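(* Let $(p_n)$ be a real sequence tending to $\infty$ and let $h$ be a gauge function satisfying $$\lim_{t\to 0}\frac{h(t)}{t}=0.$$ Then there exists $f\in B$ such that $$H_h(\mathrm{Unb}(f,(p_n)))=0.$$
   Context: The Eremenko-Lyubich class $B$ consists of all transcendental entire functions $f\colon\mathbb{C}\to\mathbb{C}$ for which the set $\mathrm{sing}(f^{-1})$ of singularities of the inverse of $f$ (which coincides with the set of critical values and finite asymptotic values of $f$) is bounded. Here $f^n$ denotes the $n$-th iterate of $f$. For a real sequence $(p_n)$ tending to $\infty$, $\mathrm{Unb}(f,(p_n))$ is the set of all $z\in\mathbb{C}$ such that $|f^n(z)|>p_n$ for infinitely many $n$. A gauge function is an increasing, continuous function $h\colon[0,\eta)\to[0,\infty)$ with $h(0)=0$, where $\eta>0$. For $A\subset\mathbb{C}$ and $\delta>0$, a $\delta$-cover of $A$ is a sequence $(A_j)_{j\in\mathbb{N}}$ of subsets of $\mathbb{C}$ with $\mathrm{diam}\, A_j<\delta$ for all $j$ and $A\subset\bigcup_j A_j$. Put $H_h^\delta(A)=\inf\{\sum_j h(\mathrm{diam}\, A_j): (A_j)\text{ is a }\delta\text{-cover of }A\}$ and $H_h(A)=\lim_{\delta\to0}H_h^\delta(A)\in[0,\infty]$, the Hausdorff measure of $A$ with respect to $h$. *)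

(* Defs.v *)
From HB Require Import structures.
From mathcomp Require Import all_boot all_order all_algebra.
From mathcomp Require Import complex.
From mathcomp Require Import all_classical all_reals all_analysis.

Set Implicit Arguments.
Unset Strict Implicit.
Unset Printing Implicit Defensive.

Import Order.TTheory GRing.Theory Num.Theory.
Import numFieldNormedType.Exports.

Local Open Scope classical_set_scope.
Local Open Scope ring_scope.

(* The complex plane is [R[i]^o] for [R : realType], a normed module over
   the field [R[i]], so that [derivable f z 1] and [derive1 f] are complex
   differentiability and the complex derivative. *)

(* The norm [`|z|] of [z : R[i]] is an element of [R[i]] with zero imaginary
   part; [cabs] is the modulus as an element of [R]. *)
Definition cabs (R : realType) (z : R[i]^o) : R := complex.Re `|z|.

Definition entire (R : realType) (f : R[i]^o -> R[i]^o) : Prop :=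
  forall z : R[i]^o, derivable f z 1.

Definition transcendental_entire (R : realType) (f : R[i]^o -> R[i]^o) : Prop :=
  entire f /\ ~ exists q : {poly R[i]}, forall z : R[i]^o, f z = q.[z].

Definition critical_values (R : realType) (f : R[i]^o -> R[i]^o) : set R[i]^o :=
  [set f z | z in [set z | derive1 f z = 0]].

Definition asymptotic_values (R : realType) (f : R[i]^o -> R[i]^o) :
    set R[i]^o :=
  [set a | exists gamma : R -> R[i]^o,
    [/\ {within `[0, +oo[, continuous gamma},
        cabs (gamma t) @[t --> +oo] --> +oo &
        f (gamma t) @[t --> +oo] --> a]].

(* For an entire function the set of singularities of the inverse consists of
   the critical values and the finite asymptotic values. *)
Definition sing_inv (R : realType) (f : R[i]^o -> R[i]^o) : set R[i]^o :=
  critical_values f `|` asymptotic_values f.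

Definition eremenko_lyubich (R : realType) (f : R[i]^o -> R[i]^o) : Prop :=
  transcendental_entire f /\ bounded_set (sing_inv f).

Definition Unb (R : realType) (f : R[i]^o -> R[i]^o) (p : nat -> R) :
    set R[i]^o :=
  [set z | forall N, exists2 n, (N <= n)%N & p n < cabs (iter n f z)].

(* A gauge function on [0, eta[ is represented by a total function whose values
   outside [0, eta[ are arbitrary. "Increasing" is read in the weak sense, which
   includes the strictly increasing functions. *)
Definition gauge_function (R : realType) (eta : R) (h : R -> R) : Prop :=
  [/\ 0 < eta,
      {in `[0, eta[ &, {homo h : x y / x <= y}},
      {within `[0, eta[, continuous h},
      {in `[0, eta[, forall t, 0 <= h t} &
      h 0 = 0].

(* Adding 0 to the set of distances only makes the diameter of the empty set
   equal to 0. Unbounded sets have diameter +oo. *)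
Definition diam (R : realType) (A : set R[i]^o) : \bar R :=
  ereal_sup (0%E |` [set (cabs (x - y))%:E | x in A & y in A]).

Definition delta_cover (R : realType) (delta : R) (A : set R[i]^o)
    (U : nat -> set R[i]^o) : Prop :=
  (forall j, (diam (U j) < delta%:E)%E) /\ A `<=` \bigcup_j U j.

(* Every [U j] in a [delta]-cover has finite diameter, so [fine] loses nothing.
   If [h] is a gauge function on [0, eta[, the value is only meaningful for
   [delta <= eta], and only such [delta] matter for [hausdorff_measure]. *)
Definition hausdorff_premeasure (R : realType) (h : R -> R) (delta : R)
    (A : set R[i]^o) : \bar R :=
  ereal_inf [set (\sum_(0 <= j <oo) (h (fine (diam (U j))))%:E)%E
            | U in delta_cover delta A].

Definition hausdorff_measure (R : realType) (h : R -> R) (A : set R[i]^o)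
    : \bar R :=
  lim (hausdorff_premeasure h delta A @[delta --> 0^'+]).

(* The limit above always exists, so [lim] is never a default value. *)
Lemma is_cvg_hausdorff_premeasure (R : realType) (h : R -> R) (A : set R[i]^o) :
  cvg (hausdorff_premeasure h delta A @[delta --> 0^'+]).
Proof.
apply: (@nonincreasing_at_right_is_cvge _ _ _); near=> e => x y _ _ xy.
apply: ereal_inf_le_tmp => _ [U [Ux AU] <-]; exists U => //; split => // j.
by apply: (lt_le_trans (Ux j)); rewrite lee_fin.
Unshelve. all: by end_near. Qed.

(* Main.v *)
Require Import Defs.
From mathcomp Require Import all_boot all_order all_algebra.
From mathcomp Require Import complex.
From mathcomp Require Import all_classical all_reals all_analysis.
From mathcomp Require Import measurable_realfun.
From mathcomp Require Import ring lra zify.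
Set Implicit Arguments.
Unset Strict Implicit.
Unset Printing Implicit Defensive.
Import Order.TTheory GRing.Theory Num.Theory.
Import numFieldNormedType.Exports.
Import Normc.
Local Open Scope classical_set_scope.
Local Open Scope ring_scope.

(** The gauge only has to beat the function t, so it is enough to cover the
    points whose orbit exceeds [p n] infinitely often by countably many sets
    whose diameters are small while the sum of the diameters is controlled.  If
    [h t <= theta * t] for [t <= D], a finite cover by sets of diameter at most
    [D] and total diameter [S] costs at most [theta * S].  Hence it suffices to
    split the set into pieces [m = 0, 1, ...] such that the total diameter [S m]
    of some cover of piece [m] does not depend on the function, while the
    largest single diameter [D m] is as small as desired: first [S m] is known,
    then [theta m] and [D m] are chosen, and only then the function.

    The function is obtained from a conformal map [X] of a half strip that
    grows as slowly as desired, [X s = 3 + sum_k s / (s + tau k)] with a fast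
    sequence [tau].  With [phi s = exp (exp s)], the Cauchy integral of
    [phi o X^-1] along the boundary of the tract, which is the image of the half
    strip under [X], is an entire function: it is bounded off the tract
    ([Fent_outside_le]), and inside it differs from [phi o X^-1] by a bounded
    Lipschitz error ([Fent_inside], [Eerr_le], [Eerr_lip]).  These bounds do not
    depend on [tau].  They rest on Cauchy's formula for rectangles
    ([cauchy_formula]) and on the fact that the difference quotients of [X] are
    almost real and vary by bounded factors over unit distances ([Yk_ge],
    [yk_ratio], [Xk_local_surj]).  Dividing by a large
    constant gives [fent], with values of modulus at most 1/2 off the tract and
    on the disc of radius 2.

    Where [fent] has modulus at least 1 it expands at a definite rate
    ([fent_expand]).  So there are no critical values outside the unit disc, and
    no asymptotic values outside the disc of radius 2: along an asymptotic path
    the image would be almost constant, and expansion would keep the path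
    bounded ([asymptotic_le]).  A nonconstant polynomial is unbounded on every
    ray, whereas [fent] is bounded on the negative axis; so it is transcendental.

    An orbit that leaves the tract is trapped in the unit disc, so an orbit in
    [Unb] stays in the tract.  Let [N m] be an index from which on [p >= m].  If
    the modulus of [f^n z] has integer part [m] and exceeds [p n] then
    [n < N (m+1)]; taking the least such [n] moreover keeps the moduli of the
    earlier iterates below [m+1] ([Unb_level]).  The points of the tract of
    modulus between [m] and [m+1] are covered by images of boxes of the half strip;
    their diameters are bounded by the derivative of [X] on the real axis, so
    their sum telescopes to a multiple of [m] ([sum_weight], [base_cover]).  One
    pull back multiplies the sum by a further multiple of [m]: the preimage in a
    box splits into about [exp (Re s)] pieces, each contracted by
    [exp (- Re s)] ([box_pull], [level_cover]).  Since [n < N (m+1)], the total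
    diameter is bounded by a number [S m] that involves [p] only.  The single
    diameters are governed by the derivative of [X] at the places where
    [|X| >= m], which is at most [1 / tau (m - 4)] up to a factor depending on [m] only
    ([yk_far]). *)

Local Notation cRe := complex.Re.
Local Notation cIm := complex.Im.

(** * The modulus and the complex exponential *)

Section Modulus.
Variable R : realType.
Implicit Types z w : R[i].

Lemma cabsE (z : R[i]^o) : cabs z = normc z.
Proof. by []. Qed.

Lemma normcE_ReIm z : normc z = Num.sqrt (cRe z ^+ 2 + cIm z ^+ 2).
Proof. by case: z. Qed.

Lemma normc_ge0 z : 0 <= normc z.
Proof. by rewrite normcE_ReIm sqrtr_ge0. Qed.

Lemma normr_normc z : `|z| = (normc z)%:C%C.
Proof. by []. Qed.

Lemma normcB z w : normc (z - w) = normc (w - z).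
Proof. by rewrite -normcN opprB. Qed.

Lemma normc_eq0 z : (normc z == 0) = (z == 0).
Proof.
apply/eqP/eqP => [/eq0_normc //|->]; exact: normc0.
Qed.

Lemma normc_gt0 z : (0 < normc z) = (z != 0).
Proof. by rewrite lt_neqAle normc_ge0 andbT eq_sym normc_eq0. Qed.

Lemma normc_real (x : R) : normc x%:C%C = `|x|.
Proof. by rewrite /= expr0n addr0 sqrtr_sqr. Qed.

Lemma Re_le_normc z : `|cRe z| <= normc z.
Proof.
by rewrite normcE_ReIm -sqrtr_sqr ler_wsqrtr// lerDl sqr_ge0.
Qed.

Lemma Im_le_normc z : `|cIm z| <= normc z.
Proof.
by rewrite normcE_ReIm -sqrtr_sqr ler_wsqrtr// lerDr sqr_ge0.
Qed.

Lemma normc_le_ReIm z : normc z <= `|cRe z| + `|cIm z|.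
Proof.
rewrite normcE_ReIm -[leRHS]ger0_norm ?addr_ge0// -sqrtr_sqr ler_wsqrtr//.
rewrite sqrrD !real_normK ?num_real// -addrA lerD2l lerDr.
by rewrite mulrn_wge0// mulr_ge0.
Qed.

Lemma normc_sqr z : normc z ^+ 2 = cRe z ^+ 2 + cIm z ^+ 2.
Proof. by rewrite normcE_ReIm sqr_sqrtr// addr_ge0// sqr_ge0. Qed.

Lemma le_normcB z w : normc (z - w) <= normc z + normc w.
Proof. by rewrite -(normcN w) le_normcD. Qed.

Lemma normcBD z w : normc z <= normc (z - w) + normc w.
Proof. by rewrite -{1}(subrK w z) le_normcD. Qed.

Lemma normc_div z w : normc (z / w) = normc z / normc w.
Proof. by rewrite normcM normcV. Qed.

Lemma normcX z n : normc (z ^+ n) = normc z ^+ n.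
Proof. by elim: n => [|n IH]; rewrite ?expr0 ?normc1// !exprS normcM IH. Qed.

Lemma normc_i : normc 'i%C = 1 :> R.
Proof. by rewrite /= expr0n expr1n add0r sqrtr1. Qed.

Lemma cReD z w : cRe (z + w) = cRe z + cRe w.
Proof. by case: z w => [? ?] [? ?]. Qed.
Lemma cImD z w : cIm (z + w) = cIm z + cIm w.
Proof. by case: z w => [? ?] [? ?]. Qed.
Lemma cReN z : cRe (- z) = - cRe z.
Proof. by case: z. Qed.
Lemma cImN z : cIm (- z) = - cIm z.
Proof. by case: z. Qed.
Lemma cReB z w : cRe (z - w) = cRe z - cRe w.
Proof. by rewrite cReD cReN. Qed.
Lemma cImB z w : cIm (z - w) = cIm z - cIm w.
Proof. by rewrite cImD cImN. Qed.
Lemma cReM z w : cRe (z * w) =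
  cRe z * cRe w - cIm z * cIm w.
Proof. by case: z w => [? ?] [? ?]. Qed.
Lemma cImM z w : cIm (z * w) =
  cRe z * cIm w + cIm z * cRe w.
Proof. by case: z w => [? ?] [? ?]. Qed.

Lemma eq_ReIm z w : cRe z = cRe w -> cIm z = cIm w -> z = w.
Proof. by case: z w => [? ?] [? ?] /= -> ->. Qed.

Lemma normc_triangle_lower z w : normc z - normc w <= normc (z - w).
Proof. by rewrite lerBlDr normcBD. Qed.

Lemma cRe_scal (x : R) z : cRe (x%:C%C * z) = x * cRe z.
Proof. by case: z => a b /=; rewrite mul0r subr0. Qed.
Lemma cIm_scal (x : R) z : cIm (x%:C%C * z) = x * cIm z.
Proof. by case: z => a b /=; rewrite mul0r addr0. Qed.

Definition cexp z : R[i] :=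
  Complex (expR (cRe z) * cos (cIm z)) (expR (cRe z) * sin (cIm z)).

Lemma cexpD z w : cexp (z + w) = cexp z * cexp w.
Proof.
apply: eq_ReIm; rewrite ?cReM ?cImM /= cReD cImD expRD ?cosD ?sinD; ring.
Qed.

Lemma normc_cexp z : normc (cexp z) = expR (cRe z).
Proof.
by rewrite normcE_ReIm /= !exprMn -mulrDr cos2Dsin2 mulr1 sqrtr_sqr ger0_norm ?expR_ge0.
Qed.

Lemma sin_le_norm (x : R) : `|sin x| <= `|x|.
Proof.
wlog x0 : x / 0 <= x => [H|].
  have [/H//|x0] := leP 0 x.
  by rewrite -normrN -sinN -(normrN x); apply: H; rewrite oppr_ge0 ltW.
have [c _] := MVT_segment x0 (fun y _ => is_derive_sin y)
  (continuous_subspaceT (@continuous_sin R)).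
rewrite sin0 !subr0 => ->; rewrite normrM -[leRHS]mul1r ler_wpM2r//.
exact: cos_max.
Qed.

Lemma one_sub_cos_le (x : R) : `|cos x - 1| <= x ^+ 2 / 2.
Proof.
have -> : cos x - 1 = - (2 * sin (x / 2) ^+ 2).
  rewrite {1}(_ : x = (x / 2) *+ 2); last by rewrite -mulr_natr divfK.
  rewrite cos_mulr2n cos2sin2 -mulr_natr; ring.
rewrite normrN normrM ger0_norm// normrX.
have := sin_le_norm (x / 2) => H.
apply: (@le_trans _ _ (2 * `|x / 2| ^+ 2)).
  by rewrite ler_wpM2l// ler_sqr ?nnegrE.
by rewrite real_normK ?num_real//; lra.
Qed.

Lemma sin_sub_le (x : R) : `|x| <= 1 -> `|sin x - x| <= x ^+ 2 / 2.
Proof.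
have H (y : R) : 0 <= y -> y <= 1 -> `|sin y - y| <= y ^+ 2 / 2.
  move=> y0 y1.
  have d (u : R) : u \in `]0, y[%R -> is_derive u 1 (sin \- id) (cos u - 1).
    by move=> _; apply: is_deriveB.
  have cn : {within `[0, y], continuous (sin \- id : R -> R)}.
    apply: continuous_subspaceT => u.
    by apply: cvgB; [exact: continuous_sin|exact: cvg_id].
  have [c cI] := MVT_segment y0 d cn; rewrite /= sin0 !subr0 => ->; rewrite normrM (ger0_norm y0).
  have := one_sub_cos_le c.
  have /andP[c0 cy] : 0 <= c <= y by move: cI; rewrite in_itv.
  have : c ^+ 2 <= c by rewrite expr2 ler_piMl//; exact: le_trans y1.
  move=> h1 h2; rewrite expr2; nra.
move=> x1; have [x0|x0] := leP 0 x; first by apply: H => //; rewrite -(ger0_norm x0).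
have := H (- x); rewrite sinN -opprD normrN sqrrN; apply.
- by rewrite oppr_ge0 ltW.
- by rewrite -(ltr0_norm x0).
Qed.

Lemma expR_rem (x : R) : `|x| <= 2^-1 -> `|expR x - 1 - x| <= 2 * x ^+ 2.
Proof.
rewrite ler_norml => /andP[x1 x2].
have h1 := expR_ge1Dx x; have h2 := expR_ge1Dx (- x).
have h3 : expR x * expR (- x) = 1 by exact: expRxMexpNx_1.
rewrite ger0_norm; last lra.
have e0 := expR_gt0 x.
have H : expR x * (1 - x) <= 1 by rewrite -h3 ler_wpM2l ?expR_ge0//; lra.
suff : expR x <= 1 + x + 2 * x ^+ 2 by lra.
rewrite -(@ler_pM2r _ (1 - x)); last lra.
apply: le_trans H _.
rewrite (_ : _ * (1 - x) = 1 + x ^+ 2 * (1 - 2 * x)); last by ring.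
by rewrite lerDl mulr_ge0// ?sqr_ge0//; lra.
Qed.

Lemma expR_half_lt2 : expR (2^-1 : R) <= 2.
Proof.
have h2 := expR_ge1Dx (- (2^-1) : R).
have h3 : expR (2^-1) * expR (- 2^-1) = 1 :> R by exact: expRxMexpNx_1.
have e0 := expR_gt0 (2^-1 : R); nra.
Qed.

(** The only analytic input on the exponential: every derivative below is
    derived from this second order remainder. *)
Lemma cexp_rem z : normc z <= 2^-1 -> normc (cexp z - 1 - z) <= 8 * normc z ^+ 2.
Proof.
case: z => x y hz.
have hx : `|x| <= 2^-1 by apply: le_trans hz; exact: (Re_le_normc (Complex x y)).
have hy : `|y| <= 2^-1 by apply: le_trans hz; exact: (Im_le_normc (Complex x y)).
have ex2 : expR x <= 2.
  apply: le_trans expR_half_lt2; rewrite ler_expR; exact: le_trans (ler_norm _) hx.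
have e0 := expR_gt0 x.
have r1 := expR_rem hx.
have c1 := one_sub_cos_le y.
have s1 : `|sin y - y| <= y ^+ 2 / 2 by apply: sin_sub_le; lra.
rewrite normc_sqr; apply: le_trans (normc_le_ReIm _) _ => /=.
have -> : expR x * cos y - 1 - x = (expR x - 1 - x) + expR x * (cos y - 1) by ring.
have -> : expR x * sin y + - 0 - y = expR x * (sin y - y) + (expR x - 1 - x) * y + x * y by ring.
have A : `|expR x - 1 - x + expR x * (cos y - 1)| <= 2 * x ^+ 2 + 2 * (y ^+ 2 / 2).
  apply: le_trans (ler_normD _ _) _; apply: lerD => //.
  by rewrite normrM (ger0_norm (ltW e0)); apply: ler_pM => //; exact: ltW.
have B : `|expR x * (sin y - y) + (expR x - 1 - x) * y + x * y| <=
   2 * (y ^+ 2 / 2) + (2 * x ^+ 2) * 2^-1 + (x ^+ 2 + y ^+ 2) / 2.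
  apply: le_trans (ler_normD _ _) _; apply: lerD.
    apply: le_trans (ler_normD _ _) _; apply: lerD.
      by rewrite normrM (ger0_norm (ltW e0)); apply: ler_pM => //; exact: ltW.
    by rewrite normrM; apply: ler_pM.
  rewrite normrM.
  have : 0 <= (`|x| - `|y|) ^+ 2 by exact: sqr_ge0.
  by rewrite sqrrB !real_normK ?num_real// -mulr_natr; lra.
have := sqr_ge0 x; have := sqr_ge0 y; lra.
Qed.

End Modulus.

(** * Uniform quadratic Taylor remainders *)

Section Holomorphy.
Variable R : realType.
Implicit Types (z w s : R[i]) (Q : set R[i]) (f g : R[i] -> R[i]).

(** Holomorphy with one constant for the values, the derivative and the Taylor
    remainder.  In contrast with pointwise differentiability this passes under
    integral signs, and it makes Cauchy's theorem elementary. *)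
Definition hol Q (M : R) g g' := forall s s', Q s -> Q s' ->
  [/\ normc (g s) <= M, normc (g' s) <= M &
      normc (g s' - g s - (s' - s) * g' s) <= M * normc (s' - s) ^+ 2].

Lemma hol_mono Q M M' g g' : M <= M' -> hol Q M g g' -> hol Q M' g g'.
Proof.
move=> MM' H s s' Qs Qs'; have [h1 h2 h3] := H s s' Qs Qs'.
split; [exact: le_trans MM'|exact: le_trans MM'|].
by apply: le_trans h3 _; rewrite ler_wpM2r ?sqr_ge0.
Qed.

Lemma hol_sub Q Q' M g g' : Q' `<=` Q -> hol Q M g g' -> hol Q' M g g'.
Proof. by move=> QQ H s s' Qs Qs'; apply: H; exact: QQ. Qed.

Lemma hol_ge0 Q M g g' s : Q s -> hol Q M g g' -> 0 <= M.
Proof. by move=> Qs /(_ _ _ Qs Qs)[h _ _]; exact: le_trans (normc_ge0 _) h. Qed.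

Lemma hol_ext Q M f f' g g' : (forall s, Q s -> f s = g s) ->
  (forall s, Q s -> f' s = g' s) -> hol Q M f f' -> hol Q M g g'.
Proof.
move=> e e' H s s' Qs Qs'; rewrite -!e// -!e'//; exact: H.
Qed.

(** Close points are handled by the Taylor bound, distant ones by the bound on
    the values. *)
Lemma hol_lip Q M g g' s s' : hol Q M g g' -> Q s -> Q s' ->
  normc (g s' - g s) <= 2 * M * normc (s' - s).
Proof.
move=> H Qs Qs'; have [h1 h2 h3] := H s s' Qs Qs'.
have [h1' _ _] := H s' s Qs' Qs.
have M0 := hol_ge0 Qs H; set u := normc (s' - s) in h3 *.
have u0 : 0 <= u := normc_ge0 _.
have [u1|u1] := leP u 1; last first.
  have := le_normcB (g s') (g s); nra.
have e : g s' - g s = (g s' - g s - (s' - s) * g' s) + (s' - s) * g' s by ring.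
rewrite e; apply: le_trans (le_normcD _ _) _; rewrite normcM -/u.
have : u * normc (g' s) <= u * M by rewrite ler_wpM2l.
have : M * u ^+ 2 <= M * u by rewrite ler_wpM2l// expr2 ler_piMl.
lra.
Qed.

(** Adding the expansions at the two points cancels the values of [g]. *)
Lemma hol_deriv_lip Q M g g' s s' : hol Q M g g' -> Q s -> Q s' ->
  normc (g' s' - g' s) <= 2 * M * normc (s' - s).
Proof.
move=> H Qs Qs'; have [h1 h2 h3] := H s s' Qs Qs'.
have [_ _ h4] := H s' s Qs' Qs.
have [->|ss] := eqVneq s' s; first by rewrite !subrr normc0 mulr0.
have u0 : 0 < normc (s' - s) by rewrite normc_gt0 subr_eq0.
rewrite -(ler_pM2l u0) -normcM.
have -> : (s' - s) * (g' s' - g' s) = (g s' - g s - (s' - s) * g' s) +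
   (g s - g s' - (s - s') * g' s') by ring.
apply: le_trans (le_normcD _ _) _.
rewrite (normcB s s') in h4.
set u := normc (s' - s) in h3 h4 *.
have -> : u * (2 * M * u) = M * u ^+ 2 + M * u ^+ 2 by ring.
exact: lerD.
Qed.

Lemma hol_cst Q (c : R[i]) : hol Q (normc c) (fun=> c) (fun=> 0).
Proof.
move=> s s' _ _; rewrite subrr mulr0 subr0 normc0; split => //; first exact: normc_ge0.
by rewrite mulr_ge0 ?normc_ge0 ?sqr_ge0.
Qed.

Lemma hol_id Q M : 1 <= M -> (forall s, Q s -> normc s <= M) -> hol Q M id (fun=> 1).
Proof.
move=> M1 H s s' Qs Qs'; rewrite mulr1 subrr normc0 normc1; split => //; first exact: H.
by rewrite mulr_ge0 ?sqr_ge0//; lra.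
Qed.

Lemma hol_add Q M N f f' g g' : hol Q M f f' -> hol Q N g g' ->
  hol Q (M + N) (fun s => f s + g s) (fun s => f' s + g' s).
Proof.
move=> Hf Hg s s' Qs Qs'; have [f1 f2 f3] := Hf _ _ Qs Qs'.
have [g1 g2 g3] := Hg _ _ Qs Qs'; split.
- by apply: le_trans (le_normcD _ _) _; exact: lerD.
- by apply: le_trans (le_normcD _ _) _; exact: lerD.
have -> : f s' + g s' - (f s + g s) - (s' - s) * (f' s + g' s) =
  (f s' - f s - (s' - s) * f' s) + (g s' - g s - (s' - s) * g' s) by ring.
by apply: le_trans (le_normcD _ _) _; rewrite [leRHS]mulrDl; exact: lerD.
Qed.

Lemma hol_mul Q M N f f' g g' : hol Q M f f' -> hol Q N g g' ->
  hol Q (6 * (M * N)) (fun s => f s * g s) (fun s => f' s * g s + f s * g' s).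
Proof.
move=> Hf Hg s s' Qs Qs'; have [f1 f2 f3] := Hf _ _ Qs Qs'.
have [g1 g2 g3] := Hg _ _ Qs Qs'.
have M0 := hol_ge0 Qs Hf; have N0 := hol_ge0 Qs Hg.
have lf := hol_lip Hf Qs Qs'; have lg := hol_lip Hg Qs Qs'.
have MN0 : 0 <= M * N by exact: mulr_ge0.
have fg : normc (f s) * normc (g s) <= M * N by apply: ler_pM; rewrite ?normc_ge0.
have f'g : normc (f' s) * normc (g s) <= M * N by apply: ler_pM; rewrite ?normc_ge0.
have fg' : normc (f s) * normc (g' s) <= M * N by apply: ler_pM; rewrite ?normc_ge0.
split.
- by rewrite normcM; lra.
- by apply: le_trans (le_normcD _ _) _; rewrite !normcM; lra.
set u := normc (s' - s) in f3 g3 lf lg *.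
have -> : f s' * g s' - f s * g s - (s' - s) * (f' s * g s + f s * g' s) =
  f s * (g s' - g s - (s' - s) * g' s) + (f s' - f s - (s' - s) * f' s) * g s
  + (f s' - f s) * (g s' - g s) by ring.
have -> : 6 * (M * N) * u ^+ 2 = M * (N * u ^+ 2) + (M * u ^+ 2) * N +
  (2 * M * u) * (2 * N * u) by ring.
apply: le_trans (le_normcD _ _) _; apply: lerD; last first.
  by rewrite normcM; apply: ler_pM; rewrite ?normc_ge0.
apply: le_trans (le_normcD _ _) _; apply: lerD; rewrite normcM;
  by apply: ler_pM; rewrite ?normc_ge0.
Qed.

(** The numerator of the remainder is [(s' - s) g'(s) (g s' - g s)] minus the
    remainder of [g] times [g s], and both are quadratic. *)
Lemma hol_inv Q M (e : R) g g' : 0 < e -> (forall s, Q s -> e <= normc (g s)) ->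
  hol Q M g g' ->
  hol Q (e^-1 + M / e ^+ 2 + 3 * M ^+ 2 / e ^+ 3) (fun s => (g s)^-1)
    (fun s => - (g' s / g s ^+ 2)).
Proof.
move=> e0 ge H s s' Qs Qs'; have [h1 h2 h3] := H _ _ Qs Qs'.
have M0 := hol_ge0 Qs H; have lg := hol_lip H Qs Qs'.
have gs := ge _ Qs; have gs' := ge _ Qs'.
have n0 w : Q w -> g w != 0.
  by move=> /ge h; rewrite -normc_gt0; exact: lt_le_trans h.
have [gn gn'] := (n0 _ Qs, n0 _ Qs').
have p1 : 0 <= e^-1 by rewrite invr_ge0 ltW.
have p2 : 0 <= M / e ^+ 2 by rewrite divr_ge0// exprn_ge0// ltW.
have p3 : 0 <= 3 * M ^+ 2 / e ^+ 3.
  by rewrite divr_ge0 ?mulr_ge0 ?exprn_ge0// ltW.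
have i1 : (normc (g s))^-1 <= e^-1 by rewrite lef_pV2 ?posrE// (lt_le_trans e0).
have i2 : (normc (g s'))^-1 <= e^-1 by rewrite lef_pV2 ?posrE// (lt_le_trans e0).
have iV w : 0 <= (normc (g w))^-1 by rewrite invr_ge0 normc_ge0.
split.
- by rewrite normcV; lra.
- rewrite normcN normc_div normcX -exprVn.
  have : normc (g' s) * (normc (g s))^-1 ^+ 2 <= M / e ^+ 2.
    rewrite -exprVn; apply: ler_pM; rewrite ?normc_ge0 ?exprn_ge0//.
    by rewrite ler_sqr ?nnegrE.
  lra.
set u := normc (s' - s) in h3 lg *.
have -> : (g s')^-1 - (g s)^-1 - (s' - s) * - (g' s / g s ^+ 2) =
  ((s' - s) * g' s * (g s' - g s) - (g s' - g s - (s' - s) * g' s) * g s)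
  / (g s ^+ 2 * g s').
  by field; rewrite gn gn'.
apply: (@le_trans _ _ (3 * M ^+ 2 / e ^+ 3 * u ^+ 2)); last first.
  by rewrite ler_wpM2r ?sqr_ge0//; lra.
rewrite normc_div [normc (_ ^+ 2 * _)]normcM normcX.
have -> : 3 * M ^+ 2 / e ^+ 3 * u ^+ 2 =
   (u * M * (2 * M * u) + M * u ^+ 2 * M) * (e^-1 ^+ 2 * e^-1) by field; lra.
rewrite invfM -exprVn.
apply: ler_pM; rewrite ?normc_ge0 ?mulr_ge0 ?exprn_ge0//.
- apply: le_trans (le_normcB _ _) _; rewrite !normcM; apply: lerD.
    apply: ler_pM; rewrite ?mulr_ge0 ?normc_ge0//.
    by apply: ler_pM; rewrite ?normc_ge0.
  by apply: ler_pM; rewrite ?normc_ge0.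
- apply: ler_pM; rewrite ?exprn_ge0//.
  by rewrite ler_sqr ?nnegrE.
Qed.

Lemma hol_cexp Q M g g' : hol Q M g g' ->
  exists N, hol Q N (fun s => cexp (g s)) (fun s => g' s * cexp (g s)).
Proof.
move=> H; pose K := 8 + 4 * (expR (2 * M) + 1 + 2 * M).
exists (expR M * (1 + M + K * (2 * M) ^+ 2 + M)) => s s' Qs Qs'.
have [h1 h2 h3] := H _ _ Qs Qs'; have [h1' _ _] := H _ _ Qs' Qs.
have M0 := hol_ge0 Qs H; have lg := hol_lip H Qs Qs'.
have E0 := expR_gt0 (2 * M).
have K0 : 0 <= K by rewrite /K; lra.
have eM : normc (cexp (g s)) <= expR M.
  rewrite normc_cexp ler_expR; apply: le_trans h1.
  exact: le_trans (ler_norm _) (Re_le_normc _).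
have P0 : 0 <= K * (2 * M) ^+ 2 by rewrite mulr_ge0 ?sqr_ge0.
have EM0 := expR_gt0 M.
split.
- by apply: le_trans eM _; rewrite ler_peMr ?(ltW EM0)//; lra.
- rewrite normcM mulrC; apply: ler_pM; rewrite ?normc_ge0//; lra.
set u := normc (s' - s) in h3 lg *.
set d := g s' - g s in h3 lg *.
have -> : cexp (g s') - cexp (g s) - (s' - s) * (g' s * cexp (g s)) =
   cexp (g s) * ((cexp d - 1 - d) + (d - (s' - s) * g' s)).
  have -> : cexp (g s') = cexp (g s) * cexp d by rewrite -cexpD; congr cexp; rewrite /d; ring.
  ring.
have d2M : normc d <= 2 * M by apply: le_trans (le_normcB _ _) _; lra.
have B : normc (cexp d - 1 - d) <= K * normc d ^+ 2.
  have [dh|dh] := leP (normc d) 2^-1.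
    apply: le_trans (cexp_rem dh) _; rewrite ler_wpM2r ?sqr_ge0// /K; lra.
  have c1 : normc (cexp d) <= expR (2 * M).
    rewrite normc_cexp ler_expR; apply: le_trans d2M.
    exact: le_trans (ler_norm _) (Re_le_normc _).
  have c2 : normc (cexp d - 1 - d) <= expR (2 * M) + 1 + 2 * M.
    apply: le_trans (le_normcB _ _) _; apply: lerD => //.
    by apply: le_trans (le_normcB _ _) _; rewrite normc1 lerD2r.
  (* for large [d] the remainder is bounded, hence at most a multiple of [d^2] *)
  have q : 4^-1 <= normc d ^+ 2.
    by have := normc_ge0 d; nra.
  apply: le_trans c2 _; rewrite /K.
  have : (expR (2 * M) + 1 + 2 * M) * 1 <= (expR (2 * M) + 1 + 2 * M) * (4 * normc d ^+ 2).
    by rewrite ler_wpM2l//; lra.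
  have := sqr_ge0 (normc d); lra.
rewrite normcM -mulrA; apply: ler_pM; rewrite ?normc_ge0//.
apply: le_trans (le_normcD _ _) _.
have u0 : 0 <= u ^+ 2 by exact: sqr_ge0.
have sq : normc d ^+ 2 <= (2 * M * u) ^+ 2.
  by rewrite ler_sqr ?nnegrE ?normc_ge0// mulr_ge0 ?normc_ge0//; lra.
have : K * normc d ^+ 2 <= K * (2 * M * u) ^+ 2 by rewrite ler_wpM2l.
have -> : K * (2 * M * u) ^+ 2 = K * (2 * M) ^+ 2 * u ^+ 2 by ring.
have : 0 <= M * u ^+ 2 by exact: mulr_ge0.
lra.
Qed.

End Holomorphy.

(** * From quadratic remainders to derivatives; integrals of complex functions *)

Section QuadraticRemainder.

(** Serves twice: over the reals it feeds the fundamental theorem of calculus,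
    over the complex numbers it gives complex differentiability. *)
Lemma is_derive_quad (K : numFieldType) (f : K^o -> K^o) (x l M d : K) :
  0 < d -> 0 <= M ->
  (forall h, `|h| < d -> `|f (h + x) - f x - h * l| <= M * `|h| ^+ 2) ->
  is_derive (x : K^o) (1 : K^o) f l.
Proof.
move=> d0 M0 H.
have C : (fun h : K => h^-1 *: ((f \o shift x) (h *: (1 : K^o)) - f x)) @ 0^' --> (l : K^o).
  apply/cvgrPdist_le => /= e e0; near=> h.
  have h0 : h != 0 by near: h; exact: nbhs_dnbhs_neq.
  have hd : `|h| < d.
    by near: h; apply/dnbhs0_lt.
  have he : `|h| < e / (M + 1).
    by near: h; apply/dnbhs0_lt; rewrite divr_gt0// ltr_wpDl.
  rewrite -normrN opprB /= -(@ler_pM2l _ `|h|) ?normr_gt0// -normrM.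
  have -> : h * (h^-1 *: (f (h *: (1 : K^o) + x) - f x) - l) = f (h + x) - f x - h * l.
    by rewrite mulrBr -[h^-1 *: _]/(h^-1 * _) mulrA divff// mul1r -[h *: 1]/(h * 1) mulr1.
  apply: le_trans (H _ hd) _; rewrite expr2 mulrCA ler_wpM2l//.
  move: (ltW he); rewrite ler_pdivlMr ?ltr_wpDl// => he'.
  by apply: le_trans he'; rewrite mulrC ler_wpM2l// lerDl.
split; last exact: cvg_lim C.
by apply/cvg_ex; exists l.
Unshelve. all: by end_near. Qed.

Lemma within_continuous_lip (R : realType) (D : set R) (f : R -> R) :
  (forall x, D x -> exists L d, 0 < d /\ forall y, D y -> `|y - x| < d ->
     `|f y - f x| <= L * `|y - x|) ->
  {within D, continuous f}.
Proof.
move=> H; apply/subspace_continuousP => x Dx.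
have [L [d [d0 Hd]]] := H _ Dx.
have L0 : 0 < `|L| + 1 by rewrite ltr_wpDl.
apply/cvgrPdist_le => e e0; rewrite near_withinE; near=> y.
move=> Dy.
have yd : `|y - x| < d.
  by near: y; rewrite near_simpl; exists d => //= y; rewrite /= distrC.
have ye : `|y - x| < e / (`|L| + 1).
  near: y; exists (e / (`|L| + 1)) => [/=|y /=]; first exact: divr_gt0.
  by rewrite distrC.
rewrite distrC; apply: le_trans (Hd _ Dy yd) _.
apply: (@le_trans _ _ ((`|L| + 1) * `|y - x|)).
  rewrite ler_wpM2r//; have := ler_norm L; lra.
by rewrite mulrC -ler_pdivlMr// ltW.
Unshelve. all: by end_near. Qed.

End QuadraticRemainder.

Section ComplexIntegral.
Context d (T : measurableType d) (R : realType) (mu : {measure set T -> \bar R}).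
Implicit Types (D : set T) (g : T -> R[i]).

Definition cmeas D g := measurable_fun D (fun t => cRe (g t)) /\
  measurable_fun D (fun t => cIm (g t)).

Definition cintegrable D g :=
  mu.-integrable D (EFin \o (fun t => cRe (g t))) /\
  mu.-integrable D (EFin \o (fun t => cIm (g t))).

Definition cint D g : R[i] :=
  Complex (Rintegral mu D (fun t => cRe (g t)))
          (Rintegral mu D (fun t => cIm (g t))).

Lemma cintegrable_le D g (b : T -> R) : measurable D -> cmeas D g ->
  (forall t, D t -> normc (g t) <= b t) -> mu.-integrable D (EFin \o b) ->
  cintegrable D g.
Proof.
move=> mD [m1 m2] gb ib; split; apply: (le_integrable mD _ _ ib).
- exact/measurable_EFinP.
- move=> t Dt /=; rewrite lee_fin; apply: le_trans (Re_le_normc _) _.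
  exact: le_trans (gb _ Dt) (ler_norm _).
- exact/measurable_EFinP.
- move=> t Dt /=; rewrite lee_fin; apply: le_trans (Im_le_normc _) _.
  exact: le_trans (gb _ Dt) (ler_norm _).
Qed.

Lemma cint_ext D f g : (forall t, D t -> f t = g t) -> cint D f = cint D g.
Proof.
by move=> fg; congr Complex; apply: eq_Rintegral => t; rewrite inE => Dt; rewrite fg.
Qed.

Lemma integrableMDl (D : set T) (a b : R) (f g : T -> R) : measurable D ->
  mu.-integrable D (EFin \o f) -> mu.-integrable D (EFin \o g) ->
  mu.-integrable D (EFin \o (fun t => a * f t + b * g t)).
Proof.
move=> mD hf hg; have := integrableD mD (integrableZl mD a hf) (integrableZl mD b hg).
by apply: (@eq_integrable _ _ _ mu) => //.
Qed.

Lemma RintegralMD (D : set T) (a b : R) (f g : T -> R) : measurable D ->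
  mu.-integrable D (EFin \o f) -> mu.-integrable D (EFin \o g) ->
  Rintegral mu D (fun t => a * f t + b * g t) =
  a * Rintegral mu D f + b * Rintegral mu D g.
Proof.
move=> mD hf hg; rewrite RintegralD//.
- by rewrite !RintegralZl.
- exact: (integrableZl mD a hf).
- exact: (integrableZl mD b hg).
Qed.

Lemma cintegrableL D (a b : R[i]) f g : measurable D -> cintegrable D f -> cintegrable D g ->
  cintegrable D (fun t => a * f t + b * g t).
Proof.
move=> mD [f1 f2] [g1 g2]; split.
- have := integrableMDl 1 1 mD (integrableMDl (cRe a) (- cIm a) mD f1 f2)
    (integrableMDl (cRe b) (- cIm b) mD g1 g2).
  apply: eq_integrable => // t _; rewrite /comp cReD !cReM; congr EFin; ring.
- have := integrableMDl 1 1 mD (integrableMDl (cRe a) (cIm a) mD f2 f1)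
    (integrableMDl (cRe b) (cIm b) mD g2 g1).
  apply: eq_integrable => // t _; rewrite /comp cImD !cImM; congr EFin; ring.
Qed.

Lemma cintL D (a b : R[i]) f g : measurable D -> cintegrable D f -> cintegrable D g ->
  cint D (fun t => a * f t + b * g t) = a * cint D f + b * cint D g.
Proof.
move=> mD [f1 f2] [g1 g2].
have i1 := integrableMDl (cRe a) (- cIm a) mD f1 f2.
have i2 := integrableMDl (cRe b) (- cIm b) mD g1 g2.
have i3 := integrableMDl (cRe a) (cIm a) mD f2 f1.
have i4 := integrableMDl (cRe b) (cIm b) mD g2 g1.
apply: eq_ReIm; rewrite ?cReD ?cImD ?cReM ?cImM /=.
- rewrite -(mulNr (cIm a)) -(mulNr (cIm b)) -!RintegralMD//.
  rewrite -[LHS]mul1r -[X in X + _]mul1r -[X in _ + X]mul1r mul1r -RintegralMD//.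
  by apply: eq_Rintegral => t _; rewrite cReD !cReM; ring.
- rewrite -!RintegralMD//.
  rewrite -[X in X + _]mul1r -[X in _ + X]mul1r -RintegralMD//.
  by apply: eq_Rintegral => t _; rewrite cImD !cImM; ring.
Qed.

(** The usual rotation: [|I|^2] is the real part of the integral of [g] times the
    conjugate of [I]. *)
Lemma cint_le D g (b : T -> R) : measurable D -> cintegrable D g ->
  mu.-integrable D (EFin \o b) -> (forall t, D t -> normc (g t) <= b t) ->
  normc (cint D g) <= Rintegral mu D b.
Proof.
move=> mD [g1 g2] ib gb; set I := cint D g.
have [I0|I0] := eqVneq I 0.
  by rewrite I0 normc0; apply: Rintegral_ge0 => t /gb; apply: le_trans; exact: normc_ge0.
have nI : 0 < normc I by rewrite normc_gt0.
have -> : Rintegral mu D b = (normc I)^-1 * Rintegral mu D (fun t => normc I * b t).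
  by rewrite RintegralZl// mulKf// gt_eqF.
rewrite ler_pdivlMl// -expr2 normc_sqr !expr2.
have -> : cRe I * cRe I + cIm I * cIm I =
  Rintegral mu D (fun t => cRe I * cRe (g t) + cIm I * cIm (g t)).
  by rewrite RintegralMD.
apply: le_Rintegral => //.
- exact: integrableMDl.
- exact: (integrableZl mD (normc I) ib).
move=> t Dt; apply: (@le_trans _ _ (normc I * normc (g t))); last first.
  by rewrite ler_wpM2l ?normc_ge0//; exact: gb.
rewrite -[normc I](_ : normc (Complex (cRe I) (- cIm I)) = _); last first.
  by rewrite !normcE_ReIm /= sqrrN.
rewrite -normcM; apply: le_trans (Re_le_normc _); apply: le_trans (ler_norm _).
by rewrite cReM /=; lra.
Qed.

End ComplexIntegral.

Section HolUnderIntegral.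
Context d (T : measurableType d) (R : realType) (mu : {measure set T -> \bar R}).

(** Differentiation under the integral sign.  Each clause of [hol] is an
    inequality between integrands, so integrating the constants is enough. *)
Lemma hol_cint (D : set T) (Q : set R[i]) (k k' : T -> R[i] -> R[i]) (M : T -> R) :
  measurable D -> mu.-integrable D (EFin \o M) ->
  (forall t, D t -> hol Q (M t) (k t) (k' t)) ->
  (forall s, Q s -> cmeas D (k ^~ s) /\ cmeas D (k' ^~ s)) ->
  hol Q (Rintegral mu D M) (fun s => cint mu D (k ^~ s)) (fun s => cint mu D (k' ^~ s)).
Proof.
move=> mD iM H mk.
have ik s : Q s -> cintegrable mu D (k ^~ s).
  move=> Qs; apply: (cintegrable_le mD _ _ iM); first exact: (mk _ Qs).1.
  by move=> t Dt; have [] := H t Dt s s Qs Qs.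
have ik' s : Q s -> cintegrable mu D (k' ^~ s).
  move=> Qs; apply: (cintegrable_le mD _ _ iM); first exact: (mk _ Qs).2.
  by move=> t Dt; have [] := H t Dt s s Qs Qs.
move=> s s' Qs Qs'; split.
- apply: cint_le => //; first exact: ik.
  by move=> t Dt; have [] := H t Dt s s Qs Qs.
- apply: cint_le => //; first exact: ik'.
  by move=> t Dt; have [] := H t Dt s s Qs Qs.
have i1 := cintegrableL 1 (-1) mD (ik _ Qs') (ik _ Qs).
have i2 := cintegrableL 1 (- (s' - s)) mD i1 (ik' _ Qs).
have e1 : cint mu D (k ^~ s') - cint mu D (k ^~ s) - (s' - s) * cint mu D (k' ^~ s)
  = cint mu D (fun t => 1 * (1 * k t s' + -1 * k t s) + - (s' - s) * k' t s).
  by rewrite (cintL _ _ mD i1 (ik' _ Qs)) (cintL _ _ mD (ik _ Qs') (ik _ Qs)); ring.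
have -> : Rintegral mu D M * normc (s' - s) ^+ 2 =
   Rintegral mu D (fun t => M t * normc (s' - s) ^+ 2).
  by rewrite RintegralZr.
rewrite e1; apply: cint_le => //.
  have := integrableZl mD (normc (s' - s) ^+ 2) iM.
  by apply: eq_integrable => // t _ /=; rewrite -EFinM mulrC.
move=> t Dt; have [_ _] := H t Dt s s' Qs Qs'; rewrite (_ : _ - _ = 1 * (1 * k t s' + -1 * k t s) + - (s' - s) * k' t s)//.
ring.
Qed.

End HolUnderIntegral.

Section LineIntegral.
Variable R : realType.
Notation leb := (@lebesgue_measure R).
Implicit Types (Q : set R[i]) (c e : R[i]) (D : set R).

Definition ray c e (t : R) : R[i] := c + t%:C%C * e.

(** Locally Lipschitz curves: enough regularity for measurability and
    integrability, and inherited from [hol] along lines. *)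
Definition clip D (g : R -> R[i]) := forall x, D x -> exists L d, 0 < d /\
  forall y, D y -> `|y - x| < d -> normc (g y - g x) <= L * `|y - x|.

Lemma clip_continuous D g : clip D g ->
  {within D, continuous (fun t => cRe (g t))} /\
  {within D, continuous (fun t => cIm (g t))}.
Proof.
move=> H; split; apply: within_continuous_lip => x Dx;
  have [L [d [d0 Hd]]] := H _ Dx; exists L, d; split => // y Dy yx;
  apply: le_trans (Hd _ Dy yx); rewrite -?cReB -?cImB.
- exact: Re_le_normc.
- exact: Im_le_normc.
Qed.

Lemma clip_cmeas D g : measurable D -> clip D g -> cmeas D g.
Proof.
by move=> mD /clip_continuous[c1 c2]; split; apply: subspace_continuous_measurable_fun.
Qed.

Lemma clip_cintegrable (a b : R) g : clip `[a, b] g -> cintegrable leb `[a, b] g.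
Proof.
move=> /clip_continuous[c1 c2]; split; apply: continuous_compact_integrable => //;
  exact: segment_compact.
Qed.

Lemma rayB c e t t' : ray c e t - ray c e t' = (t - t')%:C%C * e.
Proof. by rewrite /ray rmorphB /=; ring. Qed.

Lemma clip_ray Q M D c e g g' : hol Q M g g' -> (forall t, D t -> Q (ray c e t)) ->
  clip D (fun t => g (ray c e t)).
Proof.
move=> H DQ x Dx; exists (2 * M * normc e), 1; split => // y Dy _.
apply: le_trans (hol_lip H (DQ _ Dx) (DQ _ Dy)) _.
by rewrite rayB normcM normc_real mulrA mulrAC.
Qed.

Lemma clip_ray_deriv Q M D c e g g' : hol Q M g g' -> (forall t, D t -> Q (ray c e t)) ->
  clip D (fun t => g' (ray c e t)).
Proof.
move=> H DQ x Dx; exists (2 * M * normc e), 1; split => // y Dy _.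
apply: le_trans (hol_deriv_lip H (DQ _ Dx) (DQ _ Dy)) _.
by rewrite rayB normcM normc_real mulrA mulrAC.
Qed.

Lemma clip_scale D (e : R[i]) (g : R -> R[i]) : clip D g -> clip D (fun t => e * g t).
Proof.
move=> H x Dx; have [L [d [d0 Hd]]] := H x Dx; exists (normc e * L), d; split => // y Dy yx.
by rewrite -mulrBr normcM -mulrA ler_wpM2l ?normc_ge0//; exact: Hd.
Qed.

Lemma clip_add D (f g : R -> R[i]) : clip D f -> clip D g -> clip D (fun t => f t + g t).
Proof.
move=> Hf Hg x Dx; have [L [d [d0 Hd]]] := Hf x Dx; have [L' [d' [d0' Hd']]] := Hg x Dx.
exists (L + L'), (Num.min d d'); split; first by rewrite lt_min d0.
move=> y Dy; rewrite lt_min => /andP[h1 h2].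
rewrite opprD addrACA; apply: le_trans (le_normcD _ _) _; rewrite mulrDl.
by apply: lerD; [exact: Hd|exact: Hd'].
Qed.

(** The integral of [g s ds] along a line of direction [e]; a half line is
    allowed. *)
Definition lint e c D (g : R[i] -> R[i]) : R[i] :=
  e * cint leb D (fun t => g (ray c e t)).

Lemma lint_ext e c D f g : (forall t, D t -> f (ray c e t) = g (ray c e t)) ->
  lint e c D f = lint e c D g.
Proof. by move=> fg; congr (_ * _); apply: cint_ext. Qed.

Lemma ray_is_derive Q M (P p : R[i] -> R[i]) e c (a b t : R) :
  hol Q M P p -> (forall t, `[a, b]%classic t -> Q (ray c e t)) ->
  t \in `]a, b[ -> exists2 M' : R, 0 <= M' & exists2 d : R, 0 < d & forall h : R, `|h| < d ->
  normc (P (ray c e (h + t)) - P (ray c e t) - h%:C%C * (e * p (ray c e t))) <= M' * `|h| ^+ 2.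
Proof.
move=> H HQ; rewrite in_itv /= => /andP[at1 tb].
have Qt : Q (ray c e t) by apply: HQ; rewrite /= in_itv /= !ltW.
have M0 : 0 <= M := hol_ge0 Qt H.
exists (M * normc e ^+ 2); first by rewrite mulr_ge0 ?sqr_ge0.
exists (Num.min (t - a) (b - t)); first by rewrite lt_min !subr_gt0 at1.
move=> h; rewrite lt_min => /andP[h1 h2].
have Qh : Q (ray c e (h + t)).
  by apply: HQ; rewrite /= in_itv /=; move: h1 h2; rewrite !ltr_norml => /andP[? ?] /andP[? ?]; lra.
have [_ _] := H _ _ Qt Qh.
rewrite rayB addrK normcM normc_real exprMn (mulrC (`|h| ^+ 2)) -!mulrA => H'.
exact: H'.
Qed.

Lemma line_FTC Q M (P p : R[i] -> R[i]) e c (a b : R) : a <= b ->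
  hol Q M P p -> (forall t, `[a, b]%classic t -> Q (ray c e t)) ->
  lint e c `[a, b] p = P (ray c e b) - P (ray c e a).
Proof.
move=> ab H HQ.
have [ab'|] := ltP a b; last first.
  move=> ba; have {ba ab}-> : b = a by apply/eqP; rewrite eq_le ab ba.
  by rewrite subrr /lint /cint set_itv1 !Rintegral_set1 mulr0.
have [c1 c2] := clip_continuous (clip_ray H HQ).
have cl := clip_scale e (clip_ray_deriv H HQ); have [k1 k2] := clip_continuous cl.
have -> : lint e c `[a, b] p = cint leb `[a, b] (fun t => e * p (ray c e t)).
  have ip := clip_cintegrable (clip_ray_deriv H HQ).
  rewrite -[LHS]addr0 -[X in _ + X](mul0r (cint leb `[a, b] (fun t => p (ray c e t)))).
  rewrite -cintL//; apply: cint_ext => t _; ring.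
have D1 (t : R) : t \in `]a, b[ ->
    is_derive t 1 (fun t => cRe (P (ray c e t))) (cRe (e * p (ray c e t))).
  move=> tab; have [M' M0 [d d0 Hd]] := ray_is_derive H HQ tab.
  apply: (@is_derive_quad R _ t _ M' d) => // h hd; apply: le_trans (Hd h hd).
  apply: le_trans (Re_le_normc _).
  by rewrite !cReB cRe_scal.
have D2 (t : R) : t \in `]a, b[ ->
    is_derive t 1 (fun t => cIm (P (ray c e t))) (cIm (e * p (ray c e t))).
  move=> tab; have [M' M0 [d d0 Hd]] := ray_is_derive H HQ tab.
  apply: (@is_derive_quad R _ t _ M' d) => // h hd; apply: le_trans (Hd h hd).
  apply: le_trans (Im_le_normc _).
  by rewrite !cImB cIm_scal.
apply: eq_ReIm; rewrite ?cReB ?cImB.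
- rewrite /cint /Rintegral; rewrite (continuous_FTC2 ab' k1 (F := fun t => cRe (P (ray c e t)))) //.
  + have [q1 q2 q3] := (continuous_within_itvP _ ab').1 c1; split => //.
    by move=> t /D1 [].
  + by move=> t /D1 dt; rewrite derive1E; exact: derive_val.
- rewrite /cint /Rintegral; rewrite (continuous_FTC2 ab' k2 (F := fun t => cIm (P (ray c e t)))) //.
  + have [q1 q2 q3] := (continuous_within_itvP _ ab').1 c2; split => //.
    by move=> t /D2 [].
  + by move=> t /D2 dt; rewrite derive1E; exact: derive_val.
Qed.

Lemma lint_le e c D g (b : R -> R) : measurable D ->
  cintegrable leb D (fun t => g (ray c e t)) ->
  leb.-integrable D (EFin \o b) -> (forall t, D t -> normc (g (ray c e t)) <= b t) ->
  normc (lint e c D g) <= normc e * Rintegral leb D b.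
Proof.
by move=> mD ig ib gb; rewrite normcM ler_wpM2l ?normc_ge0//; exact: cint_le.
Qed.

Lemma lint_le_cst e c (a b : R) g (B : R) : a <= b ->
  clip `[a, b] (fun t => g (ray c e t)) ->
  (forall t, `[a, b]%classic t -> normc (g (ray c e t)) <= B) ->
  normc (lint e c `[a, b] g) <= normc e * (B * (b - a)).
Proof.
move=> ab cl gB.
have -> : B * (b - a) = Rintegral leb `[a, b] (fun=> B).
  rewrite Rintegral_cst; last exact: measurable_itv.
  congr (_ * _); rewrite -[LHS]/(fine (b - a)%:E); congr fine; apply/esym.
  apply: etrans (@lebesgue_measure_itv R `[a, b]) _; rewrite /= lte_fin.
  case: ltP => // ba; have -> : b = a by apply/eqP; rewrite eq_le ab ba.
  by rewrite subrr.
apply: lint_le => //; first exact: clip_cintegrable.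
apply: continuous_compact_integrable; first exact: segment_compact.
by apply: continuous_subspaceT => x; exact: cst_continuous.
Qed.

Lemma lintL e c D (u v : R[i]) f g : measurable D ->
  cintegrable leb D (fun t => f (ray c e t)) -> cintegrable leb D (fun t => g (ray c e t)) ->
  lint e c D (fun s => u * f s + v * g s) = u * lint e c D f + v * lint e c D g.
Proof.
by move=> mD hf hg; rewrite /lint cintL//; ring.
Qed.

End LineIntegral.

(** * Cauchy's theorem on rectangles *)

Section Cauchy.
Variable R : realType.
Notation leb := (@lebesgue_measure R).
Implicit Types (f g G : R[i] -> R[i]).

Definition rect (x1 x2 y1 y2 : R) : set R[i] :=
  [set s | x1 <= cRe s <= x2 /\ y1 <= cIm s <= y2].

Definition hline (y : R) D g : R[i] := lint 1 (Complex 0 y) D g.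
Definition vline (x : R) D g : R[i] := lint 'i%C x%:C%C D g.

Lemma ray_h (y t : R) : ray (Complex 0 y) 1 t = Complex t y.
Proof. by apply: eq_ReIm; rewrite /ray ?cReD ?cImD mulr1 /= ?add0r ?addr0. Qed.
Lemma ray_v (x t : R) : ray x%:C%C 'i%C t = Complex x t.
Proof.
by apply: eq_ReIm; rewrite /ray ?cReD ?cImD ?cRe_scal ?cIm_scal /=; rewrite ?mulr0 ?mulr1 ?addr0 ?add0r.
Qed.

Definition oint (x1 x2 y1 y2 : R) g : R[i] :=
  hline y1 `[x1, x2] g + vline x2 `[y1, y2] g - hline y2 `[x1, x2] g - vline x1 `[y1, y2] g.

Definition sides (x1 x2 y1 y2 : R) : set R[i] :=
  [set s | rect x1 x2 y1 y2 s /\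
    [\/ cRe s = x1, cRe s = x2, cIm s = y1 | cIm s = y2]].

Let side_sum_alg (u v a b c d a' b' c' d' : R[i]) :
  u * a + v * a' + (u * b + v * b') - (u * c + v * c') - (u * d + v * d') =
  u * (a + b - c - d) + v * (a' + b' - c' - d').
Proof. by ring. Qed.

Section Sides.
Variables x1 x2 y1 y2 : R.
Hypotheses (x12 : x1 <= x2) (y12 : y1 <= y2).
Let E := sides x1 x2 y1 y2.

Lemma side_h y t : y = y1 \/ y = y2 -> `[x1, x2]%classic t -> E (ray (Complex 0 y) 1 t).
Proof.
rewrite ray_h /= in_itv /= => hy tI; split; rewrite /rect /=.
  by split => //; case: hy => ->; rewrite lexx ?y12.
by case: hy => ->; [apply: Or43|apply: Or44].
Qed.

Lemma side_v x t : x = x1 \/ x = x2 -> `[y1, y2]%classic t -> E (ray x%:C%C 'i%C t).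
Proof.
rewrite ray_v /= in_itv /= => hx tI; split; rewrite /rect /=.
  by split => //; case: hx => ->; rewrite lexx ?x12.
by case: hx => ->; [apply: Or41|apply: Or42].
Qed.

Lemma oint_ext f g : (forall s, E s -> f s = g s) ->
  oint x1 x2 y1 y2 f = oint x1 x2 y1 y2 g.
Proof.
move=> fg; rewrite /oint /hline /vline.
congr (_ + _ - _ - _); apply: lint_ext => t tI; apply: fg.
- by apply: side_h => //; left.
- by apply: side_v => //; right.
- by apply: side_h => //; right.
- by apply: side_v => //; left.
Qed.

Definition eclip f :=
  (forall y, y = y1 \/ y = y2 -> clip `[x1, x2] (fun t => f (ray (Complex 0 y) 1 t))) /\
  (forall x, x = x1 \/ x = x2 -> clip `[y1, y2] (fun t => f (ray x%:C%C 'i%C t))).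

Lemma eclip_hol Q M f f' : hol Q M f f' -> E `<=` Q -> eclip f.
Proof.
move=> H EQ; split => z hz; apply: (clip_ray H) => t tI; apply: EQ.
  exact: side_h.
exact: side_v.
Qed.

Lemma eclip_deriv Q M f f' : hol Q M f f' -> E `<=` Q -> eclip f'.
Proof.
move=> H EQ; split => z hz; apply: (clip_ray_deriv H) => t tI; apply: EQ.
  exact: side_h.
exact: side_v.
Qed.

Lemma eclipL f g (u v : R[i]) : eclip f -> eclip g -> eclip (fun s => u * f s + v * g s).
Proof.
move=> [f1 f2] [g1 g2]; split => z hz; apply: clip_add; apply: clip_scale;
 by [exact: f1|exact: g1|exact: f2|exact: g2].
Qed.

Lemma ointL f g (u v : R[i]) : eclip f -> eclip g ->
  oint x1 x2 y1 y2 (fun s => u * f s + v * g s) =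
  u * oint x1 x2 y1 y2 f + v * oint x1 x2 y1 y2 g.
Proof.
move=> [f1 f2] [g1 g2].
(* the remaining linear identity is [side_sum_alg] *)
rewrite /oint /hline /vline !lintL//; try (apply: clip_cintegrable;
  solve [apply: f1; by [left|right] | apply: g1; by [left|right]
        |apply: f2; by [left|right] | apply: g2; by [left|right]]).
Qed.

Lemma oint_le f (B : R) : eclip f -> (forall s, E s -> normc (f s) <= B) ->
  normc (oint x1 x2 y1 y2 f) <= 2 * B * ((x2 - x1) + (y2 - y1)).
Proof.
move=> [f1 f2] HB.
have bh y : y = y1 \/ y = y2 -> normc (hline y `[x1, x2] f) <= B * (x2 - x1).
  move=> hy; rewrite -[leRHS]mul1r -(@normc1 R); apply: lint_le_cst => //; first exact: f1.
  by move=> t tI; apply: HB; exact: side_h.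
have bv x : x = x1 \/ x = x2 -> normc (vline x `[y1, y2] f) <= B * (y2 - y1).
  move=> hx; rewrite -[leRHS]mul1r -(@normc_i R); apply: lint_le_cst => //; first exact: f2.
  by move=> t tI; apply: HB; exact: side_v.
have -> : 2 * B * (x2 - x1 + (y2 - y1)) = B * (x2 - x1) + B * (y2 - y1)
   + B * (x2 - x1) + B * (y2 - y1) by ring.
apply: le_trans (le_normcB _ _) _; apply: lerD; last by apply: bv; left.
apply: le_trans (le_normcB _ _) _; apply: lerD; last by apply: bh; right.
apply: le_trans (le_normcD _ _) _; apply: lerD; last by apply: bv; right.
by apply: bh; left.
Qed.

Lemma oint_FTC Q M P p : hol Q M P p -> E `<=` Q -> oint x1 x2 y1 y2 p = 0.
Proof.
move=> H EQ; rewrite /oint /hline /vline.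
rewrite !(line_FTC _ H)//; try (by move=> t tI; apply: EQ;
  solve [apply: side_h => //; by [left|right] | apply: side_v => //; by [left|right]]).
by rewrite !ray_h !ray_v; ring.
Qed.

End Sides.

Lemma rect_star (x1 x2 y1 y2 : R) t s (r : R) : rect x1 x2 y1 y2 t -> rect x1 x2 y1 y2 s ->
  0 <= r <= 1 -> rect x1 x2 y1 y2 (t + r%:C%C * (s - t)).
Proof.
move=> [/andP[a1 a2] /andP[a3 a4]] [/andP[b1 b2] /andP[b3 b4]] /andP[r0 r1].
rewrite /rect /= !cReD !cImD !cRe_scal !cIm_scal !cReB !cImB.
by split; apply/andP; split; nra.
Qed.

Lemma rect_dist (x1 x2 y1 y2 : R) t s : rect x1 x2 y1 y2 t -> rect x1 x2 y1 y2 s ->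
  normc (s - t) <= (x2 - x1) + (y2 - y1).
Proof.
move=> [/andP[a1 a2] /andP[a3 a4]] [/andP[b1 b2] /andP[b3 b4]].
apply: le_trans (normc_le_ReIm _) _; rewrite cReB cImB.
by apply: lerD; rewrite ler_norml; apply/andP; split; lra.
Qed.

Lemma hol_affine (Q Q' : set R[i]) M G G' t (r : R) : hol Q M G G' -> 0 <= r <= 1 ->
  (forall s, Q' s -> Q (t + r%:C%C * (s - t))) ->
  hol Q' M (fun s => G (t + r%:C%C * (s - t))) (fun s => r%:C%C * G' (t + r%:C%C * (s - t))).
Proof.
move=> H /andP[r0 r1] QQ s s' Qs Qs'; have [h1 h2 h3] := H _ _ (QQ _ Qs) (QQ _ Qs').
have M0 := hol_ge0 (QQ _ Qs) H.
split => //.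
  by rewrite normcM normc_real ger0_norm//; apply: le_trans h2; rewrite ler_piMl ?normc_ge0.
move: h3.
have -> : t + r%:C%C * (s' - t) - (t + r%:C%C * (s - t)) = r%:C%C * (s' - s) by ring.
rewrite normcM normc_real ger0_norm// exprMn.
rewrite [(s' - s) * _]mulrCA -[r%:C%C * (s' - s) * _]mulrA => h3; apply: le_trans h3 _.
rewrite ler_wpM2l// ler_piMl ?sqr_ge0//.
by rewrite -(expr1n _ 2) ler_sqr ?nnegrE.
Qed.

(** Cutting the interval into [n] pieces bounds the total increment by [C / n]. *)
Lemma quad_const (F : R -> R[i]) (C : R) :
  (forall r r', 0 <= r -> r <= r' -> r' <= 1 -> normc (F r' - F r) <= C * (r' - r) ^+ 2) ->
  F 1 = F 0.
Proof.
move=> H.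
have C0 : 0 <= C.
  have := H 0 1 (lexx _) ler01 (lexx _); rewrite subr0 expr1n mulr1.
  exact: le_trans (normc_ge0 _).
have Hn (n k : nat) : (k <= n.+1)%N ->
    normc (F (k%:R / n.+1%:R) - F 0) <= k%:R * (C / n.+1%:R ^+ 2).
  elim: k => [|k IH] kn; first by rewrite !mul0r subrr normc0.
  have n0 : (0 : R) < n.+1%:R by [].
  have -> : F (k.+1%:R / n.+1%:R) - F 0 = (F (k.+1%:R / n.+1%:R) - F (k%:R / n.+1%:R))
     + (F (k%:R / n.+1%:R) - F 0) by ring.
  apply: le_trans (le_normcD _ _) _; rewrite -[in leRHS]natr1 [leRHS]mulrDl mul1r addrC.
  apply: lerD; first exact: (IH (ltnW kn)).
  rewrite -natr1.
  have -> : C / n.+1%:R ^+ 2 = C * ((k%:R + 1) / n.+1%:R - k%:R / n.+1%:R) ^+ 2.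
    by rewrite -mulrBl addrAC subrr add0r mul1r exprVn.
  apply: H; first by rewrite divr_ge0.
    by rewrite ler_pM2r ?invr_gt0// lerDl.
  by rewrite ler_pdivrMr// mul1r natr1 ler_nat.
apply/eqP; rewrite -subr_eq0 -normc_eq0; apply/eqP/le_anti; rewrite normc_ge0 andbT.
apply/ler_addgt0Pl => e e0; rewrite addr0.
pose n := Num.truncn (C / e).
have nC : C / e < n.+1%:R by rewrite truncnS_gt.
have := Hn n n.+1 (leqnn _); rewrite divff ?pnatr_eq0// => /le_trans; apply.
have X0 : (n.+1%:R : R) != 0 by rewrite pnatr_eq0.
have -> : n.+1%:R * (C / n.+1%:R ^+ 2) = C / n.+1%:R by field.
by rewrite ler_pdivrMr// mulrC -ler_pdivrMr// ltW.
Qed.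

Lemma sides_sub (x1 x2 y1 y2 : R) : sides x1 x2 y1 y2 `<=` rect x1 x2 y1 y2.
Proof. by move=> s []. Qed.

Lemma sides_dist (x1 x2 y1 y2 : R) t : x1 < cRe t < x2 -> y1 < cIm t < y2 ->
  exists2 dl : R, 0 < dl & forall s, sides x1 x2 y1 y2 s -> dl <= normc (s - t).
Proof.
move=> /andP[a1 a2] /andP[a3 a4].
exists (Num.min (Num.min (cRe t - x1) (x2 - cRe t))
  (Num.min (cIm t - y1) (y2 - cIm t))).
  by rewrite !lt_min !subr_gt0 a1 a2 a3.
move=> s [_ [] es].
- apply: le_trans (Re_le_normc _); rewrite cReB es distrC.
  by rewrite !ge_min; apply/orP; left; apply/orP; left; exact: ler_norm.
- apply: le_trans (Re_le_normc _); rewrite cReB es.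
  by rewrite !ge_min; apply/orP; left; apply/orP; right; exact: ler_norm.
- apply: le_trans (Im_le_normc _); rewrite cImB es distrC.
  by rewrite !ge_min; apply/orP; right; apply/orP; left; exact: ler_norm.
- apply: le_trans (Im_le_normc _); rewrite cImB es.
  by rewrite !ge_min; apply/orP; right; apply/orP; right; exact: ler_norm.
Qed.

Let shrink_alg (a b c : R[i]) : a - b = 1 * (1 * a + -1 * b) + c * 0.
Proof. by ring. Qed.

(** The contour integral of [G (t + r (s - t)) / (s - t)] does not depend on [r]:
    its derivative in [r] is the contour integral of [G' (t + r (s - t))], which
    has the primitive [G (t + r (s - t)) / r], or [s * G' t] if [r = 0].  Compare [r = 1] and [r = 0]. *)
Lemma cauchy_shrink (x1 x2 y1 y2 : R) t M G G' :
  x1 < cRe t < x2 -> y1 < cIm t < y2 ->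
  hol (rect x1 x2 y1 y2) M G G' ->
  oint x1 x2 y1 y2 (fun s => G s / (s - t)) =
  G t * oint x1 x2 y1 y2 (fun s => (s - t)^-1).
Proof.
move=> tx ty H; have [dl dl0 dlE] := sides_dist tx ty.
set Q := rect x1 x2 y1 y2 in H; set E := sides x1 x2 y1 y2 in dlE.
have EQ : E `<=` Q by exact: sides_sub.
have [x12 y12] : x1 <= x2 /\ y1 <= y2.
  by move: tx ty => /andP[? ?] /andP[? ?]; split; lra.
have Qt : Q t by move: tx ty => /andP[? ?] /andP[? ?]; split; apply/andP; split; exact: ltW.
have M0 : 0 <= M := hol_ge0 Qt H.
pose D := (x2 - x1) + (y2 - y1).
have D0 : 0 <= D by rewrite addr_ge0 ?subr_ge0.
have [N HN] : exists N, hol E N (fun s => s - t) (fun=> 1 + 0).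
  exists (Num.max 1 (normc t + D) + normc (- t)); apply: hol_add; last exact: hol_cst.
  apply: hol_id; first by rewrite le_max lexx.
  move=> s Es; rewrite le_max; apply/orP; right.
  rewrite addrC; apply: le_trans (normcBD s t) _; rewrite lerD2r.
  by apply: rect_dist => //; exact: EQ.
have [Ni HNi] : exists N, hol E N (fun s => (s - t)^-1) (fun s => - ((1 + 0) / (s - t) ^+ 2)).
  by eexists; apply: (hol_inv dl0 _ HN).
have HG (r : R) : 0 <= r <= 1 -> hol Q M (fun s => G (t + r%:C%C * (s - t)))
    (fun s => r%:C%C * G' (t + r%:C%C * (s - t))).
  by move=> r01; apply: (hol_affine H r01) => s Qs; exact: rect_star.
have HF (r : R) : 0 <= r <= 1 ->
    eclip x1 x2 y1 y2 (fun s => G (t + r%:C%C * (s - t)) / (s - t)).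
  move=> r01; apply: (eclip_hol x12 y12 (hol_mul (hol_sub EQ (HG _ r01)) HNi)).
  exact: subset_refl.
have ei := eclip_hol x12 y12 HNi (@subset_refl _ _).
have Hz (r : R) : 0 <= r <= 1 -> exists N P, hol Q N P (fun s => G' (t + r%:C%C * (s - t))).
  move=> r01; have [r0|r0] := eqVneq r 0.
    exists (6 * (Num.max 1 (normc t + D) * normc (G' t))), (fun s => s * G' t).
    have := hol_mul (@hol_id R Q (Num.max 1 (normc t + D)) _ _) (@hol_cst R Q (G' t)).
    rewrite le_max lexx => /(_ isT) h.
    apply: hol_ext (h _) => //.
      by move=> s _; rewrite r0 mul0r addr0 mul1r mulr0 addr0.
    move=> s Qs; rewrite le_max; apply/orP; right.
    by rewrite addrC; apply: le_trans (normcBD s t) _; rewrite lerD2r; exact: rect_dist.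
  do 2 eexists; apply: hol_ext (hol_mul (@hol_cst R Q (r^-1)%:C%C) (HG _ r01)) => // s Qs /=.
  by rewrite mul0r add0r mulrA -rmorphM mulVf// rmorph1 mul1r.
have main := @quad_const (fun r => oint x1 x2 y1 y2 (fun s => G (t + r%:C%C * (s - t)) / (s - t)))
   (2 * (M * D) * D).
have Ge : oint x1 x2 y1 y2 (fun s => G s / (s - t)) =
    oint x1 x2 y1 y2 (fun s => G (t + (1 : R)%:C%C * (s - t)) / (s - t)).
  apply: (oint_ext x12 y12) => s _.
  by have -> : t + (1 : R)%:C%C * (s - t) = s by rewrite rmorph1; ring.
rewrite Ge main.
  rewrite -[RHS]addr0 -[X in _ + X](mul0r (oint x1 x2 y1 y2 (fun s => (s - t)^-1))).
  rewrite -(ointL _ _ ei ei); apply: (oint_ext x12 y12) => s _.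
  have -> : t + (0 : R)%:C%C * (s - t) = t by rewrite rmorph0; ring.
  ring.
move=> r r' r0 rr' r1.
have r01 : 0 <= r <= 1 by rewrite r0 (le_trans rr').
have r01' : 0 <= r' <= 1 by rewrite r1 (le_trans r0).
have h1 := HF _ r01; have h2 := HF _ r01'.
have [N3 [P h3]] := Hz _ r01.
have h4 := eclip_deriv x12 y12 h3 EQ.
(* the integral of an exact derivative *)
have hz : oint x1 x2 y1 y2 (fun s => G' (t + r%:C%C * (s - t))) = 0.
  exact: (oint_FTC x12 y12 h3 EQ).
pose h := r' - r.
have h5 := eclipL 1 (-1) h2 h1.
have h6 := eclipL 1 (- h%:C%C) h5 h4.
have -> : oint x1 x2 y1 y2 (fun s => G (t + r'%:C%C * (s - t)) / (s - t)) -
  oint x1 x2 y1 y2 (fun s => G (t + r%:C%C * (s - t)) / (s - t)) =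
  oint x1 x2 y1 y2 (fun s => 1 * (1 * (G (t + r'%:C%C * (s - t)) / (s - t)) +
     -1 * (G (t + r%:C%C * (s - t)) / (s - t))) + - h%:C%C * G' (t + r%:C%C * (s - t))).
  by rewrite (ointL _ _ h5 h4) (ointL _ _ h2 h1) hz; exact: shrink_alg.
have -> : 2 * (M * D) * D * (r' - r) ^+ 2 = 2 * (M * h ^+ 2 * D) * D by rewrite /h; ring.
apply: (oint_le x12 y12 h6) => s Es; have Qs := EQ _ Es.
have st : s - t != 0 by rewrite -normc_gt0; apply: lt_le_trans dl0 (dlE _ Es).
have [_ _] := H _ _ (rect_star Qt Qs r01) (rect_star Qt Qs r01').
have -> : t + r'%:C%C * (s - t) - (t + r%:C%C * (s - t)) = h%:C%C * (s - t).
  by rewrite /h rmorphB /=; ring.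
set A := G (t + r'%:C%C * _); set B := G (t + r%:C%C * _); set B' := G' _ => hr.
have -> : 1 * (1 * (A / (s - t)) + -1 * (B / (s - t))) + - h%:C%C * B' =
  (A - B - h%:C%C * (s - t) * B') / (s - t) by field.
have st0 : 0 < normc (s - t) by rewrite normc_gt0.
rewrite normc_div (ler_pdivrMr _ _ st0); apply: le_trans hr _.
rewrite normcM normc_real exprMn (real_normK (num_real h)).
set u := normc (s - t).
have -> : M * (h ^+ 2 * u ^+ 2) = M * h ^+ 2 * u * u by ring.
apply: ler_wpM2r; first exact: normc_ge0.
apply: ler_wpM2l; first exact: mulr_ge0 M0 (sqr_ge0 h).
exact: rect_dist.
Qed.

(** [cauchy_shrink] applied to [(s - t) * G s], which vanishes at [t]. *)
Lemma cauchy_thm (x1 x2 y1 y2 : R) M G G' : x1 < x2 -> y1 < y2 ->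
  hol (rect x1 x2 y1 y2) M G G' -> oint x1 x2 y1 y2 G = 0.
Proof.
move=> x12 y12 H.
pose t := Complex ((x1 + x2) / 2) ((y1 + y2) / 2) : R[i].
have tx : x1 < cRe t < x2 by rewrite /t /=; apply/andP; split; lra.
have ty : y1 < cIm t < y2 by rewrite /t /=; apply/andP; split; lra.
have [dl dl0 dlE] := sides_dist tx ty.
pose D := (x2 - x1) + (y2 - y1).
have Qt : rect x1 x2 y1 y2 t.
  by move: tx ty => /andP[? ?] /andP[? ?]; split; apply/andP; split; exact: ltW.
have HN : hol (rect x1 x2 y1 y2) (Num.max 1 (normc t + D) + normc (- t))
    (fun s => s - t) (fun=> 1 + 0).
  apply: hol_add; last exact: hol_cst.
  apply: hol_id; first by rewrite le_max lexx.
  move=> s Qs; rewrite le_max; apply/orP; right.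
  by rewrite addrC; apply: le_trans (normcBD s t) _; rewrite lerD2r; exact: rect_dist.
have := cauchy_shrink tx ty (hol_mul HN H); rewrite subrr !mul0r => <-.
apply: oint_ext; [exact: ltW|exact: ltW|] => s Es.
have st : s - t != 0 by rewrite -normc_gt0; apply: lt_le_trans dl0 (dlE _ Es).
by field.
Qed.

End Cauchy.

(** * The winding number of a rectangle *)

Section Winding.
Variable R : realType.
Notation leb := (@lebesgue_measure R).

Lemma atanV (x : R) : 0 < x -> atan x + atan x^-1 = pi / 2.
Proof.
move=> x0; have a0 : 0 < atan x by rewrite -(@atan0 R); apply: lt_atan.
have a1 := atan_ltpi2 x.
have -> : x^-1 = tan (pi / 2 - atan x).
  rewrite /tan sinB cosB sin_pihalf cos_pihalf !mul0r !mul1r subr0 add0r.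
  by rewrite -{1}(atanK x) /tan invf_div.
rewrite tanK; first by rewrite addrC subrK.
by rewrite in_itv /=; apply/andP; split; have := pi_gt0 R; lra.
Qed.

Lemma clip_inv_line (D : set R) (c a : R) : c != 0 ->
  clip D (fun u => (Complex (u - a) c)^-1).
Proof.
move=> c0 x _; exists (normc (Complex (x - a) c) ^-1 * `|c|^-1), 1; split => // y _ _.
have h (u : R) : Complex (u - a) c != 0.
  by apply/eqP => -[_ /eqP]; rewrite (negPf c0).
have -> : (Complex (y - a) c)^-1 - (Complex (x - a) c)^-1 =
  (Complex (x - a) c - Complex (y - a) c) * (Complex (x - a) c)^-1 * (Complex (y - a) c)^-1.
  by field; rewrite !h.
have -> : Complex (x - a) c - Complex (y - a) c = (x - y)%:C%C.
  by apply: eq_ReIm; rewrite ?cReB ?cImB /=; ring.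
rewrite !normcM normc_real distrC -mulrA mulrC ler_wpM2r//.
rewrite !normcV ler_wpM2l ?invr_ge0 ?normc_ge0//.
have ic : `|c| <= normc (Complex (y - a) c) := Im_le_normc (Complex (y - a) c).
by rewrite lef_pV2// posrE ?normr_gt0// (lt_le_trans _ ic)// normr_gt0.
Qed.

Lemma cint_inv_line (p q c a : R) : c != 0 -> p < q ->
  cint leb `[p, q] (fun u => (Complex (u - a) c)^-1) =
  Complex (2^-1 * ln ((q - a) ^+ 2 + c ^+ 2) - 2^-1 * ln ((p - a) ^+ 2 + c ^+ 2))
          (- (atan ((q - a) / c) - atan ((p - a) / c))).
Proof.
move=> c0 pq.
have n0 (u : R) : 0 < (u - a) ^+ 2 + c ^+ 2.
  by rewrite ltr_wpDl ?sqr_ge0// exprn_even_gt0.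
have cl : clip `[p, q] (fun u => (Complex (u - a) c)^-1) by exact: clip_inv_line.
have [k1 k2] := clip_continuous cl.
have d1 (u : R) : is_derive u 1 (fun u : R => (u - a) ^+ 2 + c ^+ 2) (2 * (u - a)).
  apply: (@is_derive_quad R _ u _ 1 1) => // h _.
  have -> : (h + u - a) ^+ 2 + c ^+ 2 - ((u - a) ^+ 2 + c ^+ 2) - h * (2 * (u - a)) = h ^+ 2.
    by ring.
  by rewrite mul1r normrX.
have d2 (u : R) : is_derive u 1 (fun u : R => (u - a) / c) c^-1.
  apply: (@is_derive_quad R _ u _ 1 1) => // h _.
  have -> : (h + u - a) / c - (u - a) / c - h / c = 0 by ring.
  by rewrite normr0 mul1r sqr_ge0.
have D1 (u : R) : is_derive u 1 (fun u => 2^-1 * ln ((u - a) ^+ 2 + c ^+ 2))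
   ((u - a) / ((u - a) ^+ 2 + c ^+ 2)).
  apply: (is_derive_eq (is_deriveM (is_derive_cst (2^-1 : R) u 1) (@is_derive1_comp R (@ln R) (fun u : R => (u - a) ^+ 2 + c ^+ 2) u _ _ (is_derive1_ln (n0 u)) (d1 u)))).
  rewrite /= scaler0 addr0 /GRing.scale /=.
  by field; rewrite gt_eqF.
have D2 (u : R) : is_derive u 1 (fun u => - atan ((u - a) / c))
   (- (c / ((u - a) ^+ 2 + c ^+ 2))).
  apply: (is_derive_eq (is_deriveN (@is_derive1_comp R (@atan R) (fun u : R => (u - a) / c) u _ _ (is_derive1_atan ((u - a) / c)) (d2 u)))).
  congr (- _).
  have := n0 u; rewrite lt0r => /andP[n1 _].
  by field; rewrite n1 c0.
have lr (f : R -> R) (df : R -> R) : (forall u : R, is_derive u (1 : R) f (df u)) ->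
    derivable_oo_LRcontinuous f p q.
  move=> H; have cf : continuous f.
    by move=> u; apply: differentiable_continuous; apply/derivable1_diffP; have [] := H u.
  have [_ q2 q3] := (continuous_within_itvP _ pq).1 (@continuous_subspaceT _ _ `[p, q] f cf).
  by split => // u _; have [] := H u.
apply: eq_ReIm => /=.
- rewrite /Rintegral (continuous_FTC2 pq k1 (F := fun u => 2^-1 * ln ((u - a) ^+ 2 + c ^+ 2)))//.
    exact: lr D1.
  by move=> u _; rewrite derive1E; have [_ ->] := D1 u.
- rewrite /Rintegral (continuous_FTC2 pq k2 (F := fun u => - atan ((u - a) / c)))/=.
  + by rewrite opprB addrC opprK.
  + exact: lr D2.
  + by move=> u _; rewrite derive1E; have [_ ->] := D2 u.
Qed.

(** The logarithms of the four corner distances cancel, and the arctangents add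
    up to [pi / 2] at each corner by [atanV]. *)
Lemma oint_winding (x1 x2 y1 y2 : R) t :
  x1 < cRe t < x2 -> y1 < cIm t < y2 ->
  oint x1 x2 y1 y2 (fun s => (s - t)^-1) = Complex 0 (2 * pi).
Proof.
case: t => a b /= /andP[a1 a2] /andP[b1 b2].
have H (y : R) : y != b -> hline y `[x1, x2] (fun s => (s - Complex a b)^-1) =
    cint leb `[x1, x2] (fun u => (Complex (u - a) (y - b))^-1).
  by move=> _; rewrite /hline /lint mul1r; apply: cint_ext => u _; rewrite ray_h.
have V (x : R) : x != a -> vline x `[y1, y2] (fun s => (s - Complex a b)^-1) =
    cint leb `[y1, y2] (fun u => (Complex (u - b) (a - x))^-1).
  move=> xa; rewrite /vline /lint.
  have xi : 'i%C * 'i%C = -1 :> R[i] by rewrite -expr2 sqr_i.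
  have i0 : 'i%C != 0 :> R[i] by rewrite -normc_gt0 normc_i.
  have ii : 'i%C^-1 = - 'i%C :> R[i].
    by apply: (mulfI i0); rewrite mulfV// mulrN xi opprK.
  have cl : clip `[y1, y2] (fun u => (Complex (u - b) (a - x))^-1).
    by apply: clip_inv_line; rewrite subr_eq0 eq_sym.
  rewrite -[RHS]addr0 -[X in _ + X](mul0r (cint leb `[y1, y2] (fun u => (Complex (u - b) (a - x))^-1))).
  rewrite -[X in X + _]mul1r -cintL//; try exact: clip_cintegrable.
  have -> : cint leb `[y1, y2] (fun t => (ray x%:C%C 'i%C t - Complex a b)^-1) =
     cint leb `[y1, y2] (fun u => - 'i%C * (Complex (u - b) (a - x))^-1 + 0 * (Complex (u - b) (a - x))^-1).
    apply: cint_ext => u _; rewrite ray_v mul0r addr0 -ii -invfM; congr (_^-1).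
    by apply: eq_ReIm; rewrite ?cReM ?cImM /=; ring.
  rewrite !cintL//; try exact: clip_cintegrable.
  rewrite mulrDr mulrA mulrN xi; ring.
rewrite /oint !H ?V ?(lt_eqF a1) ?(gt_eqF a2) ?(lt_eqF b1) ?(gt_eqF b2)//.
have x12 := lt_trans a1 a2; have y12 := lt_trans b1 b2.
rewrite !cint_inv_line ?subr_eq0 ?(lt_eqF a2) ?(gt_eqF a1) ?(lt_eqF b1) ?(gt_eqF b2)//.
have at2 (u v : R) : 0 < u -> 0 < v -> atan (u / v) + atan (v / u) = pi / 2.
  by move=> u0 v0; rewrite -(invf_div u v) atanV// divr_gt0.
have [A0 B0 C0 D0] : [/\ 0 < x2 - a, 0 < a - x1, 0 < y2 - b & 0 < b - y1] by split; lra.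
apply: eq_ReIm; rewrite !(cReD,cImD,cReN,cImN) /=.
  rewrite (_ : (y2 - b) ^+ 2 + (a - x2) ^+ 2 = (x2 - a) ^+ 2 + (y2 - b) ^+ 2); last by ring.
  rewrite (_ : (y1 - b) ^+ 2 + (a - x2) ^+ 2 = (x2 - a) ^+ 2 + (y1 - b) ^+ 2); last by ring.
  rewrite (_ : (y2 - b) ^+ 2 + (a - x1) ^+ 2 = (x1 - a) ^+ 2 + (y2 - b) ^+ 2); last by ring.
  rewrite (_ : (y1 - b) ^+ 2 + (a - x1) ^+ 2 = (x1 - a) ^+ 2 + (y1 - b) ^+ 2); last by ring.
  ring.
have fl (u v w z : R) : u / v = - (w / z) -> atan (u / v) = - atan (w / z).
  by move=> ->; rewrite atanN.
rewrite (fl (x2 - a) (y1 - b) (x2 - a) (b - y1)); last by rewrite -(opprB b y1) invrN mulrN.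
rewrite (_ : (x1 - a) / (y1 - b) = (a - x1) / (b - y1)); last first.
  by rewrite -(opprB b y1) -(opprB a x1) invrN mulrNN.
rewrite (fl (y2 - b) (a - x2) (y2 - b) (x2 - a)); last by rewrite -(opprB x2 a) invrN mulrN.
rewrite (_ : (y1 - b) / (a - x2) = (b - y1) / (x2 - a)); last first.
  by rewrite -(opprB x2 a) -(opprB b y1) invrN mulrNN.
rewrite (fl (x1 - a) (y2 - b) (a - x1) (y2 - b)); last by rewrite -(opprB a x1) mulNr.
rewrite (fl (y1 - b) (a - x1) (b - y1) (a - x1)); last by rewrite -(opprB b y1) mulNr.
have := at2 _ _ A0 D0; have := at2 _ _ A0 C0; have := at2 _ _ B0 C0; have := at2 _ _ B0 D0.
lra.
Qed.

Lemma cauchy_formula (x1 x2 y1 y2 : R) t M G G' :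
  x1 < cRe t < x2 -> y1 < cIm t < y2 ->
  hol (rect x1 x2 y1 y2) M G G' ->
  oint x1 x2 y1 y2 (fun s => G s / (s - t)) = G t * Complex 0 (2 * pi).
Proof. by move=> tx ty H; rewrite (cauchy_shrink tx ty H) oint_winding. Qed.

End Winding.

(** * The slow map *)

Section CountingSums.
Variable R : realType.
Notation cnt := (@counting nat R).

(** Series are integrals for the counting measure, so that the results on
    parameter integrals apply to them. *)
Definition csum (u : nat -> R[i]) : R[i] := cint cnt setT u.
Definition rsum (b : nat -> R) : R := Rintegral cnt setT b.

Lemma cmeas_nat (u : nat -> R[i]) : cmeas setT u.
Proof. by split => _ Y _. Qed.

Lemma rsumE (b : nat -> R) : (forall k, 0 <= b k) ->
  (rsum b = fine (\sum_(0 <= k <oo) (b k)%:E)%E)%R.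
Proof.
by move=> b0; rewrite /rsum /Rintegral ge0_integral_count// => k; rewrite lee_fin.
Qed.

Lemma nat_integrable (b : nat -> R) : (forall k, 0 <= b k) ->
  (\sum_(0 <= k <oo) (b k)%:E < +oo)%E -> cnt.-integrable setT (EFin \o b).
Proof.
move=> b0 bfin; apply/integrableP; split; first by move=> _ Y _.
under eq_integral => k _ do rewrite gee0_abs ?lee_fin//.
by rewrite ge0_integral_count// => k; rewrite lee_fin.
Qed.

Lemma nat_integrable_series (b : nat -> R) : (forall k, 0 <= b k) ->
  cnt.-integrable setT (EFin \o b) -> (\sum_(0 <= k <oo) (b k)%:E = (rsum b)%:E)%E.
Proof.
move=> b0 /integrable_fin_num h; rewrite rsumE// fineK//.
rewrite -ge0_integral_count; last by move=> k; rewrite lee_fin.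
exact: h.
Qed.

Definition geomw (k : nat) : R := 2^-1 ^+ k.

Lemma geomw_ge0 k : 0 <= geomw k.
Proof. by rewrite exprn_ge0. Qed.

Lemma geo_sum : (\sum_(0 <= k <oo) (geomw k)%:E = 2%:E)%E.
Proof.
apply: cvg_lim => //; have := @cvg_geometric_eseries_half R 2 0.
rewrite expr0 divr1; apply: cvg_trans; apply: near_eq_cvg; near=> n.
rewrite /eseries /=; apply: eq_bigr => k _; congr EFin.
rewrite addn1 natrX exprS /geomw exprVn; field.
by rewrite expf_neq0.
Unshelve. all: by end_near. Qed.

Lemma geomw_integrable c : cnt.-integrable setT (EFin \o (fun k => c * geomw k)).
Proof.
have h : cnt.-integrable setT (EFin \o geomw).
  by apply: nat_integrable; [exact: geomw_ge0|rewrite geo_sum ltry].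
exact: (integrableZl measurableT c h).
Qed.

Lemma rsum_geomw c : rsum (fun k => c * geomw k) = c * 2.
Proof.
have h : cnt.-integrable setT (EFin \o geomw).
  by apply: nat_integrable; [exact: geomw_ge0|rewrite geo_sum ltry].
by rewrite /rsum RintegralZl// -/(rsum geomw) rsumE ?geo_sum//; exact: geomw_ge0.
Qed.

Lemma nat_integrable_le (b g : nat -> R) : cnt.-integrable setT (EFin \o g) ->
  (forall k, `|b k| <= g k) -> cnt.-integrable setT (EFin \o b).
Proof.
move=> ig bg; apply: (le_integrable measurableT _ _ ig); first by move=> _ Y _.
by move=> k _ /=; rewrite lee_fin; apply: le_trans (bg k) (ler_norm _).
Qed.

Lemma rsum_le (b g : nat -> R) : cnt.-integrable setT (EFin \o b) ->
  cnt.-integrable setT (EFin \o g) -> (forall k, b k <= g k) -> rsum b <= rsum g.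
Proof. by move=> ib ig bg; apply: le_Rintegral. Qed.

Lemma rsum_ge_partial (b : nat -> R) n : (forall k, 0 <= b k) ->
  cnt.-integrable setT (EFin \o b) -> \sum_(0 <= k < n) b k <= rsum b.
Proof.
move=> b0 ib; rewrite -lee_fin -nat_integrable_series//.
rewrite (nneseries_split 0 n); last by move=> k _; rewrite lee_fin.
rewrite add0n sumEFin leeDl//; apply: nneseries_ge0 => k _ _; by rewrite lee_fin.
Qed.

Lemma indic_integrable n : cnt.-integrable setT (EFin \o (fun k => (k < n)%N%:R : R)).
Proof.
apply: (nat_integrable_le (geomw_integrable (2 ^+ n))) => k.
rewrite ger0_norm//; have [kn|nk] := ltnP k n; last by rewrite mulr_ge0// geomw_ge0.
rewrite /geomw exprVn ler_pdivlMr ?exprn_gt0// mul1r.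
by rewrite ler_eXn2l ?ltr1n// ltnW.
Qed.

Lemma rsum_indic n : rsum (fun k => (k < n)%N%:R : R) = n%:R.
Proof.
rewrite rsumE// (nneseries_split 0 n); last by move=> k _; rewrite lee_fin.
rewrite add0n eseries0 ?adde0; last by move=> k nk _; rewrite ltnNge nk.
rewrite sumEFin /= -natr_sum; congr (_%:R).
rewrite (eq_big_nat _ _ (F2 := fun=> 1%N)); first by rewrite sum_nat_const_nat subn0 muln1.
by move=> k /andP[_ ->].
Qed.

Lemma csum_le (u : nat -> R[i]) (b : nat -> R) : cnt.-integrable setT (EFin \o b) ->
  (forall k, normc (u k) <= b k) -> normc (csum u) <= rsum b.
Proof.
move=> ib ub; apply: cint_le => //.
by apply: (cintegrable_le measurableT (cmeas_nat u) _ ib).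
Qed.

Lemma csumL (u v : nat -> R[i]) (b c : nat -> R) (x y : R[i]) :
  cnt.-integrable setT (EFin \o b) -> cnt.-integrable setT (EFin \o c) ->
  (forall k, normc (u k) <= b k) -> (forall k, normc (v k) <= c k) ->
  csum (fun k => x * u k + y * v k) = x * csum u + y * csum v.
Proof.
move=> ib ic ub vc; apply: cintL => //.
- exact: (cintegrable_le measurableT (cmeas_nat u) _ ib).
- exact: (cintegrable_le measurableT (cmeas_nat v) _ ic).
Qed.

End CountingSums.

Section SlowMap.
Variable R : realType.
Notation cnt := (@counting nat R).
Variable tau : nat -> R.
Hypothesis tau0 : 200 <= tau 0%N.
Hypothesis tauS : forall k, 2 * tau k <= tau k.+1.

(** Doubling makes every series in [1 / tau k] comparable to a geometric one. *)
Lemma tau_grow K j : tau K * 2 ^+ j <= tau (K + j)%N.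
Proof.
elim: j => [|j IH]; first by rewrite expr0 mulr1 addn0.
by rewrite addnS exprS; apply: le_trans (tauS _); rewrite mulrCA ler_wpM2l.
Qed.

Lemma tau_ge200 k : 200 <= tau k.
Proof.
elim: k => // k IH; apply: le_trans (tauS k); lra.
Qed.

Lemma tau_gt0 k : 0 < tau k. Proof. by have := tau_ge200 k; lra. Qed.

Lemma tauV_le k : (tau k)^-1 <= 200^-1 * geomw R k.
Proof.
have := tau_grow 0 k; rewrite add0n => h.
have p : 0 < 200 * 2 ^+ k :> R by apply: mulr_gt0; rewrite ?exprn_gt0 ?ltr0n.
rewrite /geomw exprVn -invfM lef_pV2; [|exact: tau_gt0|exact: p].
by apply: le_trans h; apply: ler_wpM2r; [exact: exprn_ge0|exact: tau0].
Qed.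

Lemma tauV_integrable c : cnt.-integrable setT (EFin \o (fun k => c / tau k)).
Proof.
apply: (nat_integrable_le (geomw_integrable (`|c| * 200^-1))) => k.
rewrite normrM -mulrA ler_wpM2l// ger0_norm ?invr_ge0 ?(ltW (tau_gt0 k))//.
exact: tauV_le.
Qed.

Lemma rsum_tauV c : 0 <= c -> rsum (fun k => c / tau k) <= c / 100.
Proof.
move=> c0; have -> : c / 100 = (c / 200) * 2 by field.
rewrite -rsum_geomw; apply: rsum_le; [exact: tauV_integrable|exact: geomw_integrable|].
by move=> k; rewrite -mulrA ler_wpM2l//; exact: tauV_le.
Qed.

(** A half strip wider than the one that parametrises the tract; the difference
    leaves room for the contours of the Cauchy integrals. *)
Definition wide_strip : set R[i] := [set s | -2 <= cRe s /\ `|cIm s| <= 5].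

Lemma wide_lower s (t : R) : wide_strip s -> 200 <= t ->
  cRe s + t <= normc (s + t%:C%C) /\ 198 <= cRe s + t.
Proof.
move=> [h1 h2] t2; split; last lra.
apply: le_trans (Re_le_normc _); rewrite cReD /=.
exact: ler_norm.
Qed.

Lemma wide_half s (t : R) : wide_strip s -> 200 <= t -> t / 2 <= normc (s + t%:C%C).
Proof.
move=> hs t2; have [h1 h2] := wide_lower hs t2; apply: le_trans h1.
case: hs; lra.
Qed.

Lemma wide_neq0 s (t : R) : wide_strip s -> 200 <= t -> s + t%:C%C != 0.
Proof. by move=> hs t2; rewrite -normc_gt0; have := wide_half hs t2; lra. Qed.

Definition Yterm (s s' : R[i]) (k : nat) : R[i] :=
  (tau k)%:C%C / ((s + (tau k)%:C%C) * (s' + (tau k)%:C%C)).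
(** The difference quotient of the slow map, see [XkB]; on the diagonal it is the
    derivative. *)
Definition Yk (s s' : R[i]) : R[i] := csum (Yterm s s').
(** The term [s / (s + tau k)] is negligible until [Re s] reaches [tau k] and
    then rises to 1, so the map gains one unit per term. *)
Definition Xk (s : R[i]) : R[i] := 3 + csum (fun k => s / (s + (tau k)%:C%C)).
Definition yterm (a b : R) (k : nat) : R := tau k / ((a + tau k) * (b + tau k)).
(** The difference quotient on the real axis; it controls [Yk] in the whole
    strip up to a factor 2. *)
Definition yk (a b : R) : R := rsum (yterm a b).

Lemma yterm_gt0 a b k : -2 <= a -> -2 <= b -> 0 < yterm a b k.
Proof.
move=> a2 b2; have t := tau_ge200 k.
by rewrite divr_gt0 ?mulr_gt0//; lra.
Qed.

Lemma yterm_le a b k : -2 <= a -> -2 <= b -> yterm a b k <= 2 / tau k.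
Proof.
move=> a2 b2; have t := tau_ge200 k.
rewrite /yterm ler_pdivrMr ?mulr_gt0//; try lra.
rewrite mulrAC ler_pdivlMr; last lra.
have h : 0 <= (a + 2) * (b + tau k) + (tau k - 2) * (b + 2).
  by apply: addr_ge0; apply: mulr_ge0; lra.
have : (a + tau k) * (b + tau k) = (a + 2) * (b + tau k) + (tau k - 2) * (b + 2) +
   (tau k - 2) * (tau k - 2) by ring.
nra.
Qed.

Lemma yterm_integrable a b : -2 <= a -> -2 <= b -> cnt.-integrable setT (EFin \o yterm a b).
Proof.
move=> a2 b2; apply: (nat_integrable_le (tauV_integrable 2)) => k.
by rewrite ger0_norm ?yterm_le// ltW// yterm_gt0.
Qed.

Lemma normc_Yterm s s' k : wide_strip s -> wide_strip s' ->
  normc (Yterm s s' k) <= yterm (cRe s) (cRe s') k.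
Proof.
move=> hs hs'; have t := tau_ge200 k.
have [h1 h2] := wide_lower hs t; have [h3 h4] := wide_lower hs' t.
rewrite /Yterm normc_div normc_real ger0_norm; last lra.
rewrite normcM ler_wpM2l; try lra.
rewrite lef_pV2 ?posrE ?mulr_gt0//; try lra.
by apply: ler_pM => //; lra.
Qed.

Lemma cRe_inv (z : R[i]) : cRe z^-1 = cRe z / normc z ^+ 2.
Proof. by rewrite normc_sqr; case: z. Qed.

Let sqr_mono (p : R) : 198 <= p -> 198 ^+ 2 <= p ^+ 2.
Proof. by move=> h; rewrite !expr2; exact: (ler_pM (ler0n _ _) (ler0n _ _) h h). Qed.

(** The imaginary parts are at most 5 and the real parts of [s + tau k] at least
    198, so the argument of each term is tiny. *)
Lemma Re_Yterm s s' k : wide_strip s -> wide_strip s' ->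
  2^-1 * yterm (cRe s) (cRe s') k <= cRe (Yterm s s' k).
Proof.
move=> hs hs'; have t := tau_ge200 k.
have [_ p1] := wide_lower hs t; have [_ q1] := wide_lower hs' t.
rewrite /Yterm cRe_scal /yterm mulrCA ler_wpM2l; try lra.
rewrite cRe_inv normcM exprMn !normc_sqr cReM !cReD !cImD /= !addr0.
case: hs hs' => _ hu [_ hv]; move: hu hv p1 q1.
set p := cRe s + tau k; set q := cRe s' + tau k.
set u := cIm s; set v := cIm s'.
rewrite !ler_norml => /andP[u1 u2] /andP[v1 v2] p1 q1.
have p0 : 0 < p by lra.
have q0 : 0 < q by lra.
have uu : u ^+ 2 <= 25 by nra.
have vv : v ^+ 2 <= 25 by nra.
have uv : u * v <= 25 by nra.
have pp := sqr_mono p1.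
have qq := sqr_mono q1.
rewrite -invfM ler_pdivlMr; last first.
  apply: mulr_gt0; apply: ltr_pwDl; rewrite ?sqr_ge0 ?exprn_gt0//.
rewrite mulrC ler_pdivrMr; last by rewrite mulr_gt0// mulr_gt0.
have pq0 : 0 < p * q by exact: mulr_gt0.
have pq1 := ler_pM (ler0n R 198) (ler0n R 198) p1 q1.
have e1 : p ^+ 2 * v ^+ 2 <= p ^+ 2 * 25 by rewrite ler_wpM2l ?sqr_ge0.
have e2 : u ^+ 2 * q ^+ 2 <= 25 * q ^+ 2 by rewrite ler_wpM2r ?sqr_ge0.
have e3 : u ^+ 2 * v ^+ 2 <= 25 * 25 by apply: ler_pM; rewrite ?sqr_ge0.
have e4 : p ^+ 2 * 198 ^+ 2 <= p ^+ 2 * q ^+ 2 by rewrite ler_wpM2l ?sqr_ge0.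
have e5 : 198 ^+ 2 * q ^+ 2 <= p ^+ 2 * q ^+ 2 by rewrite ler_wpM2r ?sqr_ge0.
have e6 : (p * q) * (u * v) <= (p * q) * 25 by rewrite ler_wpM2l// ltW.
have e7 : (p * q) * (198 * 198) <= (p * q) * (p * q) by rewrite ler_wpM2l// ltW.
lra.
Qed.

End SlowMap.

Section SlowMapEstimates.
Variable R : realType.
Notation cnt := (@counting nat R).
Variable tau : nat -> R.
Hypothesis tau0 : 200 <= tau 0%N.
Hypothesis tauS : forall k, 2 * tau k <= tau k.+1.

Let tg := tau_ge200 tau0 tauS.
Let tp := tau_gt0 tau0 tauS.
Notation X := (Xk tau).
Notation Y := (Yk tau).
Notation y := (yk tau).
Notation H := (@wide_strip R).
Let iy := yterm_integrable tau0 tauS.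

Lemma Yk_le s s' : H s -> H s' -> normc (Y s s') <= y (cRe s) (cRe s').
Proof.
move=> hs hs'; apply: csum_le; first by apply: iy; [case: hs|case: hs'].
by move=> k; apply: normc_Yterm.
Qed.

Lemma Re_Yk_ge s s' : H s -> H s' ->
  2^-1 * y (cRe s) (cRe s') <= cRe (Y s s').
Proof.
move=> hs hs'; have i1 : cnt.-integrable setT (EFin \o yterm tau (cRe s) (cRe s')).
  by apply: iy; [case: hs|case: hs'].
rewrite /yk /rsum -RintegralZl//; apply: le_Rintegral => //.
- exact: (integrableZl measurableT 2^-1 i1).
- apply: (nat_integrable_le i1) => k; apply: le_trans (Re_le_normc _) _.
  exact: normc_Yterm.
- by move=> k _; exact: Re_Yterm.
Qed.

Lemma Yk_ge s s' : H s -> H s' ->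
  2^-1 * y (cRe s) (cRe s') <= normc (Y s s').
Proof.
move=> hs hs'; apply: le_trans (Re_Yk_ge hs hs') _.
exact: le_trans (ler_norm _) (Re_le_normc _).
Qed.

Lemma Xterm_le s k : H s -> normc (s / (s + (tau k)%:C%C)) <= 2 * normc s / tau k.
Proof.
move=> hs; have h := wide_half hs (tg k); have t0 := tp k.
rewrite normc_div ler_pdivrMr; last lra.
rewrite mulrAC ler_pdivlMr//.
have := normc_ge0 s; nra.
Qed.

Lemma XkB s t : H s -> H t -> X s - X t = (s - t) * Y s t.
Proof.
move=> hs ht.
have i1 := tauV_integrable tau0 tauS (2 * normc s).
have i2 := tauV_integrable tau0 tauS (2 * normc t).
have b1 := fun k => Xterm_le k hs; have b2 := fun k => Xterm_le k ht.
have i3 : cnt.-integrable setT (EFin \o yterm tau (cRe s) (cRe t)).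
  by apply: iy; [case: hs|case: ht].
have b3 := fun k => normc_Yterm tau0 tauS k hs ht.
have := csumL 1 (-1) i1 i2 b1 b2.
have := csumL (s - t) 0 i3 i3 b3 b3.
have -> : (fun k => (s - t) * Yterm tau s t k + 0 * Yterm tau s t k) =
  (fun k => 1 * (s / (s + (tau k)%:C%C)) + -1 * (t / (t + (tau k)%:C%C))).
  apply/funext => k; rewrite /Yterm.
  by field; rewrite !wide_neq0.
move=> -> ; rewrite mul0r addr0 mul1r mulN1r => e.
by rewrite /Xk /Yk e; ring.
Qed.

Lemma yk_ge0 a b : -2 <= a -> -2 <= b -> 0 <= y a b.
Proof.
by move=> a2 b2; apply: Rintegral_ge0 => k _; apply/ltW/(yterm_gt0 tau0 tauS).
Qed.

Lemma yk_gt0 a b : -2 <= a -> -2 <= b -> 0 < y a b.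
Proof.
move=> a2 b2; have := rsum_ge_partial 1 (fun k => ltW (yterm_gt0 tau0 tauS k a2 b2)) (iy a2 b2).
by rewrite big_nat1; apply: lt_le_trans; exact: yterm_gt0.
Qed.

Lemma ykC a b : y a b = y b a.
Proof. by congr rsum; apply/funext => k; rewrite /yterm (mulrC (a + _)). Qed.

(** A Harnack inequality: the derivative of the slow map changes by at most a
    factor [1 + r] over a distance [r].  The constant does not depend on [tau]. *)
Lemma yk_ratio a b c : -2 <= a -> -2 <= b -> -2 <= c ->
  y a b <= (1 + `|c - b|) * y a c.
Proof.
move=> a2 b2 c2; rewrite /yk /rsum -RintegralZl//; last exact: iy.
apply: le_Rintegral => //; first exact: iy.
  exact: (integrableZl measurableT _ (iy a2 c2)).
move=> k _; rewrite /yterm; have t := tg k.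
have a0 : 0 < a + tau k by lra.
have b0 : 198 <= b + tau k by lra.
have c0 : 0 < c + tau k by lra.
rewrite ler_pdivrMr ?mulr_gt0//; last lra.
have -> : (1 + `|c - b|) * (tau k / ((a + tau k) * (c + tau k))) *
  ((a + tau k) * (b + tau k)) = tau k * ((1 + `|c - b|) * (b + tau k) / (c + tau k)).
  by field; rewrite !lt0r_neq0.
rewrite ler_peMr ?(ltW (tp k))// ler_pdivlMr// mul1r.
have := ler_norm (c - b); have := normr_ge0 (c - b); nra.
Qed.

Lemma yk_mono a a' b : -2 <= a -> a <= a' -> -2 <= b -> y a' b <= y a b.
Proof.
move=> a2 aa b2; have a2' : -2 <= a' by exact: le_trans aa.
apply: rsum_le; [exact: iy|exact: iy|] => k; rewrite /yterm; have t := tg k.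
apply: ler_wpM2l; first lra.
by rewrite lef_pV2 ?posrE ?mulr_gt0//; try lra; rewrite ler_wpM2r//; lra.
Qed.

Lemma yk_small a b : -2 <= a -> -2 <= b -> y a b <= 50^-1.
Proof.
move=> a2 b2; apply: (@le_trans _ _ (2 / 100)); last lra.
apply: le_trans (rsum_tauV tau0 tauS _); last lra.
apply: rsum_le; [exact: iy|exact: tauV_integrable|].
by move=> k; exact: yterm_le.
Qed.

Lemma hol_resolvent Q (t : R) : Q `<=` H -> 200 <= t ->
  hol Q (2 / t) (fun s => (s + t%:C%C)^-1) (fun s => - (s + t%:C%C)^-1 ^+ 2).
Proof.
move=> QH t2 s s' /QH hs /QH hs'.
have t0 : 0 < t by lra.
have bnd u : H u -> normc (u + t%:C%C)^-1 <= 2 / t.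
  move=> hu; rewrite normcV -[2 / t]invf_div lef_pV2 ?posrE; last 2 first.
  - by have := wide_half hu t2; lra.
  - by rewrite divr_gt0.
  exact: wide_half.
have t1 : 2 / t <= 1 by rewrite ler_pdivrMr//; lra.
have p0 : 0 <= 2 / t by rewrite divr_ge0// ltW.
split; first exact: bnd.
  rewrite normcN normcX expr2; apply: (@le_trans _ _ (2 / t * 1)); last by rewrite mulr1.
  apply: ler_pM; rewrite ?normc_ge0 ?bnd//; exact: le_trans (bnd _ hs) t1.
have -> : (s' + t%:C%C)^-1 - (s + t%:C%C)^-1 - (s' - s) * - (s + t%:C%C)^-1 ^+ 2 =
   (s' + t%:C%C)^-1 * (s + t%:C%C)^-1 ^+ 2 * (s' - s) ^+ 2.
  by field; rewrite !wide_neq0.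
rewrite normcM [normc ((s' - s) ^+ 2)]normcX ler_wpM2r ?sqr_ge0//.
rewrite normcM normcX -[leRHS]mulr1; apply: ler_pM; rewrite ?normc_ge0 ?sqr_ge0 ?bnd//.
by rewrite expr_le1 ?normc_ge0//; exact: le_trans (bnd _ hs) t1.
Qed.

Lemma hol_csum Q c (u u' : nat -> R[i] -> R[i]) :
  (forall k, hol Q (c / tau k) (u k) (u' k)) ->
  hol Q (rsum (fun k => c / tau k)) (fun s => csum (u ^~ s)) (fun s => csum (u' ^~ s)).
Proof.
move=> h; apply: hol_cint => //; exact: tauV_integrable.
Qed.

Lemma hol_Xk Q B : Q `<=` H -> 1 <= B -> (forall s, Q s -> normc s <= B) ->
  exists N X', hol Q N X X'.
Proof.
move=> QH B1 QB; do 2 eexists; apply: hol_add; first exact: hol_cst.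
apply: (@hol_csum Q (12 * B) (fun k s => s / (s + (tau k)%:C%C))
  (fun k s => 1 * (s + (tau k)%:C%C)^-1 + s * (- (s + (tau k)%:C%C)^-1 ^+ 2))) => k.
apply: hol_mono (hol_mul (hol_id B1 QB) (hol_resolvent QH (tg k))).
by rewrite le_eqVlt; apply/orP; left; apply/eqP; ring.
Qed.

Lemma hol_Yk_diag Q : Q `<=` H -> exists N Y', hol Q N (fun s => Y s s) Y'.
Proof.
move=> QH; exists (rsum (fun k => 144 / tau k)).
pose u' k s := 0 * ((s + (tau k)%:C%C)^-1 * (s + (tau k)%:C%C)^-1) +
   (tau k)%:C%C * (- (s + (tau k)%:C%C)^-1 ^+ 2 * (s + (tau k)%:C%C)^-1 +
   (s + (tau k)%:C%C)^-1 * (- (s + (tau k)%:C%C)^-1 ^+ 2)).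
exists (fun s => csum (u' ^~ s)).
apply: (@hol_csum Q 144 (fun k s => Yterm tau s s k)) => k.
have h := hol_mul (@hol_cst R Q (tau k)%:C%C)
  (hol_mul (hol_resolvent QH (tg k)) (hol_resolvent QH (tg k))).
apply: hol_mono (hol_ext _ _ h) => //; last by move=> s Qs; rewrite /Yterm -invfM.
rewrite normc_real gtr0_norm//; have t0 := lt0r_neq0 (tp k).
by rewrite le_eqVlt; apply/orP; left; apply/eqP; field.
Qed.

Lemma hol_Yk Q t : Q `<=` H -> H t -> exists N Y', hol Q N (fun s => Y s t) Y'.
Proof.
move=> QH ht; exists (rsum (fun k => 24 / tau k)).
pose u' k s := 0 * (s + (tau k)%:C%C)^-1 +
   (tau k)%:C%C / (t + (tau k)%:C%C) * (- (s + (tau k)%:C%C)^-1 ^+ 2).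
exists (fun s => csum (u' ^~ s)).
apply: (@hol_csum Q 24 (fun k s => Yterm tau s t k)) => k.
have t0 := tp k.
have h := hol_mul (@hol_cst R Q ((tau k)%:C%C / (t + (tau k)%:C%C))) (hol_resolvent QH (tg k)).
apply: hol_mono (hol_ext _ _ h) => //; last first.
  by move=> s Qs; rewrite /Yterm invfM mulrAC mulrA.
have -> : 24 / tau k = 6 * (2 * (2 / tau k)) by ring.
rewrite ler_pM2l// ler_wpM2r ?divr_ge0 ?(ltW t0)//.
rewrite normc_div normc_real gtr0_norm// ler_pdivrMr; last by have := wide_half ht (tg k); lra.
by have := wide_half ht (tg k); lra.
Qed.

(** The slow map on the real axis.  By [xiB] an increment is the length of the
    step times [yk], so that sums of [yk] over consecutive steps telescope. *)
Definition xi (a : R) : R := cRe (X a%:C%C).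

Lemma wide_real a : -2 <= a -> H a%:C%C.
Proof. by move=> a2; split => //=; rewrite normr0. Qed.

Lemma Re_Yk_real a b : cRe (Y a%:C%C b%:C%C) = y a b.
Proof.
transitivity (rsum (fun k => cRe (Yterm tau a%:C%C b%:C%C k))) => //.
apply: eq_Rintegral => k _; have -> : Yterm tau a%:C%C b%:C%C k = (yterm tau a b k)%:C%C.
  by rewrite /Yterm /yterm !(rmorphM, fmorphV, rmorphD).
by [].
Qed.

Lemma xiB a b : -2 <= a -> -2 <= b -> xi a - xi b = (a - b) * y a b.
Proof.
move=> a2 b2; rewrite /xi -cReB XkB; try exact: wide_real.
by rewrite -rmorphB cRe_scal Re_Yk_real.
Qed.

Lemma xi_mono a b : -2 <= a -> a <= b -> xi a <= xi b.
Proof.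
move=> a2 ab; rewrite -subr_ge0 xiB//; last exact: le_trans ab.
by rewrite mulr_ge0 ?subr_ge0// yk_ge0// (le_trans a2 ab).
Qed.

Lemma Re_Xk_close s : H s -> `|cRe (X s) - xi (cRe s)| <= 10^-1.
Proof.
move=> hs; have hr : H (cRe s)%:C%C by apply: wide_real; case: hs.
rewrite /xi -cReB XkB//; apply: le_trans (Re_le_normc _) _; rewrite normcM.
have h1 : normc (s - (cRe s)%:C%C) <= 5.
  apply: le_trans (normc_le_ReIm _) _; rewrite cReB cImB /= subrr normr0 add0r subr0.
  by case: hs.
have h2 : normc (Y s (cRe s)%:C%C) <= 50^-1.
  apply: le_trans (Yk_le hs hr) _; apply: yk_small; by case: hs.
have := ler_pM (normc_ge0 _) (normc_ge0 _) h1 h2; lra.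
Qed.

Lemma xi0 : xi 0 = 3.
Proof.
have z0 : csum (fun=> 0 : R[i]) = 0.
  have b k : normc (0 : R[i]) <= 1 * geomw R k by rewrite normc0 mul1r geomw_ge0.
  have := csumL 0 0 (geomw_integrable 1) (geomw_integrable 1) b b.
  by rewrite !mul0r addr0.
rewrite /xi /Xk (_ : (fun k => _) = fun=> 0); last first.
  by apply/funext => k; rewrite rmorph0 mul0r.
rewrite z0 addr0.
have -> : (3 : R[i]) = (3 : R)%:C%C by rewrite rmorph_nat.
by [].
Qed.

Lemma Re_Xk_ge s : H s -> 2 < cRe (X s).
Proof.
move=> hs; have h1 : xi (-2) <= xi (cRe s) by apply: xi_mono => //; case: hs.
have z2 : -2 <= 0 :> R by lra.
have h2 := xiB (lexx (-2)) z2; have h3 := yk_small (lexx (-2)) z2.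
have := Re_Xk_close hs; rewrite ler_norml => /andP[h4 _].
rewrite xi0 in h2; lra.
Qed.

(** Each of the first [n] terms is at least 1/2. *)
Lemma xi_ge n a : tau n <= a -> 3 + n%:R / 2 <= xi a.
Proof.
move=> na; have t0 := tp n; have a0 : 0 < a by lra.
have : xi a - xi 0 = (a - 0) * y a 0 by apply: xiB; lra.
rewrite xi0 subr0 => e; have {e}-> : xi a = 3 + a * y a 0 by rewrite -e; ring.
rewrite lerD2l -ler_pdivrMl//.
have a2 : -2 <= a by lra.
have z2 : -2 <= 0 :> R by lra.
apply: le_trans _ (rsum_ge_partial n (fun k => ltW (yterm_gt0 tau0 tauS k a2 z2)) (iy a2 z2)).
have mono k : (k < n)%N -> tau k <= tau n.
  move=> kn; have := tau_grow tauS k (n - k); rewrite subnKC ?(ltnW kn)// => h.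
  by apply: le_trans h; rewrite ler_peMr ?(ltW (tp k))// exprn_ege1// ler1n.
apply: (@le_trans _ _ (\sum_(0 <= k < n) (a^-1 * 2^-1))).
  by rewrite sumr_const_nat subn0 -mulr_natl; lra.
apply: ler_sum_nat => k /andP[_ kn]; have kt := mono _ kn; have tk := tp k.
have at0 : 0 < a + tau k by lra.
have -> : yterm tau a 0 k = (a + tau k)^-1.
  by rewrite /yterm add0r; field; rewrite !lt0r_neq0.
by rewrite -invfM lef_pV2 ?posrE//; lra.
Qed.

(** The first [K] terms are at most 1 up to an error, and the others are a
    geometric tail of ratio 1/2 whose size is of order [|s| / tau K]. *)
Lemma Xk_upper s K : H s ->
  normc (X s) <= 3 + K%:R + 4 * (cRe s + 9) * 2 ^+ K / tau K.
Proof.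
move=> hs; set a := cRe s; have a2 : -2 <= a by case: hs.
have tK := tp K.
pose c := 2 * (a + 9) * 2 ^+ K / tau K.
have c0 : 0 <= c by rewrite /c divr_ge0 ?mulr_ge0 ?exprn_ge0//; lra.
have ib := integrableMDl 1 c measurableT (indic_integrable R K) (@geomw_integrable R 1).
have bnd k : normc (s / (s + (tau k)%:C%C)) <= 1 * (k < K)%N%:R + c * (1 * geomw R k).
  have [h1 h2] := wide_lower hs (tg k); have t0 := tp k.
  rewrite normc_div ler_pdivrMr; last by rewrite -/a in h1 h2; lra.
  have sn : normc s <= `|a| + 5.
    by apply: le_trans (normc_le_ReIm _) _; rewrite lerD2l; case: hs.
  have a4 : `|a| + 5 <= a + 9.
    by have [] := ger0P a; lra.
  rewrite !mul1r; have [kK|Kk] := ltnP k K.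
    apply: (@le_trans _ _ ((1 + c * geomw R k) * (a + tau k))); last first.
      by apply: ler_wpM2l => //; apply: addr_ge0 => //; apply: mulr_ge0 => //; exact: geomw_ge0.
    have tk := tg k.
    have p0 : 0 <= c * geomw R k * (a + tau k) by apply: mulr_ge0; [apply: mulr_ge0 => //; exact: geomw_ge0|lra].
    by rewrite mulrDl mul1r; apply: le_trans sn _; lra.
  rewrite add0r; apply: le_trans sn _; apply: le_trans a4 _.
  have tk : tau K * 2 ^+ (k - K) <= tau k by have := tau_grow tauS K (k - K); rewrite subnKC.
  apply: (@le_trans _ _ (c * geomw R k * (tau k / 2))); last first.
    by apply: ler_wpM2l; [apply: mulr_ge0 => //; exact: geomw_ge0|exact: wide_half].
  have -> : c * geomw R k * (tau k / 2) = (a + 9) * (tau k / (tau K * 2 ^+ (k - K))).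
    rewrite /c /geomw exprVn -{1}(subnKC Kk) exprD; field.
    by rewrite !expf_neq0// lt0r_neq0.
  rewrite ler_peMr//; first by lra.
  by rewrite ler_pdivlMr ?mul1r// mulr_gt0// exprn_gt0.
apply: le_trans (le_normcD _ _) _; rewrite -addrA; apply: lerD.
  have -> : (3 : R[i]) = (3 : R)%:C%C by rewrite rmorph_nat.
  by rewrite normc_real ger0_norm.
apply: le_trans (csum_le ib bnd) _.
rewrite /rsum RintegralMD//; [|exact: indic_integrable|exact: geomw_integrable].
rewrite -/(rsum _) -/(rsum _) rsum_indic rsum_geomw mul1r lerD2l /c.
by rewrite le_eqVlt; apply/orP; left; apply/eqP; ring.
Qed.

(** The same splitting at [K] as in [Xk_upper]: the first [K] terms are at most
    [1 / (a + 9)] each. *)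
Lemma yk_thin K a : -2 <= a ->
  y a a <= K%:R / (a + 9) + 2 ^+ K * 4 / tau K.
Proof.
move=> a2; have tK := tp K.
pose c := 2 * 2 ^+ K / tau K.
have c0 : 0 <= c by rewrite /c divr_ge0 ?mulr_ge0 ?exprn_ge0//; lra.
have a9 : 0 <= (a + 9)^-1 by rewrite invr_ge0; lra.
have ib := integrableMDl (a + 9)^-1 c measurableT (indic_integrable R K) (@geomw_integrable R 1).
apply: (@le_trans _ _ (rsum (fun k => (a + 9)^-1 * (k < K)%N%:R + c * (1 * geomw R k)))).
  apply: rsum_le => //; first exact: iy.
  move=> k; rewrite mul1r; have tk := tg k.
  have [kK|Kk] := ltnP k K.
    have h1 : yterm tau a a k <= (a + 9)^-1.
      rewrite /yterm ler_pdivrMr; last by rewrite mulr_gt0//; lra.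
      rewrite -ler_pdivrMl ?invr_gt0//; last lra.
      by rewrite invrK; nra.
    by rewrite mulr1; apply: le_trans h1 _; rewrite lerDl mulr_ge0 ?geomw_ge0.
  rewrite mulr0 add0r; apply: le_trans (yterm_le tau0 tauS k a2 a2) _.
  have h : tau K * 2 ^+ (k - K) <= tau k by have := tau_grow tauS K (k - K); rewrite subnKC.
  have -> : c * geomw R k = 2 / (tau K * 2 ^+ (k - K)).
    rewrite /c /geomw exprVn -{1}(subnKC Kk) exprD; field.
    by rewrite !expf_neq0// lt0r_neq0.
  by rewrite ler_wpM2l// lef_pV2 ?posrE ?mulr_gt0 ?exprn_gt0.
rewrite /rsum RintegralMD//; [|exact: indic_integrable|exact: geomw_integrable].
rewrite -/(rsum _) -/(rsum _) rsum_indic rsum_geomw mul1r /c.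
by rewrite le_eqVlt; apply/orP; left; apply/eqP; ring.
Qed.

(** If [|X s| >= K + 4] then by [Xk_upper] the real part of [s] is at least of
    order [tau K / 2^K], and [yk_thin] applies.  This is how a fast sequence
    [tau] makes the images of boxes arbitrarily small. *)
Lemma yk_far K s a : H s -> K%:R + 4 <= normc (X s) -> -2 <= a -> cRe s - 1 <= a ->
  y a a <= (K.+2)%:R * 2 ^+ K * 8 / tau K.
Proof.
move=> hs hX a2 sa; apply: le_trans (yk_thin K a2) _.
have tK := tp K.
have := Xk_upper K hs; set b := cRe s in sa * => hu.
have b2 : -2 <= b by case: hs.
have P : 0 < 2 ^+ K :> R by exact: exprn_gt0.
have h1 : 1 <= 4 * (b + 9) * 2 ^+ K / tau K by lra.
rewrite ler_pdivlMr// mul1r in h1.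
have h2 : (a + 9)^-1 <= 2 ^+ K * 8 / tau K.
  rewrite -div1r ler_pdivrMr; last lra.
  rewrite mulrAC ler_pdivlMr// mul1r; apply: le_trans h1 _.
  have -> : 2 ^+ K * 8 * (a + 9) = (8 * (a + 9)) * 2 ^+ K by ring.
  by rewrite ler_pM2r//; lra.
have h3 : K%:R * (a + 9)^-1 <= K%:R * (2 ^+ K * 8 / tau K) by rewrite ler_wpM2l.
have -> : K.+2%:R = K%:R + 2 :> R by rewrite -!natr1; ring.
have h4 : 0 <= 2 ^+ K * 4 / tau K by rewrite divr_ge0 ?mulr_ge0 ?(ltW P)// ltW.
have -> : (K%:R + 2) * 2 ^+ K * 8 / tau K =
   K%:R * (2 ^+ K * 8 / tau K) + 2 ^+ K * 4 / tau K * 4 by ring.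
apply: lerD => //; lra.
Qed.

End SlowMapEstimates.

(** * Local surjectivity of the slow map *)

Section LocalSurjectivity.
Variable R : realType.

Lemma rect_min (x1 x2 y1 y2 L : R) (f : R[i] -> R) : x1 <= x2 -> y1 <= y2 ->
  (forall s s', rect x1 x2 y1 y2 s -> rect x1 x2 y1 y2 s' ->
     `|f s' - f s| <= L * normc (s' - s)) ->
  exists2 c, rect x1 x2 y1 y2 c & forall s, rect x1 x2 y1 y2 s -> f c <= f s.
Proof.
move=> x12 y12 HL.
pose A : set (R * R) := `[x1, x2] `*` `[y1, y2].
pose F (p : R * R) : R := f (Complex p.1 p.2).
have rA p : A p -> rect x1 x2 y1 y2 (Complex p.1 p.2).
  by case: p => u v [] /=; rewrite !in_itv.
have cA : compact A by apply: compact_setX; exact: segment_compact.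
have nA : (A !=set0)%classic.
  by exists (x1, y1); split; rewrite /= in_itv /= lexx.
have L0 : 0 < `|L| + 1 by rewrite ltr_wpDl.
have cF : {within A, continuous F}.
  apply/subspace_continuousP => p Ap; apply/cvgrPdist_le => e e0.
  have d0 : 0 < e / (`|L| + 1) / 2 by rewrite !divr_gt0.
  rewrite near_withinE; apply: filterS (nbhsx_ballx p _ d0) => q [q1 q2] Aq.
  rewrite distrC; apply: le_trans (HL _ _ (rA _ Ap) (rA _ Aq)) _.
  apply: (@le_trans _ _ ((`|L| + 1) * normc (Complex q.1 q.2 - Complex p.1 p.2))).
    by rewrite ler_wpM2r ?normc_ge0//; have := ler_norm L; lra.
  rewrite mulrC -ler_pdivlMr//; apply: le_trans (normc_le_ReIm _) _.
  rewrite cReB cImB /= (splitr (e / _)); by apply: lerD; rewrite distrC; [exact: (ltW q1)|exact: (ltW q2)].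
have [c cIA cm] := compact_EVT_min nA cA cF.
exists (Complex c.1 c.2); first by apply: rA; rewrite inE in cIA.
move=> [u v] [su sv]; apply: (cm (u, v)); rewrite inE; split; rewrite /= in_itv.
  exact: su.
exact: sv.
Qed.

Variable tau : nat -> R.
Hypothesis tau0 : 200 <= tau 0%N.
Hypothesis tauS : forall k, 2 * tau k <= tau k.+1.
Notation X := (Xk tau).
Notation Y := (Yk tau).
Notation y := (yk tau).
Notation H := (@wide_strip R).

Let squareP (s0 s : R[i]) (r : R) :
  `|cRe (s - s0)| <= r -> `|cIm (s - s0)| <= r ->
  rect (cRe s0 - r) (cRe s0 + r) (cIm s0 - r) (cIm s0 + r) s.
Proof.
rewrite cReB cImB !ler_norml => /andP[? ?] /andP[? ?].
by split; apply/andP; split; lra.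
Qed.

(** Minimise [|X s - z|] over the square.  The minimum is not attained on the
    boundary, where [X s] is too far from [X s0]; at an interior minimum a small
    Newton step would decrease the distance unless [X s = z]. *)
Lemma Xk_local_surj s0 r z : 0 < r <= 1 ->
  (forall s, `|cRe (s - s0)| <= r -> `|cIm (s - s0)| <= r -> H s) ->
  normc (z - X s0) < r / 8 * y (cRe s0) (cRe s0) ->
  exists s, [/\ `|cRe (s - s0)| <= r, `|cIm (s - s0)| <= r & X s = z].
Proof.
move=> /andP[r0 r1] HQ zs.
pose a := cRe s0; pose b := cIm s0.
pose Q := rect (a - r) (a + r) (b - r) (b + r).
have QP s : Q s -> `|cRe (s - s0)| <= r /\ `|cIm (s - s0)| <= r.
  by case=> /andP[h1 h2] /andP[h3 h4]; rewrite cReB cImB !ler_norml -/a -/b; split; apply/andP; split; lra.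
have QH : Q `<=` H by move=> s /QP[h1 h2]; exact: HQ.
have hs0 : H s0 by apply: HQ; rewrite subrr /= normr0 ltW.
have a2 : -2 <= a by case: hs0.
have Q0 : Q s0 by apply: squareP; rewrite subrr /= normr0 ltW.
have yL s s' : H s -> H s' -> normc (X s' - X s) <= 50^-1 * normc (s' - s).
  move=> hs hs'; rewrite XkB// normcM mulrC ler_wpM2r ?normc_ge0//.
  apply: le_trans (Yk_le tau0 tauS hs' hs) _; apply: yk_small => //; by [case: hs|case: hs'].
have p1 : a - r <= a + r by lra.
have p2 : b - r <= b + r by lra.
have lip0 s s' : Q s -> Q s' ->
    `|normc (X s' - z) - normc (X s - z)| <= 50^-1 * normc (s' - s).
  move=> /QH hs /QH hs'; apply: le_trans (yL _ _ hs hs').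
  have -> : X s' - X s = (X s' - z) - (X s - z) by ring.
  rewrite ler_norml; apply/andP; split.
    by rewrite lerBrDr; have := normc_triangle_lower (X s - z) (X s' - z); rewrite (normcB (X s - z)); lra.
  exact: normc_triangle_lower.
have [c Qc cm] := rect_min p1 p2 lip0.
have hc := QH _ Qc; have [c1 c2] := QP _ Qc.
have [e|ne] := eqVneq (X c) z; first by exists c.
exfalso.
pose y0 := y a a.
have y00 : 0 < y0 by exact: yk_gt0.
have cz : normc (X c - z) <= normc (X s0 - z) by exact: cm.
(* the minimum is not attained on the boundary of the square *)
have bd s : Q s -> r <= normc (s - s0) -> normc (X s0 - z) < normc (X s - z).
  move=> Qs rs; have hs := QH _ Qs; have [h1 h2] := QP _ Qs.
  have := Yk_ge tau0 tauS hs hs0.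
  have sa : -2 <= cRe s by case: hs.
  have := yk_ratio tau0 tauS a2 a2 sa; rewrite -/a -/y0.
  have -> : cRe s - a = cRe (s - s0) by rewrite cReB.
  move=> h3; rewrite (ykC _ _ a) => h4.
  have h5 : y0 <= 4 * normc (Y s s0).
    have yp : 0 <= y a (cRe s) by exact: yk_ge0.
    by nra.
  have h6 : r / 4 * y0 <= normc (X s - X s0).
    by rewrite XkB// normcM; have := normc_ge0 (Y s s0); nra.
  have h7 : normc (X s - X s0) - normc (X s0 - z) <= normc (X s - z).
    have -> : X s - z = (X s - X s0) - (z - X s0) by ring.
    by rewrite (normcB _ z) normc_triangle_lower.
  rewrite -/a -/y0 in zs; rewrite normcB in zs; lra.
have cr : normc (c - s0) < r.
  by rewrite ltNge; apply/negP => /(bd _ Qc); rewrite ltNge cz.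
(* the Newton direction at [c], with a step [e] that keeps the square and makes
   the variation of the difference quotient negligible *)
have [N [Y' hN]] := hol_Yk tau0 tauS QH hc.
have N0 := hol_ge0 Qc hN.
set w := X c - z in ne cz *.
have w0 : 0 < normc w by rewrite normc_gt0 subr_eq0.
have Y0 : 0 < normc (Y c c).
  have cc : -2 <= cRe c by case: hc.
  by apply: lt_le_trans (Yk_ge tau0 tauS hc hc); rewrite mulr_gt0// yk_gt0.
have Yn : Y c c != 0 by rewrite -normc_gt0.
pose v := w / Y c c.
pose e := Num.min (Num.min 1 ((r - normc (c - s0)) / (normc v + 1)))
   (normc w / (2 * (2 * N * normc v ^+ 2 + 1))).
have nv := normc_ge0 v.
have D0 : 0 < 2 * (2 * N * normc v ^+ 2 + 1) by rewrite mulr_gt0// ltr_wpDl// !mulr_ge0// sqr_ge0.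
have e0 : 0 < e.
  by rewrite /e !lt_min ltr01 !divr_gt0 ?subr_gt0 ?ltr_wpDl.
have e1 : e <= 1 by rewrite /e !ge_min lexx.
have e2 : e * (normc v + 1) <= r - normc (c - s0).
  by rewrite -ler_pdivlMr ?ltr_wpDl// /e !ge_min lexx orbT.
have e3 : e * (2 * (2 * N * normc v ^+ 2 + 1)) <= normc w.
  by rewrite -ler_pdivlMr// /e !ge_min lexx orbT.
pose s := c - e%:C%C * v.
have sr : normc (s - s0) <= r.
  have -> : s - s0 = (c - s0) - e%:C%C * v by rewrite /s; ring.
  apply: le_trans (le_normcB _ _) _; rewrite normcM normc_real ger0_norm ?ltW//.
  have := e2; rewrite mulrDr mulr1; lra.
have Qs : Q s := squareP (le_trans (Re_le_normc _) sr) (le_trans (Im_le_normc _) sr).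
have hs := QH _ Qs.
have := cm _ Qs; rewrite leNgt => /negP; apply; rewrite -/w.
have -> : X s - z = (1 - e)%:C%C * w - e%:C%C * v * (Y s c - Y c c).
  have -> : X s - z = (X s - X c) + w by rewrite /w; ring.
  rewrite XkB// rmorphB rmorph1.
  have -> : s - c = - (e%:C%C * v) by rewrite /s; ring.
  have -> : w = v * Y c c by rewrite /v divfK.
  ring.
apply: le_lt_trans (le_normcB _ _) _.
rewrite !normcM !normc_real (ger0_norm (ltW e0)) ger0_norm ?subr_ge0//.
have lip := hol_lip hN Qc Qs.
have sc : normc (s - c) = e * normc v.
  have -> : s - c = - (e%:C%C * v) by rewrite /s; ring.
  by rewrite normcN normcM normc_real ger0_norm ?ltW.
rewrite sc in lip.
have h8 : e * normc v * normc (Y s c - Y c c) <= e * normc v * (2 * N * (e * normc v)).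
  by apply: ler_wpM2l => //; apply: mulr_ge0 => //; exact: ltW.
apply: (@le_lt_trans _ _ ((1 - e) * normc w + e * normc v * (2 * N * (e * normc v)))).
  by rewrite lerD2l -(normcM w); exact: h8.
have -> : e * normc v * (2 * N * (e * normc v)) = e * (e * (2 * N * normc v ^+ 2)) by ring.
have h9 : e * (2 * N * normc v ^+ 2) < normc w.
  apply: lt_le_trans e3; rewrite ltr_pM2l//.
  have : 0 <= 2 * N * normc v ^+ 2 by rewrite !mulr_ge0// sqr_ge0.
  lra.
have : e * (e * (2 * N * normc v ^+ 2)) < e * normc w by rewrite ltr_pM2l.
lra.
Qed.

End LocalSurjectivity.

(** * Dominated integrals over half lines and half strips *)

Section HalfLines.
Variable R : realType.
Notation leb := (@lebesgue_measure R).

Lemma expN_within (N : R) : {within `[N, +oo[, continuous (fun t : R => expR (- t))}.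
Proof.
apply: continuous_subspaceT => t; apply: continuous_comp; first exact: opp_continuous.
exact: continuous_expR.
Qed.

Lemma expN_int (N : R) : (\int[leb]_(t in `[N, +oo[) (expR (- t))%:E = (expR (- N))%:E)%E.
Proof.
have d (t : R) : is_derive t 1 (fun t : R => - expR (- t)) (expR (- t)).
  have d1 : is_derive t 1 (fun t : R => - t) (- 1) by apply: is_deriveN.
  have := is_deriveN (@is_derive1_comp R (@expR R) (fun t : R => - t) t _ _ (is_derive_expR _) d1).
  by rewrite mulrN1 opprK.
rewrite (@ge0_continuous_FTC2y R (fun t => expR (- t)) (fun t => - expR (- t)) N 0).
- by rewrite sub0e -EFinN opprK.
- by move=> t _; exact: expR_ge0.
- exact: expN_within.
- by rewrite -oppr0; apply: cvgN; exact: cvgr_expR.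
- by move=> t _; have [] := d t.
- apply: cvg_at_right_filter; apply: cvgN; apply: continuous_comp.
    exact: opp_continuous.
  exact: continuous_expR.
- by move=> t _; rewrite derive1E; have [_ ->] := d t.
Qed.

Lemma expN_integrable (N C : R) : leb.-integrable `[N, +oo[ (EFin \o (fun t => C * expR (- t))).
Proof.
suff h : leb.-integrable `[N, +oo[ (EFin \o (fun t => expR (- t))).
  by apply: (@integrableZl _ _ R leb _ _ C _ h); exact: measurable_itv.
apply/integrableP; split.
  by apply/measurable_EFinP; apply: subspace_continuous_measurable_fun => //; exact: expN_within.
under eq_integral => t _ do rewrite gee0_abs ?lee_fin ?expR_ge0//.
by rewrite expN_int ltry.
Qed.

Lemma Rint_expN (N C : R) : 0 <= C ->
  Rintegral leb `[N, +oo[ (fun t => C * expR (- t)) = C * expR (- N).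
Proof.
move=> C0; have h := expN_integrable N 1.
have h' : leb.-integrable `[N, +oo[ (EFin \o (fun t => expR (- t))).
  by apply: eq_integrable h => // t _; rewrite /= mul1r.
by rewrite RintegralZl// /Rintegral expN_int.
Qed.

Implicit Types g : R -> R[i].

Lemma tail_cintegrable (N C : R) g : clip `[N, +oo[ g ->
  (forall t, N <= t -> normc (g t) <= C * expR (- t)) -> cintegrable leb `[N, +oo[ g.
Proof.
move=> cl gC; apply: (cintegrable_le _ _ _ (expN_integrable N C)) => //.
  exact: clip_cmeas.
by move=> t /=; rewrite in_itv /= andbT; exact: gC.
Qed.

Lemma tail_le (N C : R) g : 0 <= C -> clip `[N, +oo[ g ->
  (forall t, N <= t -> normc (g t) <= C * expR (- t)) ->
  normc (cint leb `[N, +oo[ g) <= C * expR (- N).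
Proof.
move=> C0 cl gC; rewrite -Rint_expN//; apply: cint_le => //.
- exact: tail_cintegrable gC.
- exact: expN_integrable.
by move=> t /=; rewrite in_itv /= andbT; exact: gC.
Qed.

(** The right end [b] may be finite or infinite. *)
Lemma cint_split (b : itv_bound R) (N x : R) g :
  cintegrable leb [set` Interval (BLeft N) b] g -> N <= x -> (BRight x <= b)%O ->
  cint leb [set` Interval (BLeft N) b] g =
  cint leb `[N, x] g + cint leb [set` Interval (BLeft x) b] g.
Proof.
move=> [i1 i2] Nx xb.
have h (f : R -> R) : leb.-integrable [set` Interval (BLeft N) b] (EFin \o f) ->
   Rintegral leb [set` Interval (BLeft N) b] f = Rintegral leb `[N, x] f +
   Rintegral leb [set` Interval (BLeft x) b] f.
  move=> fi; have nb : (BLeft N <= BRight x :> itv_bound R)%O by rewrite bnd_simp.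
  have := Rintegral_itvB fi nb xb; rewrite Rintegral_itv_obnd_cbnd; last first.
    apply: integrableS fi => //; apply: subset_itvr; exact: nb.
  by move=> <-; rewrite addrC subrK.
by apply: eq_ReIm; rewrite ?cReD ?cImD /= h.
Qed.

End HalfLines.

Section Contour.
Variable R : realType.
Notation leb := (@lebesgue_measure R).
Variable tau : nat -> R.
Hypothesis tau0 : 200 <= tau 0%N.
Hypothesis tauS : forall k, 2 * tau k <= tau k.+1.
Notation X := (Xk tau).
Notation Y := (Yk tau).
Notation y := (yk tau).
Notation H := (@wide_strip R).

Definition phi (s : R[i]) : R[i] := cexp (cexp s).

(** The Cauchy kernel for [phi o X^-1], pulled back to the half strip: the
    factor [Y s s] is the derivative of [X]. *)
Definition ker (z s : R[i]) : R[i] := phi s * (Y s s / (X s - z)).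

Lemma normc_phi s : normc (phi s) = expR (expR (cRe s) * cos (cIm s)).
Proof. by rewrite normc_cexp. Qed.

Lemma hol_phi (Q : set R[i]) B : (forall s, Q s -> normc s <= B) ->
  exists N phi', hol Q N phi phi'.
Proof.
move=> QB; have h1 : hol Q (Num.max 1 B) id (fun=> 1).
  apply: hol_id; first by rewrite le_max lexx.
  by move=> s /QB h; rewrite le_max h orbT.
have [N2 h2] := hol_cexp h1; have [N3 h3] := hol_cexp h2.
by exists N3; eexists; exact: h3.
Qed.

Lemma hol_ker (Q : set R[i]) B d z : Q `<=` H -> (forall s, Q s -> normc s <= B) ->
  0 < d -> (forall s, Q s -> d <= normc (X s - z)) -> exists N K', hol Q N (ker z) K'.
Proof.
move=> QH QB d0 Qd; have [N1 [p1 h1]] := hol_phi QB.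
have [N2 [p2 h2]] := hol_Yk_diag tau0 tauS QH.
have QB' s : Q s -> normc s <= Num.max 1 B by move=> /QB h; rewrite le_max h orbT.
have B1 : 1 <= Num.max 1 B by rewrite le_max lexx.
have [N3 [p3 h3]] := hol_Xk tau0 tauS QH B1 QB'.
have h4 := hol_inv d0 Qd (hol_add h3 (@hol_cst R Q (- z))).
by do 2 eexists; apply: hol_mul h1 (hol_mul h2 h4).
Qed.

Lemma pi_lt4 : pi < 4 :> R.
Proof. by have := pihalf_lt2 R; lra. Qed.

(** On horizontal lines at these heights [cos] is at most -1/2, so [phi] decays
    doubly exponentially to the right. *)
Definition decay_range (c : R) := pi - pi / 4 <= `|c| <= pi + pi / 4.

Lemma decay_le5 c : decay_range c -> `|c| <= 5.
Proof. by move=> /andP[_ h]; apply: le_trans h _; have := pi_lt4; lra. Qed.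

Lemma cos_decay c : decay_range c -> cos c <= - 2^-1.
Proof.
rewrite -cos_norm => /andP[h1 h2]; have p0 := pi_gt0 R.
set u := `|c| - pi; have -> : `|c| = u + pi by rewrite /u; ring.
rewrite cosDpi lerN2 -cos_norm.
have q : 2^-1 <= cos (pi / 4) :> R.
  have c0 : 0 < cos (pi / 4) :> R by apply: cos_gt0_pihalf; apply/andP; split; lra.
  have := @cos_mulr2n R (pi / 4); rewrite (_ : (pi / 4) *+ 2 = pi / 2); last first.
    by rewrite -mulr_natr; field.
  rewrite cos_pihalf -mulr_natr => e; nra.
apply: le_trans q _; rewrite leNgt; apply/negP.
have u4 : `|u| <= pi / 4 by rewrite ler_norml /u; apply/andP; split; lra.
rewrite ltr_cos ?in_itv /=; [|by apply/andP; split; lra|].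
  by rewrite ltNge u4.
by rewrite normr_ge0 /=; lra.
Qed.

Lemma phi_decay s : decay_range (cIm s) -> normc (phi s) <= 2 * expR (- cRe s).
Proof.
move=> /cos_decay hc; rewrite normc_phi.
have e0 := expR_gt0 (cRe s).
apply: (@le_trans _ _ (expR (- (expR (cRe s) / 2)))).
  rewrite ler_expR; nra.
rewrite !expRN -[2 * _]invf_div lef_pV2 ?posrE ?divr_gt0 ?expR_gt0//.
by apply: le_trans (expR_ge1Dx _); lra.
Qed.

Lemma Ydiag_le1 s : H s -> normc (Y s s) <= 1.
Proof.
move=> hs; apply: le_trans (Yk_le tau0 tauS hs hs) _.
have h2 : -2 <= cRe s by case: hs.
have := yk_small tau0 tauS h2 h2; lra.
Qed.

Lemma ker_bound z s d : H s -> 0 < d -> d <= normc (X s - z) ->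
  normc (ker z s) <= d^-1 * normc (phi s).
Proof.
move=> hs d0 hd; rewrite normcM mulrC ler_wpM2r ?normc_ge0//.
rewrite normc_div; have := Ydiag_le1 hs.
rewrite -[d^-1]mul1r => h; apply: ler_pM; rewrite ?normc_ge0 ?invr_ge0 ?normc_ge0//.
by rewrite lef_pV2 ?posrE// (lt_le_trans d0).
Qed.

Lemma clip_ker_tail N c d z : -2 <= N -> `|c| <= 5 -> 0 < d ->
  (forall t, N <= t -> d <= normc (X (Complex t c) - z)) ->
  clip `[N, +oo[ (fun t => ker z (ray (Complex 0 c) 1 t)).
Proof.
move=> N2 c5 d0 hd x /=; rewrite in_itv /= andbT => Nx.
pose Q : set R[i] := [set s | N <= cRe s <= x + 1 /\ cIm s = c].
have QH : Q `<=` H.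
  by move=> s [/andP[h1 _] h2]; split; [exact: le_trans h1|rewrite h2].
have QB s : Q s -> normc s <= `|N| + `|x + 1| + 5.
  move=> [/andP[h1 h3] h2]; apply: le_trans (normc_le_ReIm _) _; apply: lerD; last by rewrite h2.
  rewrite ler_norml; apply/andP; split.
    have := ler_norm (- N); rewrite normrN; have := normr_ge0 (x + 1); lra.
  have := ler_norm (x + 1); have := normr_ge0 N; lra.
have Qd s : Q s -> d <= normc (X s - z).
  by case: s => u v [/= /andP[h1 _] ->]; exact: hd.
have [M [K' hK]] := hol_ker QH QB d0 Qd.
have cl : clip `[N, (x + 1)] (fun t => ker z (ray (Complex 0 c) 1 t)).
  by apply: (clip_ray hK) => t; rewrite /= in_itv /= ray_h => tI; split.
have [|L [e [e0 he]]] := cl x; first by rewrite /= in_itv /= Nx lerDl ler01.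
exists L, (Num.min e 1); split; first by rewrite lt_min e0 ltr01.
move=> t /=; rewrite in_itv /= andbT => Nt; rewrite lt_min => /andP[te t1].
apply: he => //; rewrite /= in_itv /= Nt /=.
by move: t1; rewrite ltr_norml => /andP[_]; lra.
Qed.

Lemma ker_tail_bound N c d z : -2 <= N -> decay_range c -> 0 < d ->
  (forall t, N <= t -> d <= normc (X (Complex t c) - z)) ->
  forall t, N <= t -> normc (ker z (ray (Complex 0 c) 1 t)) <= d^-1 * 2 * expR (- t).
Proof.
move=> N2 cD d0 hd t Nt; rewrite ray_h.
have hs : H (Complex t c) by split; [exact: le_trans Nt|exact: decay_le5].
apply: le_trans (ker_bound hs d0 (hd _ Nt)) _.
rewrite -mulrA ler_wpM2l ?invr_ge0 ?(ltW d0)//.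
exact: (@phi_decay (Complex t c)).
Qed.

Lemma hline_tail_le N c d z : -2 <= N -> decay_range c -> 0 < d ->
  (forall t, N <= t -> d <= normc (X (Complex t c) - z)) ->
  normc (hline c `[N, +oo[ (ker z)) <= d^-1 * 2 * expR (- N).
Proof.
move=> N2 cD d0 hd; rewrite /hline /lint mul1r.
apply: tail_le.
- by rewrite mulr_ge0// invr_ge0 ltW.
- exact: clip_ker_tail N2 (decay_le5 cD) d0 hd.
- exact: ker_tail_bound N2 cD d0 hd.
Qed.

Lemma hline_split N M c d z : -2 <= N -> N <= M -> decay_range c -> 0 < d ->
  (forall t, N <= t -> d <= normc (X (Complex t c) - z)) ->
  hline c `[N, +oo[ (ker z) = hline c `[N, M] (ker z) + hline c `[M, +oo[ (ker z).
Proof.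
move=> N2 NM cD d0 hd; rewrite /hline /lint !mul1r; apply: cint_split => //.
by apply: tail_cintegrable (ker_tail_bound N2 cD d0 hd); exact: clip_ker_tail N2 (decay_le5 cD) d0 hd.
Qed.

Lemma rect_bound (x1 x2 y1 y2 : R) s : rect x1 x2 y1 y2 s ->
  normc s <= `|x1| + `|x2| + (`|y1| + `|y2|).
Proof.
move=> [/andP[a1 a2] /andP[b1 b2]]; apply: le_trans (normc_le_ReIm _) _.
have h (u v w : R) : u <= v -> v <= w -> `|v| <= `|u| + `|w|.
  move=> uv vw; rewrite ler_norml; apply/andP; split.
    have := ler_norm (- u); rewrite normrN; have := normr_ge0 w; lra.
  have := ler_norm w; have := normr_ge0 u; lra.
by apply: lerD; exact: h.
Qed.

Lemma rect_wide (x1 x2 y1 y2 : R) : -2 <= x1 -> `|y1| <= 5 -> `|y2| <= 5 -> rect x1 x2 y1 y2 `<=` H.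
Proof.
move=> x12; rewrite !ler_norml => /andP[a1 a2] /andP[b1 b2] s [/andP[c1 c2] /andP[d1 d2]].
by split; [exact: le_trans c1|rewrite ler_norml; apply/andP; split; lra].
Qed.

Lemma exp_small (x C N : R) : (forall M, N <= M -> x <= C * expR (- M)) -> x <= 0.
Proof.
move=> h; apply/ler_addgt0Pl => e e0; rewrite addr0.
pose M := Num.max N (`|C| / e).
have Ce : `|C| / e <= M by rewrite /M le_max lexx orbT.
apply: le_trans (h M _) _; first by rewrite /M le_max lexx.
have E0 := expR_gt0 (- M).
apply: (@le_trans _ _ (`|C| * expR (- M))); first by apply: ler_wpM2r; [exact: ltW|exact: ler_norm].
rewrite ler_pdivrMr// in Ce.
rewrite expRN ler_pdivrMr ?expR_gt0//.
apply: le_trans Ce _; rewrite mulrC ler_wpM2l ?(ltW e0)//.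
by have := expR_ge1Dx M; lra.
Qed.

Let strip_alg (a1 a2 v1 v2 : R[i]) t1 t2 : a1 + v2 - a2 - v1 = 0 ->
  a1 + t1 - (a2 + t2) - v1 = t1 - t2 - v2.
Proof.
move=> e; have -> : a1 + t1 - (a2 + t2) - v1 = (t1 - t2 - v2) + (a1 + v2 - a2 - v1) by ring.
by rewrite e addr0.
Qed.

Let normcB3 (u v w : R[i]) (A B C : R) : normc u <= A -> normc v <= B -> normc w <= C ->
  normc (u - v - w) <= A + B + C.
Proof.
move=> h1 h2 h3; apply: le_trans (le_normcB _ _) _; apply: lerD => //.
by apply: le_trans (le_normcB _ _) _; apply: lerD.
Qed.

(** Cauchy's theorem for the strip truncated at abscissa [M]; the right side
    tends to 0 as [M] grows because of the decay of [phi]. *)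
Lemma strip_shift N c1 c2 d z : -2 <= N -> c1 < c2 -> 0 < d ->
  (forall c, c1 <= c <= c2 -> decay_range c) ->
  (forall s, N <= cRe s -> c1 <= cIm s <= c2 -> d <= normc (X s - z)) ->
  hline c1 `[N, +oo[ (ker z) - hline c2 `[N, +oo[ (ker z) = vline N `[c1, c2] (ker z).
Proof.
move=> N2 c12 d0 cD hd.
have D1 : decay_range c1 by apply: cD; rewrite lexx ltW.
have D2 : decay_range c2 by apply: cD; rewrite lexx ltW.
have l1 M : N <= M -> forall t, M <= t -> d <= normc (X (Complex t c1) - z).
  by move=> NM t Mt; apply: hd => /=; [exact: le_trans Mt|rewrite lexx ltW].
have l2 M : N <= M -> forall t, M <= t -> d <= normc (X (Complex t c2) - z).
  by move=> NM t Mt; apply: hd => /=; [exact: le_trans Mt|rewrite lexx ltW].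
apply/eqP; rewrite -subr_eq0 -normc_eq0; apply/eqP/le_anti; rewrite normc_ge0 andbT.
apply: (@exp_small _ (d^-1 * 2 * (2 + (c2 - c1))) (N + 1)) => M NM.
have NM' : N < M by lra.
have N2M : -2 <= M by lra.
have QH : rect N M c1 c2 `<=` H by apply: rect_wide => //; exact: decay_le5.
have Qd s : rect N M c1 c2 s -> d <= normc (X s - z).
  by move=> [/andP[h1 _] h2]; exact: hd.
have [K [K' hK]] := hol_ker QH (@rect_bound N M c1 c2) d0 Qd.
have := cauchy_thm NM' c12 hK; rewrite /oint => e.
rewrite (hline_split N2 (ltW NM') D1 d0 (l1 _ (lexx N))).
rewrite (hline_split N2 (ltW NM') D2 d0 (l2 _ (lexx N))).
set a1 := hline c1 `[N, M] _ in e *; set a2 := hline c2 `[N, M] _ in e *.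
set v1 := vline N _ _ in e *; set v2 := vline M _ _ in e *.
set t1 := hline c1 _ _; set t2 := hline c2 _ _.
rewrite (strip_alg t1 t2 e).
have e1 : normc t1 <= d^-1 * 2 * expR (- M) by apply: hline_tail_le => //; apply: l1; exact: ltW.
have e2 : normc t2 <= d^-1 * 2 * expR (- M) by apply: hline_tail_le => //; apply: l2; exact: ltW.
have e3 : normc v2 <= d^-1 * 2 * expR (- M) * (c2 - c1).
  rewrite -[leRHS]mul1r -[X in X * _](@normc_i R); apply: lint_le_cst; first exact: ltW.
    apply: (clip_ray hK) => t; rewrite /= in_itv /= ray_v => tI.
    by split => //=; rewrite lexx ltW.
  move=> t; rewrite /= in_itv /= ray_v => tI.
  have hs : H (Complex M t) by split => //=; apply: decay_le5; exact: cD.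
  apply: le_trans (ker_bound hs d0 _) _; first by apply: hd => //=; exact: ltW.
  rewrite -mulrA ler_wpM2l ?invr_ge0 ?(ltW d0)//.
  by apply: (@phi_decay (Complex M t)) => /=; exact: cD.
have -> : d^-1 * 2 * (2 + (c2 - c1)) * expR (- M) = d^-1 * 2 * expR (- M) +
   d^-1 * 2 * expR (- M) + d^-1 * 2 * expR (- M) * (c2 - c1) by ring.
exact: normcB3 e1 e2 e3.
Qed.

(** The positively oriented boundary of the half strip [Re s >= N, |Im s| <= b]:
    in along the upper ray, down the vertical side, out along the lower ray. *)
Definition ucont (N b : R) (g : R[i] -> R[i]) : R[i] :=
  hline (- b) `[N, +oo[ g - hline b `[N, +oo[ g - vline N `[- b, b] g.

Let cut_alg (p1 p2 q1 q2 v w : R[i]) :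
  p1 + p2 - (q1 + q2) - v - (p2 - q2 - w) = p1 + w - q1 - v.
Proof. by ring. Qed.

Let widen_alg (p p' q q' u v w : R[i]) : p - q = u -> p' - q' = v ->
  q' - p - w = p' - q - (v + (w + u)).
Proof. by move=> <- <-; ring. Qed.

(** The two half strips differ by a rectangle. *)
Lemma ucont_cut N M b d z : -2 <= N -> N <= M -> decay_range b -> 0 <= b -> 0 < d ->
  (forall t, N <= t -> d <= normc (X (Complex t b) - z)) ->
  (forall t, N <= t -> d <= normc (X (Complex t (- b)) - z)) ->
  ucont N b (ker z) - ucont M b (ker z) = oint N M (- b) b (ker z).
Proof.
move=> N2 NM bD b0 d0 h1 h2.
have bD' : decay_range (- b) by rewrite /decay_range normrN.
rewrite /ucont (hline_split N2 NM bD d0 h1) (hline_split N2 NM bD' d0 h2) /oint.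
exact: cut_alg.
Qed.

Lemma vline_split (x c1 c2 c3 : R) Q M' (f f' : R[i] -> R[i]) : hol Q M' f f' -> c1 <= c2 -> c2 <= c3 ->
  (forall t, c1 <= t <= c3 -> Q (Complex x t)) ->
  vline x `[c1, c3] f = vline x `[c1, c2] f + vline x `[c2, c3] f.
Proof.
move=> hf c12 c23 HQ; rewrite /vline /lint -mulrDr; congr (_ * _).
apply: cint_split => //; apply: clip_cintegrable; apply: (clip_ray hf) => t.
by rewrite /= in_itv /= ray_v; exact: HQ.
Qed.

(** [strip_shift] on the two strips between the heights [a] and [b]. *)
Lemma ucont_widen N a b d z : -2 <= N -> a < b -> 0 < d -> decay_range a -> decay_range b ->
  0 <= a ->
  (forall s, N <= cRe s -> `|cIm s| <= b -> d <= normc (X s - z)) ->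
  ucont N a (ker z) = ucont N b (ker z).
Proof.
move=> N2 ab d0 aD bD a0 hd.
have b0 : 0 <= b by lra.
have rng c : a <= c <= b -> decay_range c.
  move: aD bD => /andP[a1 _] /andP[_ b1] /andP[c1 c2].
  have c0 : 0 <= c by lra.
  by rewrite (ger0_norm a0) in a1; rewrite (ger0_norm b0) in b1; rewrite /decay_range ger0_norm//; apply/andP; split; lra.
have s1 : hline a `[N, +oo[ (ker z) - hline b `[N, +oo[ (ker z) = vline N `[a, b] (ker z).
  apply: (strip_shift N2 ab d0 rng) => s Ns /andP[h1 h2]; apply: hd => //.
  by rewrite ger0_norm//; lra.
have s2 : hline (- b) `[N, +oo[ (ker z) - hline (- a) `[N, +oo[ (ker z) = vline N `[- b, - a] (ker z).
  apply: (strip_shift N2 _ d0) => [|c /andP[h1 h2]|s Ns /andP[h1 h2]]; first by lra.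
    by rewrite -(opprK c) /decay_range normrN; apply: rng; apply/andP; split; lra.
  by apply: hd => //; rewrite ler0_norm; lra.
have b5 : `|b| <= 5 by exact: decay_le5.
pose Q := rect N N (- b) b.
have QH : Q `<=` H by apply: rect_wide => //; rewrite normrN.
have Qd s : Q s -> d <= normc (X s - z).
  by move=> [/andP[h1 _] /andP[h2 h3]]; apply: hd => //; rewrite ler_norml h2.
have [K [K' hK]] := hol_ker QH (@rect_bound N N (- b) b) d0 Qd.
have i1 : - b <= - a by lra.
have i2 : - a <= b by lra.
have i3 : - a <= a by lra.
have i4 : a <= b by lra.
have j1 t : - b <= t <= b -> Q (Complex N t) by move=> tI; split; rewrite /= ?lexx.
have j2 t : - a <= t <= b -> Q (Complex N t).
  by move=> /andP[h1 h2]; apply: j1; apply/andP; split; lra.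
rewrite /ucont (vline_split hK i1 i2 j1) (vline_split hK i3 i4 j2).
exact: widen_alg s1 s2.
Qed.

End Contour.

(** * The Cauchy integral defines an entire function *)

Section EntireFunction.
Variable R : realType.
Notation leb := (@lebesgue_measure R).
Variable tau : nat -> R.
Hypothesis tau0 : 200 <= tau 0%N.
Hypothesis tauS : forall k, 2 * tau k <= tau k.+1.
Notation X := (Xk tau).
Notation Y := (Yk tau).
Notation y := (yk tau).
Notation H := (@wide_strip R).
Notation ker := (ker tau).
Notation phi := (@phi R).

(** The support of the contour of [ucont]. *)
Definition contour (N b : R) : set R[i] := [set s |
  (N <= cRe s /\ `|cIm s| = b) \/ (cRe s = N /\ `|cIm s| <= b)].

Lemma contourP N b s : contour N b s -> N <= cRe s /\ `|cIm s| <= b.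
Proof. by case=> [[h ->]|[-> h]]. Qed.

Lemma contour_wide N b : -2 <= N -> b <= 5 -> contour N b `<=` H.
Proof. by move=> N2 b5 s /contourP[h1 h2]; split; [exact: le_trans h1|exact: le_trans b5]. Qed.

(** The integrands for which [ucont] converges and is linear. *)
Definition ucont_ok (N b : R) (g : R[i] -> R[i]) :=
  (forall M, exists K g', hol (contour N b `&` [set s | cRe s <= M]) K g g') /\
  (exists2 C, 0 <= C & forall s, contour N b s -> normc (g s) <= C * normc (phi s)).

Let ucont_sum_alg (u v a b c a' b' c' : R[i]) :
  u * a + v * a' - (u * b + v * b') - (u * c + v * c') =
  u * (a - b - c) + v * (a' - b' - c').
Proof. by ring. Qed.

Section Fixed.
Variables (N b : R).
Hypotheses (N2 : -2 <= N) (b0 : 0 <= b) (bD : decay_range b).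

Lemma contour_ray c t : `|c| = b -> N <= t -> contour N b (ray (Complex 0 c) 1 t).
Proof. by move=> cb Nt; rewrite ray_h; left. Qed.

Lemma contour_side t : `[- b, b]%classic t -> contour N b (ray N%:C%C 'i%C t).
Proof. by rewrite /= in_itv /= ray_v => tI; right; split => //=; rewrite ler_norml. Qed.

Lemma ucont_ok_clip c g : `|c| = b -> ucont_ok N b g ->
  clip `[N, +oo[ (fun t => g (ray (Complex 0 c) 1 t)).
Proof.
move=> cb [hg _] x /=; rewrite in_itv /= andbT => Nx.
have [K [g' hK]] := hg (x + 1).
have cl : clip `[N, (x + 1)] (fun t => g (ray (Complex 0 c) 1 t)).
  apply: (clip_ray hK) => t; rewrite /= in_itv /= ray_h => /andP[t1 t2].
  by split; [left|rewrite /=; lra].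
have [|L [e [e0 he]]] := cl x; first by rewrite /= in_itv /= Nx lerDl ler01.
exists L, (Num.min e 1); split; first by rewrite lt_min e0 ltr01.
move=> t /=; rewrite in_itv /= andbT => Nt; rewrite lt_min => /andP[te t1].
apply: he => //; rewrite /= in_itv /= Nt /=.
by move: t1; rewrite ltr_norml => /andP[_]; lra.
Qed.

Lemma phi_ray c t : `|c| = b -> normc (phi (ray (Complex 0 c) 1 t)) <= 2 * expR (- t).
Proof.
move=> cb; rewrite ray_h; apply: (@phi_decay R (Complex t c)).
by rewrite /decay_range /= cb -(ger0_norm b0).
Qed.

Lemma ucont_ok_ray_bound c g B : `|c| = b -> 0 <= B ->
  (forall s, contour N b s -> normc (g s) <= B * normc (phi s)) ->
  forall t, N <= t -> normc (g (ray (Complex 0 c) 1 t)) <= B * 2 * expR (- t).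
Proof.
move=> cb B0 gB t Nt; apply: le_trans (gB _ (contour_ray cb Nt)) _.
by rewrite -mulrA ler_wpM2l//; exact: phi_ray.
Qed.

Lemma ucont_ok_cint c g : `|c| = b -> ucont_ok N b g ->
  cintegrable leb `[N, +oo[ (fun t => g (ray (Complex 0 c) 1 t)).
Proof.
move=> cb ug; have [_ [C C0 hC]] := ug.
exact: tail_cintegrable (ucont_ok_clip cb ug) (ucont_ok_ray_bound cb C0 hC).
Qed.

Lemma ucont_ok_vclip g : ucont_ok N b g -> clip `[- b, b] (fun t => g (ray N%:C%C 'i%C t)).
Proof.
move=> [hg _]; have [K [g' hK]] := hg N.
apply: (clip_ray hK) => t; rewrite /= in_itv /= ray_v => tI.
split; last by rewrite /=; lra.
by right; split => //=; rewrite ler_norml.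
Qed.

(** On the rays [phi] is bounded by [2 exp (- t)], on the vertical side by
    [exp (exp N)]. *)
Lemma ucont_le g B : ucont_ok N b g -> 0 <= B ->
  (forall s, contour N b s -> normc (g s) <= B * normc (phi s)) ->
  normc (ucont N b g) <= B * (4 * expR (- N) + expR (expR N) * (2 * b)).
Proof.
move=> ug B0 gB.
have hb c : `|c| = b -> normc (hline c `[N, +oo[ g) <= B * 2 * expR (- N).
  move=> cb; rewrite /hline /lint mul1r; apply: tail_le; first by rewrite mulr_ge0.
    exact: ucont_ok_clip.
  exact: ucont_ok_ray_bound.
have vb : normc (vline N `[- b, b] g) <= B * expR (expR N) * (b - - b).
  rewrite -[leRHS]mul1r -[X in X * _](@normc_i R); apply: lint_le_cst; first by apply: le_trans b0; rewrite oppr_le0.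
    exact: ucont_ok_vclip.
  move=> t tI; apply: le_trans (gB _ (contour_side tI)) _; rewrite ler_wpM2l//.
  rewrite ray_v normc_phi ler_expR /=.
  by rewrite ler_piMr ?expR_ge0// cos_le1.
have -> : B * (4 * expR (- N) + expR (expR N) * (2 * b)) =
  B * 2 * expR (- N) + B * 2 * expR (- N) + B * expR (expR N) * (b - - b) by ring.
apply: le_trans (le_normcB _ _) _; apply: lerD => //.
apply: le_trans (le_normcB _ _) _; apply: lerD; apply: hb; rewrite ?normrN; exact: ger0_norm.
Qed.

Lemma ucont_okL (u v : R[i]) f g : ucont_ok N b f -> ucont_ok N b g -> ucont_ok N b (fun s => u * f s + v * g s).
Proof.
move=> [hf [C C0 fC]] [hg [D D0 gD]]; split.
  move=> M; have [K [f' h1]] := hf M; have [K' [g' h2]] := hg M.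
  by do 2 eexists; apply: hol_add (hol_mul (hol_cst _) h1) (hol_mul (hol_cst _) h2).
exists (normc u * C + normc v * D); first by rewrite addr_ge0 ?mulr_ge0 ?normc_ge0.
move=> s Gs; apply: le_trans (le_normcD _ _) _; rewrite !normcM mulrDl -!mulrA.
by apply: lerD; apply: ler_wpM2l; rewrite ?normc_ge0//; [exact: fC|exact: gD].
Qed.

Lemma ucontL (u v : R[i]) f g : ucont_ok N b f -> ucont_ok N b g ->
  ucont N b (fun s => u * f s + v * g s) = u * ucont N b f + v * ucont N b g.
Proof.
move=> uf ug; have n1 : `|b| = b by exact: ger0_norm.
have n2 : `|- b| = b by rewrite normrN.
(* the remaining linear identity is [ucont_sum_alg] *)
rewrite /ucont /hline /vline !lintL//; try exact: ucont_ok_cint;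
  try (apply: clip_cintegrable; exact: ucont_ok_vclip).
Qed.

Lemma ucont_ok_hol g d (z : R[i]) (e : R) : 0 < d -> e <= 5 -> b <= e ->
  (forall s, contour N b s -> d <= normc (X s - z)) ->
  (exists2 C, 0 <= C & forall s, contour N b s -> normc (g s) <= C * normc (phi s)) ->
  (forall Q B, Q `<=` H -> (forall s, Q s -> normc s <= B) ->
     (forall s, Q s -> d <= normc (X s - z)) -> exists K g', hol Q K g g') ->
  ucont_ok N b g.
Proof.
move=> d0 e5 be hd hC hg; split => // M.
apply: (hg _ (`|N| + `|M| + 5)).
- by move=> s [/(contour_wide N2 (le_trans be e5))].
- move=> s [/contourP[h1 h2] /= h3].
  have rs : rect N M (- 5) 5 s.
    split; first by rewrite h1.
    by rewrite -ler_norml; apply: le_trans h2 _; exact: le_trans e5.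
  apply: le_trans (normc_le_ReIm _) _; apply: lerD; last by apply: le_trans h2 _; exact: le_trans e5.
  rewrite ler_norml; apply/andP; split.
    have := ler_norm (- N); rewrite normrN; have := normr_ge0 M; lra.
  have := ler_norm M; have := normr_ge0 N; lra.
- by move=> s [/hd].
Qed.

Lemma ucont_ok_ker d z : 0 < d -> (forall s, contour N b s -> d <= normc (X s - z)) -> ucont_ok N b (ker z).
Proof.
move=> d0 hd; have b5 : b <= 5 by rewrite -(ger0_norm b0); exact: decay_le5.
apply: (ucont_ok_hol d0 (lexx _) b5 hd).
  exists d^-1; first by rewrite invr_ge0 ltW.
  by move=> s Gs; apply: ker_bound => //; [exact: (contour_wide N2 b5)|exact: hd].
by move=> Q B QH QB Qd; exact: (hol_ker tau0 tauS QH QB d0 Qd).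
Qed.

(** The derivative of [ker z s] in [z]. *)
Definition kerD (z s : R[i]) : R[i] := ker z s * (X s - z)^-1.

Lemma ucont_ok_kerD d z : 0 < d -> (forall s, contour N b s -> d <= normc (X s - z)) -> ucont_ok N b (kerD z).
Proof.
move=> d0 hd; have b5 : b <= 5 by rewrite -(ger0_norm b0); exact: decay_le5.
apply: (ucont_ok_hol d0 (lexx _) b5 hd).
  exists (d^-1 * d^-1); first by rewrite mulr_ge0 ?invr_ge0 ?ltW.
  move=> s Gs; rewrite normcM mulrC normcV -mulrA; apply: ler_pM; rewrite ?normc_ge0 ?invr_ge0 ?normc_ge0//.
    by rewrite lef_pV2 ?posrE ?hd// (lt_le_trans d0 (hd _ Gs)).
  by apply: ker_bound => //; [exact: (contour_wide N2 b5)|exact: hd].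
move=> Q B QH QB Qd; have [K1 [k1 h1]] := hol_ker tau0 tauS QH QB d0 Qd.
have QB' s : Q s -> normc s <= Num.max 1 B by move=> /QB h; rewrite le_max h orbT.
have B1 : 1 <= Num.max 1 B by rewrite le_max lexx.
have [N3 [p3 h3]] := hol_Xk tau0 tauS QH B1 QB'.
have h4 := hol_inv d0 Qd (hol_add h3 (@hol_cst R Q (- z))).
by do 2 eexists; apply: hol_mul h1 h4.
Qed.

End Fixed.

(** The heights [a0] and [b0] lie on either side of [pi], the half height of the
    strip that parametrises the tract: contours at height [a0] stay away from
    [X s = z] for [z] outside the tract, contours at height [b0] for [z] inside. *)
Definition a0 : R := pi - pi / 4.
Definition b0 : R := pi + pi / 4.

Lemma a0_decay : decay_range a0.
Proof.
have p := pi_gt0 R; rewrite /decay_range ger0_norm /a0 ?lexx /=; lra.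
Qed.
Lemma b0_decay : decay_range b0.
Proof.
have p := pi_gt0 R; rewrite /decay_range ger0_norm /b0 ?lexx ?andbT /=; lra.
Qed.
Lemma a0_ge0 : 0 <= a0. Proof. by have := pi_gt0 R; rewrite /a0; lra. Qed.
Lemma b0_ge0 : 0 <= b0. Proof. by have := pi_gt0 R; rewrite /b0; lra. Qed.
Lemma ab0 : a0 < b0. Proof. by have := pi_gt0 R; rewrite /a0 /b0; lra. Qed.
Lemma b0_le5 : b0 <= 5. Proof. by rewrite -(ger0_norm b0_ge0); exact: (decay_le5 b0_decay). Qed.
Lemma a0_le5 : a0 <= 5. Proof. by apply: le_trans b0_le5; exact: ltW ab0. Qed.

(** [|X s| > r] holds to the right of this abscissa, by [xi_ge]. *)
Definition far (r : R) : R := tau (Num.truncn (2 * r)).+1.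

Lemma far_ge r s : H s -> far r <= cRe s -> r + 1 <= normc (X s).
Proof.
move=> hs h; have h1 := xi_ge tau0 tauS h.
have h2 := Re_Xk_close tau0 tauS hs.
have h3 : 2 * r < (Num.truncn (2 * r)).+1%:R by exact: truncnS_gt.
apply: le_trans (le_trans (ler_norm _) (Re_le_normc _)).
by move: h2; rewrite ler_norml => /andP[h4 _]; lra.
Qed.

Lemma far_gt0 r : 0 < far r.
Proof. exact: tau_gt0. Qed.

Definition twoPiI : R[i] := Complex 0 (2 * pi).
Lemma twoPiI_neq0 : twoPiI != 0.
Proof.
by apply/eqP => -[/eqP]; rewrite mulf_eq0 pnatr_eq0 /= gt_eqF// pi_gt0.
Qed.

(** The contour starts so far to the right that it leaves out every solution of
    [X s = z]; by [Fent_eq] any such start gives the same value. *)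
Definition Fent (z : R[i]) : R[i] := - ucont (far (normc z)) a0 (ker z) / twoPiI.

Lemma ucont_indep N N' z : -2 <= N -> -2 <= N' ->
  (forall s, H s -> N <= cRe s -> 1 <= normc (X s - z)) ->
  (forall s, H s -> N' <= cRe s -> 1 <= normc (X s - z)) ->
  ucont N a0 (ker z) = ucont N' a0 (ker z).
Proof.
wlog NN : N N' / N <= N' => [W|].
  have [NN|/ltW NN] := leP N N'; first exact: (W _ _ NN).
  by move=> k1 k2 k3 k4; apply/esym; exact: (W _ _ NN k2 k1 k4 k3).
move=> N2 N2' hN hN'.
have [->//|ne] := eqVneq N N'.
have lt : N < N' by rewrite lt_neqAle ne.
have aN : `|- a0| = a0 by rewrite normrN; exact: ger0_norm a0_ge0.
have aP : `|a0| = a0 by exact: ger0_norm a0_ge0.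
have hr c : `|c| = a0 -> forall t, N <= t -> 1 <= normc (X (Complex t c) - z).
  move=> hc t Nt; apply: hN => //; split => /=; first exact: le_trans Nt.
  by rewrite hc; exact: a0_le5.
apply/eqP; rewrite -subr_eq0.
rewrite (ucont_cut tau0 tauS N2 NN a0_decay a0_ge0 ltr01 (hr _ aP) (hr _ aN)).
have QH : rect N N' (- a0) a0 `<=` H by apply: rect_wide; rewrite ?aN ?aP ?a0_le5.
have Qd s : rect N N' (- a0) a0 s -> 1 <= normc (X s - z).
  by move=> Qs; apply: hN; [exact: QH|case: Qs => /andP[]].
have [K [K' hK]] := hol_ker tau0 tauS QH (@rect_bound R N N' (- a0) a0) ltr01 Qd.
rewrite (cauchy_thm lt _ hK)//.
by have := pi_gt0 R; rewrite /a0; lra.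
Qed.

Lemma far_sep (z s : R[i]) : H s -> far (normc z) <= cRe s -> 1 <= normc (X s - z).
Proof.
move=> hs h; have := far_ge hs h.
have := normc_triangle_lower (X s) z; lra.
Qed.

Lemma Fent_eq N z : -2 <= N ->
  (forall s, H s -> N <= cRe s -> 1 <= normc (X s - z)) ->
  Fent z = - ucont N a0 (ker z) / twoPiI.
Proof.
move=> N2 hN; rewrite /Fent (ucont_indep _ N2 _ hN)//; last by move=> s; exact: far_sep.
by have := far_gt0 (normc z); lra.
Qed.

Let ker_alg (f g a w z : R[i]) : a - w != 0 -> a - z != 0 ->
  1 * (1 * (f * (g / (a - w))) + -1 * (f * (g / (a - z)))) +
  - (w - z) * (f * (g / (a - z)) * (a - z)^-1) =
  (w - z) ^+ 2 * f * (g / ((a - z) ^+ 2 * (a - w))).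
Proof. by move=> n1 n2; field; rewrite n1 n2. Qed.

Let deriv_alg (A B D T h : R[i]) :
  - A / T - - B / T - h * (- D / T) = - (1 * (1 * A + -1 * B) + - h * D) / T.
Proof. by ring. Qed.

(** For [w] near [z] one contour serves both, and the kernel has the derivative
    [kerD] in [z] with an explicit quadratic remainder. *)
Lemma Fent_deriv z : exists L C, 0 <= C /\ forall w, normc (w - z) <= 1 ->
  normc (Fent w - Fent z - (w - z) * L) <= C * normc (w - z) ^+ 2.
Proof.
pose N := far (normc z + 1).
have N2 : -2 <= N by have := far_gt0 (normc z + 1); rewrite /N; lra.
have sep w : normc (w - z) <= 1 -> forall s, H s -> N <= cRe s -> 1 <= normc (X s - w).
  move=> wz s hs hN; have := far_ge hs hN.
  have := normc_triangle_lower (X s) w; have := normcBD w z; lra.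
have z1 : normc (z - z) <= 1 by rewrite subrr normc0.
have GH := contour_wide N2 a0_le5.
have G1 w : normc (w - z) <= 1 -> forall s, contour N a0 s -> 1 <= normc (X s - w).
  by move=> wz s Gs; apply: (sep _ wz); [exact: GH|case: (contourP Gs)].
have u1 w (wz : normc (w - z) <= 1) := ucont_ok_ker N2 a0_ge0 a0_decay ltr01 (G1 _ wz).
have u2 := ucont_ok_kerD N2 a0_ge0 a0_decay ltr01 (G1 _ z1).
pose C := 4 * expR (- N) + expR (expR N) * (2 * a0).
have C0 : 0 <= C by rewrite addr_ge0// ?mulr_ge0 ?expR_ge0 ?a0_ge0.
exists (- ucont N a0 (kerD z) / twoPiI), (C / normc twoPiI).
split; first by rewrite divr_ge0 ?normc_ge0.
move=> w wz; rewrite (Fent_eq N2 (sep _ wz)) (Fent_eq N2 (sep _ z1)).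
set h := w - z.
have l1 := ucontL a0_ge0 a0_decay 1 (-1) (u1 _ wz) (u1 _ z1).
have u3 := ucont_okL 1 (-1) (u1 _ wz) (u1 _ z1).
have l2 := ucontL a0_ge0 a0_decay 1 (- h) u3 u2.
have u4 := ucont_okL 1 (- h) u3 u2.
have -> : - ucont N a0 (ker w) / twoPiI - - ucont N a0 (ker z) / twoPiI -
    h * (- ucont N a0 (kerD z) / twoPiI) =
    - ucont N a0 (fun s => 1 * (1 * ker w s + -1 * ker z s) + - h * kerD z s) / twoPiI.
  by rewrite l2 l1; exact: deriv_alg.
rewrite normc_div normcN [leRHS]mulrAC ler_wpM2r ?invr_ge0 ?normc_ge0//.
rewrite mulrC; apply: ucont_le => //; [exact: a0_ge0|exact: a0_decay|exact: sqr_ge0|].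
move=> s Gs; have hs := GH _ Gs.
have d1 := G1 _ wz _ Gs; have d2 := G1 _ z1 _ Gs.
have n1 : X s - w != 0 by rewrite -normc_gt0; exact: lt_le_trans ltr01 d1.
have n2 : X s - z != 0 by rewrite -normc_gt0; exact: lt_le_trans ltr01 d2.
have -> : 1 * (1 * ker w s + -1 * ker z s) + - h * kerD z s =
    h ^+ 2 * phi s * (Y s s / ((X s - z) ^+ 2 * (X s - w))).
  rewrite /kerD /ker.
  exact: ker_alg.
rewrite normcM normcM normcX -[leRHS]mulr1; apply: ler_wpM2l.
  by apply: mulr_ge0; [exact: sqr_ge0|exact: normc_ge0].
have y1 := Ydiag_le1 tau0 tauS hs.
rewrite normc_div normcM normcX.
have P1 : 1 <= normc (X s - z) ^+ 2 * normc (X s - w).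
  by apply: mulr_ege1 => //; exact: exprn_ege1.
rewrite ler_pdivrMr ?mul1r; first exact: le_trans y1 P1.
exact: lt_le_trans ltr01 P1.
Qed.

End EntireFunction.

(** * Size of the entire function inside and outside the tract *)

Section TractEstimates.
Variable R : realType.
Variable tau : nat -> R.
Hypothesis tau0 : 200 <= tau 0%N.
Hypothesis tauS : forall k, 2 * tau k <= tau k.+1.
Notation X := (Xk tau).
Notation Y := (Yk tau).
Notation y := (yk tau).
Notation H := (@wide_strip R).
Notation ker := (ker tau).
Notation phi := (@phi R).
Notation Fent := (Fent tau).
Notation a0 := (a0 R).
Notation b0 := (b0 R).
Notation twoPiI := (twoPiI R).

Definition half_strip : set R[i] := [set s | -1 <= cRe s /\ `|cIm s| <= pi].
Definition tract : set R[i] := [set X s | s in half_strip].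

(** An error bound that does not depend on [tau]; it is this uniformity that lets
    [tau] be chosen at the very end. *)
Definition M0 : R := 1000 * expR 2.

Lemma half_strip_wide : half_strip `<=` H.
Proof. by move=> s [h1 h2]; split; have := pi_lt4 R; lra. Qed.

Lemma pi4_half : 2^-1 <= pi / 4 :> R.
Proof. by have := pi_ge2 R; lra. Qed.

Lemma normc_twoPiI : 1 <= normc twoPiI.
Proof.
apply: le_trans (Im_le_normc _); rewrite /= ger0_norm; have := pi_ge2 R; lra.
Qed.

(** Otherwise [Xk_local_surj] would put [z] into the tract. *)
Lemma outside_sep z s : ~ tract z -> 0 <= cRe s -> `|cIm s| <= a0 ->
  16^-1 * y (cRe s) (cRe s) <= normc (X s - z).
Proof.
move=> nz s0 sa; rewrite leNgt; apply/negP => h; apply: nz.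
have p4 := pi4_half; have p5 := pi_lt4 R.
have hI s' : `|cRe (s' - s)| <= 2^-1 -> `|cIm (s' - s)| <= 2^-1 -> half_strip s'.
  rewrite cReB cImB => h1 h2; split.
    by move: h1; rewrite ler_norml => /andP[h1 _]; lra.
  have -> : cIm s' = (cIm s' - cIm s) + cIm s by ring.
  by apply: le_trans (ler_normD _ _) _; rewrite /a0 in sa; lra.
have r01 : 0 < (2^-1 : R) <= 1 by apply/andP; split; lra.
have [||s' [h1 h2 e]] := @Xk_local_surj R tau tau0 tauS s 2^-1 z r01.
- by move=> s' h1 h2; apply: half_strip_wide; exact: hI.
- by rewrite normcB; apply: lt_le_trans h _; rewrite le_eqVlt; apply/orP; left; apply/eqP; field.
by exists s' => //; exact: hI.
Qed.

Lemma yk_decr a b c d : -2 <= a -> a <= b -> -2 <= c -> c <= d -> y b d <= y a c.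
Proof.
move=> a2 ab c2 cd; have b2 := le_trans a2 ab.
apply: (@le_trans _ _ (y b c)).
  by rewrite (ykC _ b d) (ykC _ b c); exact: yk_mono.
exact: yk_mono.
Qed.

(** For [z] outside the tract the kernel has no pole in the inner half strip, so
    the contour can be pushed left to abscissa 0. *)
Lemma Fent_outside z : ~ tract z -> Fent z = - ucont 0 a0 (ker z) / twoPiI.
Proof.
move=> nz.
pose N := far tau (normc z).
have N0 : 0 < N := far_gt0 tau0 tauS (normc z).
have N2 : -2 <= N by lra.
have Z2 : -2 <= 0 :> R by lra.
pose d := Num.min 1 (16^-1 * y N N).
have d0 : 0 < d by rewrite /d lt_min ltr01 mulr_gt0// yk_gt0.
have sep s : H s -> 0 <= cRe s -> `|cIm s| <= a0 -> d <= normc (X s - z).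
  move=> hs s0 sa; have [sN|/ltW sN] := leP N (cRe s).
    by rewrite /d ge_min; apply/orP; left; exact: far_sep.
  rewrite /d ge_min; apply/orP; right; apply: le_trans (outside_sep nz s0 sa).
  by rewrite ler_wpM2l//; apply: yk_decr => //; lra.
have a5 := a0_le5 R; have ap := a0_ge0 R.
have hray c : `|c| = a0 -> forall t, 0 <= t -> d <= normc (X (Complex t c) - z).
  move=> hc t t0; apply: sep => //=; last by rewrite hc.
  by split => /=; [exact: le_trans t0|rewrite hc].
have aN : `|- a0| = a0 by rewrite normrN ger0_norm.
have aP : `|a0| = a0 by rewrite ger0_norm.
have QH : rect 0 N (- a0) a0 `<=` H by apply: rect_wide; rewrite ?aN ?aP.
have Qd s : rect 0 N (- a0) a0 s -> d <= normc (X s - z).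
  move=> Qs; apply: sep; first exact: QH.
    by case: Qs => /andP[].
  by rewrite ler_norml; case: Qs.
have [K [K' hK]] := hol_ker tau0 tauS QH (@rect_bound R 0 N (- a0) a0) d0 Qd.
have cut := ucont_cut tau0 tauS Z2 (ltW N0) (a0_decay R) ap d0 (hray _ aP) (hray _ aN).
have aa : - a0 < a0 by have := pi_gt0 R; rewrite /a0; lra.
rewrite (cauchy_thm N0 aa hK) in cut.
by rewrite /Fent (subr0_eq cut).
Qed.

Lemma Fent_outside_le z : ~ tract z -> normc (Fent z) <= M0.
Proof.
move=> nz; rewrite (Fent_outside nz) normc_div normcN.
have a5 := a0_le5 R; have ap := a0_ge0 R.
have Z2 : -2 <= 0 :> R by lra.
pose N := far tau (normc z).
have N0 : 0 < N := far_gt0 tau0 tauS (normc z).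
pose d := Num.min 1 (16^-1 * y N N).
have d0 : 0 < d by rewrite /d lt_min ltr01 mulr_gt0// yk_gt0//; lra.
have GH := contour_wide Z2 a5.
have sep s : contour 0 a0 s -> d <= normc (X s - z).
  move=> Gs; have hs := GH _ Gs; have [s0 sa] := contourP Gs.
  have [sN|/ltW sN] := leP N (cRe s).
    by rewrite /d ge_min; apply/orP; left; exact: far_sep.
  rewrite /d ge_min; apply/orP; right; apply: le_trans (outside_sep nz s0 sa).
  by rewrite ler_wpM2l//; apply: yk_decr => //; lra.
have ok := ucont_ok_ker tau0 tauS Z2 ap (a0_decay R) d0 sep.
have B16 : 0 <= 16 :> R by lra.
have bd s : contour 0 a0 s -> normc (ker z s) <= 16 * normc (phi s).
  move=> Gs; have hs := GH _ Gs; have [s0 sa] := contourP Gs.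
  rewrite normcM mulrC ler_wpM2r ?normc_ge0// normc_div.
  have s2 : -2 <= cRe s by lra.
  have y0 := yk_gt0 tau0 tauS s2 s2.
  have h1 := outside_sep nz s0 sa.
  rewrite ler_pdivrMr; last by apply: lt_le_trans h1; rewrite mulr_gt0.
  by apply: le_trans (Yk_le tau0 tauS hs hs) _; lra.
have := ucont_le ap (a0_decay R) ok B16 bd.
set U := normc (ucont _ _ _) => hU.
have T1 := normc_twoPiI.
have E1 : expR 1 <= expR 2 :> R by rewrite ler_expR; lra.
have E0 : 1 <= expR 1 :> R by have := expR_ge1Dx (1 : R); lra.
rewrite ler_pdivrMr; last lra.
apply: (@le_trans _ _ M0); last first.
  by rewrite ler_peMr// /M0; lra.
apply: le_trans hU _; rewrite /M0 oppr0 !expR0.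
have : expR 1 * (2 * a0) <= expR 2 * 10 by apply: ler_pM => //; lra.
lra.
Qed.

Lemma outer_gap t s : half_strip t -> contour (-2) b0 s -> 2^-1 <= normc (s - t).
Proof.
move=> [t1 t2] [[s1 s2]|[s1 s2]].
  apply: le_trans (Im_le_normc _); rewrite cImB.
  have := lerB_dist (cIm s) (cIm t); rewrite s2 /b0.
  have := pi4_half; lra.
apply: le_trans (Re_le_normc _); rewrite cReB s1 distrC ger0_norm; lra.
Qed.

(** The outer contour keeps a distance 1/2 from the half strip, and by
    [yk_ratio] its image keeps a comparable distance in units of the derivative
    of [X]; hence the kernel is at most [6 |phi|] there. *)
Lemma outer_ratio t s : half_strip t -> contour (-2) b0 s ->
  y (cRe s) (cRe s) <= 6 * normc (X s - X t).
Proof.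
move=> ht Gs; have ht' := half_strip_wide ht.
have hs := contour_wide (lexx _) (b0_le5 R) Gs.
have gap := outer_gap ht Gs.
have s2 : -2 <= cRe s by case: hs.
have t2 : -2 <= cRe t by case: ht'.
rewrite XkB// normcM.
have h1 := Yk_ge tau0 tauS hs ht'.
have h2 := yk_ratio tau0 tauS s2 s2 t2.
have h3 : `|cRe t - cRe s| <= normc (s - t).
  by rewrite distrC -cReB; exact: Re_le_normc.
have y0 := yk_gt0 tau0 tauS s2 t2.
set Y0 := y _ (cRe t) in h1 h2 y0 *.
set g := normc (s - t) in gap h3 *.
apply: le_trans h2 _; apply: (@le_trans _ _ ((1 + g) * Y0)).
  by rewrite ler_wpM2r ?(ltW y0)// lerD2l.
apply: (@le_trans _ _ (6 * (g * (2^-1 * Y0)))); last first.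
  by rewrite ler_pM2l// ler_wpM2l//; lra.
have -> : 6 * (g * (2^-1 * Y0)) = (3 * g) * Y0 by field.
by rewrite ler_wpM2r ?(ltW y0)//; lra.
Qed.

Lemma outer_sep t : half_strip t -> exists2 d : R, 0 < d &
  forall s, H s -> `|cIm s| <= b0 -> 2^-1 <= normc (s - t) -> d <= normc (X s - X t).
Proof.
move=> ht; have ht' := half_strip_wide ht.
have t2 : -2 <= cRe t by case: ht'.
pose N := far tau (normc (X t)).
have N0 : 0 < N := far_gt0 tau0 tauS _.
have N2 : -2 <= N by lra.
exists (Num.min 1 (4^-1 * y N (cRe t))).
  by rewrite lt_min ltr01 mulr_gt0// yk_gt0.
move=> s hs sb gap; have [sN|/ltW sN] := leP N (cRe s).
  by rewrite ge_min; apply/orP; left; exact: far_sep.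
rewrite ge_min; apply/orP; right; rewrite XkB// normcM.
have s2 : -2 <= cRe s by case: hs.
have h1 := Yk_ge tau0 tauS hs ht'.
have h2 : y N (cRe t) <= y (cRe s) (cRe t) by exact: yk_mono.
have y0 := yk_gt0 tau0 tauS N2 t2.
have -> : 4^-1 * y N (cRe t) = 2^-1 * (2^-1 * y N (cRe t)) by field.
by apply: ler_pM => //; lra.
Qed.

Let rect_in (x1 x2 y1 y2 : R) (s : R[i]) : x1 < cRe s < x2 ->
  y1 < cIm s < y2 -> rect x1 x2 y1 y2 s.
Proof. by move=> /andP[? ?] /andP[? ?]; split; apply/andP; split; exact: ltW. Qed.

(** By [Fent_inside], the deviation of [Fent] from [phi o X^-1] on the tract. *)
Definition Eerr (t : R[i]) : R[i] := - ucont (-2) b0 (ker (X t)) / twoPiI.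

Let ker_pole_alg (f g u w : R[i]) : f * (g * (u^-1 * w^-1)) = f * (g * w^-1) / u.
Proof. by ring. Qed.

Let inside_alg (A B f T : R[i]) : T != 0 -> A - B = f * T -> - B / T = f + - A / T.
Proof.
move=> T0 e; have -> : B = A - f * T by rewrite -e; ring.
by field.
Qed.

(** Widening the contour and pushing it left to abscissa -2 crosses the pole at
    [t], whose residue is [phi t]. *)
Lemma Fent_inside t : half_strip t -> Fent (X t) = phi t + Eerr t.
Proof.
move=> ht; have ht' := half_strip_wide ht.
pose N := far tau (normc (X t)) + (`|cRe t| + 1).
have F0 := far_gt0 tau0 tauS (normc (X t)).
have Nt : cRe t < N.
  by rewrite /N; have := ler_norm (cRe t); lra.
have N0 : 0 < N by rewrite /N; have := normr_ge0 (cRe t); lra.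
have N2 : -2 <= N by lra.
have NF : far tau (normc (X t)) <= N by rewrite /N; have := normr_ge0 (cRe t); lra.
have sepN s : H s -> N <= cRe s -> 1 <= normc (X s - X t).
  by move=> hs hN; apply: far_sep => //; exact: le_trans hN.
have bp := b0_ge0 R; have b5 := b0_le5 R; have ap := a0_ge0 R.
rewrite (Fent_eq tau0 tauS N2 sepN).
have -> : ucont N a0 (ker (X t)) = ucont N b0 (ker (X t)).
  apply: (ucont_widen tau0 tauS N2 (ab0 R) ltr01 (a0_decay R) (b0_decay R) ap) => s Ns sb.
  by apply: sepN => //; split; [lra|exact: le_trans b5].
have [d d0 hd] := outer_sep ht.
have bN : `|- b0| = b0 by rewrite normrN ger0_norm.
have bP : `|b0| = b0 by rewrite ger0_norm.
have hray c : `|c| = b0 -> forall u, -2 <= u -> d <= normc (X (Complex u c) - X t).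
  move=> hc u u0; have Gu : contour (-2) b0 (Complex u c) by left.
  apply: hd => /=; [exact: (contour_wide (lexx _) b5 Gu)|by rewrite hc|exact: outer_gap].
have cut := ucont_cut tau0 tauS (lexx _) N2 (b0_decay R) bp d0 (hray _ bP) (hray _ bN).
(* the kernel is [phi s * (Y s s / Y s t) / (s - t)], and the quotient is 1 at [t] *)
pose Q := rect (-2) N (- b0) b0.
have QH : Q `<=` H by apply: rect_wide; rewrite ?bN ?bP.
have [N1 [p1 h1]] := hol_phi (@rect_bound R (-2) N (- b0) b0).
have [N3 [p2 h2]] := hol_Yk_diag tau0 tauS QH.
have [N4 [p3 h3]] := hol_Yk tau0 tauS QH ht'.
have t2 : -2 <= cRe t by case: ht'.
pose e := 2^-1 * y N (cRe t).
have e0 : 0 < e by rewrite mulr_gt0// yk_gt0.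
have hY s : Q s -> e <= normc (Y s t).
  move=> Qs; have hs := QH _ Qs; apply: le_trans (Yk_ge tau0 tauS hs ht').
  rewrite ler_wpM2l//; apply: yk_mono => //; first by case: hs.
  by case: Qs => /andP[].
have hG := hol_mul h1 (hol_mul h2 (hol_inv e0 hY h3)).
have [tI1 tI2] : -2 < cRe t < N /\ - b0 < cIm t < b0.
  case: (ht) => k1 k2; split; first by apply/andP; split; lra.
  by rewrite -ltr_norml; apply: le_lt_trans k2 _; rewrite /b0; have := pi_gt0 R; lra.
have cf := cauchy_formula tI1 tI2 hG.
have eK : oint (-2) N (- b0) b0 (ker (X t)) = phi t * twoPiI.
  rewrite -[RHS](_ : phi t * (Y t t / Y t t) * twoPiI = _); last first.
    by rewrite divff ?mulr1// -normc_gt0; apply: lt_le_trans e0 (hY _ _); exact: rect_in tI1 tI2.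
  rewrite -[RHS]cf; apply: oint_ext; [exact: ltW (lt_trans (andP tI1).1 (andP tI1).2)|exact: ltW (lt_trans (andP tI2).1 (andP tI2).2)|].
  move=> s Es; have Qs := @sides_sub _ _ _ _ _ _ Es; have hs := QH _ Qs.
  rewrite /ker XkB// invfM; exact: ker_pole_alg.
rewrite eK in cut.
exact: (inside_alg (twoPiI_neq0 R) cut).
Qed.

End TractEstimates.

(** * Normalisation and expansion *)

Section Expansion.
Variable R : realType.
Variable tau : nat -> R.
Hypothesis tau0 : 200 <= tau 0%N.
Hypothesis tauS : forall k, 2 * tau k <= tau k.+1.
Notation X := (Xk tau).
Notation Y := (Yk tau).
Notation y := (yk tau).
Notation H := (@wide_strip R).
Notation ker := (ker tau).
Notation phi := (@phi R).
Notation Fent := (Fent tau).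
Notation b0 := (b0 R).
Notation twoPiI := (twoPiI R).
Notation half_strip := (@half_strip R).
Notation tract := (tract tau).
Notation M0 := (M0 R).
Notation Eerr := (Eerr tau).

Let bp := b0_ge0 R.
Let b5 := b0_le5 R.

Lemma expR12_ge : 1 <= expR 1 :> R /\ expR 1 <= expR 2 :> R.
Proof. by split; [have := expR_ge1Dx (1 : R); lra|rewrite ler_expR; lra]. Qed.

Lemma M0_gt : 1000 <= M0.
Proof. by have [h1 h2] := expR12_ge; rewrite /M0; lra. Qed.

Lemma outer_uok t : half_strip t -> ucont_ok (-2) b0 (ker (X t)).
Proof.
move=> ht; have [d d0 hd] := outer_sep tau0 tauS ht.
apply: (ucont_ok_ker tau0 tauS (lexx _) bp (b0_decay R) d0) => s Gs; apply: hd.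
- exact: (contour_wide (lexx _) b5 Gs).
- by case: (contourP Gs).
- exact: outer_gap.
Qed.

Lemma outer_const B : 0 <= B ->
  B * (4 * expR (- -2) + expR (expR (-2)) * (2 * b0)) <= 14 * B * expR 2 :> R.
Proof.
move=> B0; rewrite opprK.
have e : expR (expR (-2)) <= expR 2 :> R.
  by rewrite ler_expR; apply: (@le_trans _ _ 1); [rewrite expR_le1|]; lra.
have -> : 14 * B * expR 2 = B * (14 * expR 2) by ring.
rewrite ler_wpM2l//.
have : expR (expR (-2)) * (2 * b0) <= expR 2 * 10.
  by apply: ler_pM; [exact: expR_ge0|have := bp; lra|exact: e|have := b5; lra].
lra.
Qed.

Lemma outer_quot t s : half_strip t -> contour (-2) b0 s ->
  normc (Y s s) / normc (X s - X t) <= 6.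
Proof.
move=> ht Gs; have hs := contour_wide (lexx _) b5 Gs.
have s2 : -2 <= cRe s by case: hs.
have h := outer_ratio tau0 tauS ht Gs.
have y0 := yk_gt0 tau0 tauS s2 s2.
rewrite ler_pdivrMr; last lra.
exact: le_trans (Yk_le tau0 tauS hs hs) h.
Qed.

Lemma normc_div_twoPiI (u : R[i]) : normc (u / twoPiI) <= normc u.
Proof.
have T1 := normc_twoPiI R; rewrite normc_div ler_pdivrMr; last lra.
by rewrite ler_peMr ?normc_ge0.
Qed.

Lemma Eerr_le t : half_strip t -> normc (Eerr t) <= M0.
Proof.
move=> ht; rewrite /Eerr; apply: le_trans (normc_div_twoPiI _) _; rewrite normcN.
have B6 : 0 <= 6 :> R by lra.
apply: le_trans (ucont_le bp (b0_decay R) (outer_uok ht) B6 _) _.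
  move=> s Gs; rewrite normcM mulrC ler_wpM2r ?normc_ge0// normc_div.
  exact: outer_quot.
apply: le_trans (outer_const B6) _; rewrite /M0.
have := expR_gt0 (2 : R); lra.
Qed.

Let ker_diff_alg (f g a u v : R[i]) : a - u != 0 -> a - v != 0 ->
  1 * (f * (g / (a - u))) + -1 * (f * (g / (a - v))) =
  f * (g / (a - u)) * ((u - v) / (a - v)).
Proof. by move=> n1 n2; field; rewrite n1 n2. Qed.

Let Ediff_alg (A B T : R[i]) : - A / T - - B / T = - (1 * A + -1 * B) / T.
Proof. by ring. Qed.

(** The difference of two kernels carries an additional factor
    [(X t - X t') / (X s - X t')], which is at most [10 |t - t'|]. *)
Lemma Eerr_lip t t' : half_strip t -> half_strip t' -> normc (t - t') <= 1 ->
  normc (Eerr t - Eerr t') <= M0 * normc (t - t').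
Proof.
move=> ht ht' tt.
have ht2 := half_strip_wide ht; have ht2' := half_strip_wide ht'.
rewrite /Eerr Ediff_alg -(ucontL bp (b0_decay R) 1 (-1) (outer_uok ht) (outer_uok ht')).
apply: le_trans (normc_div_twoPiI _) _; rewrite normcN.
have u3 := ucont_okL 1 (-1) (outer_uok ht) (outer_uok ht').
have B0 : 0 <= 60 * normc (t - t') by rewrite mulr_ge0 ?normc_ge0.
apply: le_trans (ucont_le bp (b0_decay R) u3 B0 _) _; last first.
  apply: le_trans (outer_const B0) _; rewrite /M0.
  have -> : 14 * (60 * normc (t - t')) * expR 2 = 840 * expR 2 * normc (t - t') by ring.
  by rewrite ler_wpM2r ?normc_ge0//; have := expR_gt0 (2 : R); lra.
move=> s Gs; have hs := contour_wide (lexx _) b5 Gs.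
have s2 : -2 <= cRe s by case: hs.
have t2 : -2 <= cRe t by case: ht2.
have t2' : -2 <= cRe t' by case: ht2'.
have [d d0 hd] := outer_sep tau0 tauS ht; have [d' d0' hd'] := outer_sep tau0 tauS ht'.
have gap := outer_gap ht Gs; have gap' := outer_gap ht' Gs.
have sb : `|cIm s| <= b0 by case: (contourP Gs).
have n1 : X s - X t != 0 by rewrite -normc_gt0; exact: lt_le_trans d0 (hd _ hs sb gap).
have n2 : X s - X t' != 0 by rewrite -normc_gt0; exact: lt_le_trans d0' (hd' _ hs sb gap').
rewrite /ker (ker_diff_alg _ _ n1 n2).
have q1 := outer_quot ht Gs.
have q2 : normc ((X t - X t') / (X s - X t')) <= 10 * normc (t - t').
  rewrite normc_div ler_pdivrMr ?normc_gt0// !XkB// !normcM.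
  set g := normc (s - t') in gap' *; set e := normc (t - t') in tt *.
  have h1 := Yk_le tau0 tauS ht2 ht2'.
  have h2 := Yk_ge tau0 tauS hs ht2'.
  have h3 := yk_ratio tau0 tauS t2' t2 s2.
  rewrite (ykC _ _ (cRe t)) (ykC _ _ (cRe s)) in h3.
  have y0 := yk_gt0 tau0 tauS s2 t2'.
  have h4 : `|cRe s - cRe t| <= g + 1.
    rewrite -cReB; apply: le_trans (Re_le_normc _) _.
    have -> : s - t = (s - t') - (t - t') by ring.
    by apply: le_trans (le_normcB _ _) _; rewrite lerD2l.
  set Yst := y (cRe s) _ in h2 h3 y0 *.
  have e0 : 0 <= e := normc_ge0 _.
  have h5 : normc (Y t t') <= 5 * g * Yst.
    apply: le_trans h1 _; apply: le_trans h3 _.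
    by rewrite ler_wpM2r ?(ltW y0)//; lra.
  apply: (@le_trans _ _ (e * (5 * g * Yst))); first by rewrite ler_wpM2l.
  have -> : e * (5 * g * Yst) = 10 * e * (g * (2^-1 * Yst)) by field.
  apply: ler_wpM2l; first by apply: mulr_ge0.
  by apply: ler_wpM2l => //; lra.
rewrite (normcM (phi s * _)) (normcM (phi s)) [normc (Y s s / _)]normc_div.
have -> : 60 * normc (t - t') * normc (phi s) = normc (phi s) * 6 * (10 * normc (t - t')) by ring.
apply: ler_pM; [|exact: normc_ge0| |exact: q2].
  by apply: mulr_ge0; [exact: normc_ge0|apply: divr_ge0; exact: normc_ge0].
by apply: ler_wpM2l; [exact: normc_ge0|exact: q1].
Qed.

(** Large enough for the error [M0] and its Lipschitz constant to become
    negligible after division. *)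
Definition K0 : R := 400 * M0.
Definition fent (z : R[i]) : R[i] := Fent z / K0%:C%C.

Lemma K0_gt : 400 * 1000 <= K0. Proof. by have := M0_gt; rewrite /K0; lra. Qed.
Lemma K0_gt0 : 0 < K0. Proof. by have := K0_gt; lra. Qed.
Lemma normc_K0 : normc K0%:C%C = K0.
Proof. by rewrite normc_real ger0_norm//; have := K0_gt; lra. Qed.

Let scale_alg (A B h L T : R[i]) : A / T - B / T - h * (L / T) = (A - B - h * L) / T.
Proof. by ring. Qed.

Lemma fent_deriv z : exists L C, 0 <= C /\ forall w, normc (w - z) <= 1 ->
  normc (fent w - fent z - (w - z) * L) <= C * normc (w - z) ^+ 2.
Proof.
have [L [C [C0 hC]]] := Fent_deriv tau0 tauS z.
have K1 := K0_gt.
exists (L / K0%:C%C), C; split => // w wz; rewrite /fent scale_alg normc_div normc_K0.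
apply: le_trans (hC _ wz); rewrite ler_pdivrMr; last lra.
by rewrite ler_peMr ?normc_ge0//; lra.
Qed.

Lemma fent_outside z : ~ tract z -> normc (fent z) <= 2^-1.
Proof.
move=> nz; rewrite normc_div normc_K0 ler_pdivrMr; last by have := K0_gt; lra.
by apply: le_trans (Fent_outside_le tau0 tauS nz) _; rewrite /K0; have := M0_gt; lra.
Qed.

Lemma fent_inside s : half_strip s -> normc (fent (X s) - phi s / K0%:C%C) <= 400^-1.
Proof.
move=> hs; rewrite /fent (Fent_inside tau0 tauS hs) -mulrBl addrC addKr.
rewrite normc_div normc_K0 ler_pdivrMr; last by have := K0_gt; lra.
by apply: le_trans (Eerr_le hs) _; rewrite /K0; have := M0_gt; lra.
Qed.

(** Where the function has modulus at least 1 the number [exp (Re (cexp s))] is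
    huge, so [cexp s] is in the right half plane. *)
Lemma fent_large s : half_strip s -> 1 <= normc (fent (X s)) ->
  K0 / 2 <= normc (phi s) /\ 1 <= cRe (cexp s).
Proof.
move=> hs f1; have h := fent_inside hs; have K1 := K0_gt.
have p : K0 / 2 <= normc (phi s).
  have : normc (fent (X s)) <= normc (fent (X s) - phi s / K0%:C%C) + normc (phi s / K0%:C%C).
    exact: normcBD.
  rewrite [normc (phi s / _)]normc_div normc_K0 => h2.
  have : 2^-1 <= normc (phi s) / K0 by lra.
  by rewrite ler_pdivlMr; lra.
split => //; rewrite -ler_expR; move: p; rewrite normc_cexp; apply: le_trans.
have [e1 e2] := expR12_ge; rewrite /K0 /M0; lra.
Qed.

Lemma cexp_diff_lower (u v : R[i]) : normc (u - v) <= 32^-1 ->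
  3 / 4 * normc (cexp v) * normc (u - v) <= normc (cexp u - cexp v).
Proof.
move=> uv; have -> : cexp u - cexp v = cexp v * (cexp (u - v) - 1).
  by rewrite mulrBr mulr1 -cexpD; congr (cexp _ - _); ring.
rewrite normcM mulrAC mulrC ler_wpM2l ?normc_ge0//.
have u0 := normc_ge0 (u - v).
have h : normc (u - v) <= 2^-1 by lra.
have := cexp_rem h.
have := normc_triangle_lower (u - v) (- (cexp (u - v) - 1 - (u - v))).
rewrite normcN opprK (_ : u - v + (cexp (u - v) - 1 - (u - v)) = cexp (u - v) - 1); last by ring.
rewrite expr2; nra.
Qed.

Lemma fentB a b : fent a - fent b = (Fent a - Fent b) / K0%:C%C.
Proof. exact: (esym (mulrBl _ _ _)). Qed.

Let expand_alg (e d v W : R) : 0 <= v -> 3 / 4 * e * d <= v -> 8^-1 * v <= W -> 16^-1 * e * d <= W.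
Proof.
have -> : 16^-1 * e * d = 16^-1 * (e * d) by ring.
have -> : 3 / 4 * e * d = 3 / 4 * (e * d) by ring.
by move=> v0 h1; apply: le_trans; lra.
Qed.

Let split_alg (a b c d : R[i]) : a + b - (c + d) = (a - c) - - (b - d).
Proof. by ring. Qed.

(** In the coordinate [v = cexp s] the main term is [exp v / K0], which expands
    by at least 3/8 where the function has modulus at least 1, and the error [Eerr / K0] is
    Lipschitz with a tiny constant.  Passing from [s] to [v] expands by
    [exp (Re s)]. *)
Lemma fent_expand s s' : half_strip s -> half_strip s' -> normc (s' - s) <= 32^-1 ->
  normc (cexp s' - cexp s) <= 32^-1 -> 1 <= normc (fent (X s)) ->
  8^-1 * normc (cexp s' - cexp s) <= normc (fent (X s') - fent (X s)) /\
  16^-1 * expR (cRe s) * normc (s' - s) <= normc (fent (X s') - fent (X s)).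
Proof.
move=> hs hs' ss vv f1; have [p r1] := fent_large hs f1; have K1 := K0_gt.
have e1 : 1 <= expR (cRe s).
  rewrite -normc_cexp; apply: le_trans r1 _; exact: le_trans (ler_norm _) (Re_le_normc _).
have h1 : 3 / 4 * expR (cRe s) * normc (s' - s) <= normc (cexp s' - cexp s).
  by rewrite -normc_cexp; exact: cexp_diff_lower.
have h2 : 3 / 4 * normc (phi s) * normc (cexp s' - cexp s) <= normc (phi s' - phi s).
  exact: cexp_diff_lower.
have h3 : normc (Eerr s' - Eerr s) <= M0 * normc (s' - s) by apply: Eerr_lip => //; lra.
set dv := normc (cexp s' - cexp s) in vv h1 h2 *; set ds := normc (s' - s) in ss h1 h3 *.
have ds0 : 0 <= ds := normc_ge0 _.
have dv0 : 0 <= dv := normc_ge0 _.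
have h4 : 3 / 4 * ds <= dv.
  have h0 : ds <= expR (cRe s) * ds by rewrite ler_peMl.
  by apply: le_trans h1; rewrite -(mulrA (3 / 4)); apply: ler_wpM2l; [lra|].
have m0 := M0_gt.
have h5 : 3 / 8 * K0 * dv <= 3 / 4 * normc (phi s) * dv by apply: ler_wpM2r => //; lra.
have h6 : M0 * ds <= M0 * (4 / 3 * dv) by apply: ler_wpM2l; lra.
have h7 : 8^-1 * K0 * dv <= normc (Fent (X s') - Fent (X s)).
  rewrite (Fent_inside tau0 tauS hs) (Fent_inside tau0 tauS hs').
  rewrite split_alg.
  have := normc_triangle_lower (phi s' - phi s) (- (Eerr s' - Eerr s)).
  rewrite normcN.
  have : 8^-1 * K0 * dv <= 3 / 8 * K0 * dv - M0 * (4 / 3 * dv).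
    have -> : 3 / 8 * K0 * dv - M0 * (4 / 3 * dv) = (3 / 8 * K0 - 4 / 3 * M0) * dv by ring.
    by apply: ler_wpM2r => //; rewrite /K0; lra.
  lra.
have h8 : 8^-1 * dv <= normc (fent (X s') - fent (X s)).
  rewrite fentB normc_div normc_K0 (ler_pdivlMr _ _ K0_gt0) (mulrAC 8^-1 dv).
  exact: h7.
split; first exact: h8.
exact: (expand_alg dv0 h1 h8).
Qed.

Lemma tract_norm z : tract z -> 2 < normc z.
Proof.
move=> [s hs <-]; have := Re_Xk_ge tau0 tauS (half_strip_wide hs).
by move=> h; apply: lt_le_trans h _; exact: le_trans (ler_norm _) (Re_le_normc _).
Qed.

(** The disc of radius 2 is mapped into the disc of radius 1/2, so an orbit that
    enters it stays there. *)
Lemma fent_le_half z : normc z <= 2 -> normc (fent z) <= 2^-1.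
Proof. by move=> z2; apply: fent_outside => /tract_norm; rewrite ltNge z2. Qed.

End Expansion.

(** * The function belongs to the Eremenko-Lyubich class *)

Section PolyBounded.
Variable R : realType.

(** A product of linear factors is large far out on the ray. *)
Lemma poly_bounded_ray (q : {poly R[i]}) (B : R) :
  (forall x : R, 0 <= x -> normc q.[- x%:C%C] <= B) -> (size q <= 1)%N.
Proof.
move=> qB; rewrite leqNgt; apply/negP => sq.
have [r er] := closed_field_poly_normal q.
have l0 : lead_coef q != 0 by rewrite lead_coef_eq0 -size_poly_gt0; exact: leq_trans sq.
have l0' : 0 < normc (lead_coef q) by rewrite normc_gt0.
have [x0 [c1 hr]] : exists x0 : R, 0 <= x0 /\ forall a, a \in r -> normc a <= x0.
  elim: (r) => [|a l [x0 [p h]]]; first by exists 0.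
  exists (x0 + normc a); split; first by rewrite addr_ge0 ?normc_ge0.
  move=> b; rewrite inE => /orP[/eqP->|/h hb]; first by rewrite lerDr.
  by apply: le_trans hb _; rewrite lerDl normc_ge0.
pose K := 1 + `|B| / normc (lead_coef q).
have K1 : 1 <= K by rewrite lerDl divr_ge0 ?normc_ge0.
have hf (a : R[i]) : a \in r -> K <= normc (- (x0 + K)%:C%C - a).
  move=> /hr ha; rewrite -opprD normcN.
  have := normc_triangle_lower (x0 + K)%:C%C (- a); rewrite opprK normcN normc_real.
  by rewrite ger0_norm; lra.
have : normc (lead_coef q) * K <= normc q.[- (x0 + K)%:C%C].
  rewrite {2}er hornerZ normcM ler_wpM2l ?normc_ge0//.
  have : (0 < size r)%N.
    have := sq; rewrite er size_scale// size_prod_XsubC; by case: (size r).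
  case: r hf {er hr sq} => // a l hf _; rewrite big_cons hornerM normcM hornerXsubC.
  apply: (@le_trans _ _ (K * 1)); first by rewrite mulr1.
  apply: ler_pM => //; [lra|by apply: hf; rewrite mem_head|].
  elim: l hf => [|b l IH] hf; first by rewrite big_nil hornerC normc1.
  rewrite big_cons hornerM normcM hornerXsubC -[1]mulr1; apply: ler_pM => //.
    by apply: le_trans K1 _; apply: hf; rewrite !inE eqxx orbT.
  by apply: IH => c; rewrite inE => /orP[/eqP->|hc]; apply: hf; rewrite !inE ?eqxx// hc !orbT.
have -> : normc (lead_coef q) * K = normc (lead_coef q) + `|B|.
  by rewrite /K mulrDr mulr1 [_ * (_ / _)]mulrC divfK ?gt_eqF.
have x1 : 0 <= x0 + K by lra.
have := qB _ x1; have := ler_norm B; lra.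
Qed.
End PolyBounded.

Section ClassB.
Variable R : realType.
Variable tau : nat -> R.
Hypothesis tau0 : 200 <= tau 0%N.
Hypothesis tauS : forall k, 2 * tau k <= tau k.+1.
Notation X := (Xk tau).
Notation Y := (Yk tau).
Notation y := (yk tau).
Notation phi := (@phi R).
Notation fent := (fent tau).
Notation half_strip := (@half_strip R).
Notation tract := (tract tau).
Notation K0 := (K0 R).

Lemma large_in_tract z : 1 <= normc (fent z) -> tract z.
Proof.
move=> f1; apply: contrapT => nz; have := fent_outside tau0 tauS nz; lra.
Qed.

Lemma large_expR s : half_strip s -> 1 <= normc (fent (X s)) -> 1 <= expR (cRe s).
Proof.
move=> hs f1; have [_ r1] := fent_large tau0 tauS hs f1.
rewrite -normc_cexp; apply: le_trans r1 _; exact: le_trans (ler_norm _) (Re_le_normc _).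
Qed.

Lemma cexp_diff_upper (u v : R[i]) : normc (u - v) <= 64^-1 ->
  normc (cexp u - cexp v) <= 2 * normc (u - v) * expR (cRe v).
Proof.
move=> uv; have -> : cexp u - cexp v = cexp v * (cexp (u - v) - 1).
  by rewrite mulrBr mulr1 -cexpD; congr (cexp _ - _); ring.
rewrite normcM normc_cexp mulrC ler_wpM2r ?expR_ge0//.
have u0 := normc_ge0 (u - v).
have h : normc (u - v) <= 2^-1 by lra.
have := cexp_rem h.
have := normcBD (cexp (u - v) - 1) (u - v); rewrite expr2; nra.
Qed.

Lemma cexp_close (s s' : R[i]) : 1 <= expR (cRe s) ->
  normc (s' - s) <= 64^-1 / expR (cRe s) ->
  normc (s' - s) <= 64^-1 /\ normc (cexp s' - cexp s) <= 32^-1.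
Proof.
move=> e1 h; have e0 : 0 < expR (cRe s) := expR_gt0 _.
have h2 : normc (s' - s) <= 64^-1.
  apply: le_trans h _; rewrite ler_pdivrMr//; lra.
split => //; apply: le_trans (cexp_diff_upper h2) _.
by move: h; rewrite ler_pdivlMr//; lra.
Qed.

(** Expansion along a horizontal segment starting at [s] excludes a vanishing
    derivative. *)
Lemma critical_le a : critical_values (fent : R[i]^o -> R[i]^o) a -> normc a <= 1.
Proof.
move=> [z d0 <-]; rewrite leNgt; apply/negP => /ltW f1.
have [L [C [C0 hC]]] := fent_deriv tau0 tauS z.
have eL : L = 0.
  rewrite -d0 derive1E; apply/esym.
  have h : is_derive (z : R[i]^o) (1 : R[i]^o) (fent : R[i]^o -> R[i]^o) L.
    apply: (@is_derive_quad _ _ _ _ C%:C%C 1); rewrite ?ltr01 ?lecR// => u.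
    rewrite !normr_normc -(rmorph1 (real_complex R)) ltcR => /ltW u1.
    rewrite -rmorphXn -rmorphM lecR -[u in X in _ <= X](addrK z) -{2}[u](addrK z).
    by apply: hC; rewrite addrK.
  exact: derive_val.
have [s hs ez] := large_in_tract f1; rewrite -ez in f1 hC.
have e1 := large_expR hs f1.
set e := expR (cRe s) in e1.
(* short enough for the quadratic term to be smaller than the expansion *)
pose d := 64^-1 / (e * (1 + C)).
have eC : 0 < e * (1 + C) by rewrite mulr_gt0//; lra.
have dp : 0 < d by rewrite divr_gt0.
have dn : normc (s + d%:C%C - s) = d by rewrite addrC addKr normc_real gtr0_norm.
have de : d <= 64^-1 / e.
  rewrite /d ler_wpM2l// lef_pV2 ?posrE//; last lra.
  by rewrite ler_peMr//; lra.
have hs' : half_strip (s + d%:C%C).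
  case: hs => h1 h2; split; rewrite ?cReD ?cImD/= ?addr0//; lra.
have hd : normc (s + d%:C%C - s) <= 64^-1 / e by rewrite dn.
have [k1 k2] := cexp_close e1 hd.
have k3 : normc (s + d%:C%C - s) <= 32^-1 by lra.
have [_ ] := fent_expand tau0 tauS hs hs' k3 k2 f1.
rewrite dn -/e => low.
have H1 := half_strip_wide hs; have H2 := half_strip_wide hs'.
have up : normc (X (s + d%:C%C) - X s) <= d.
  rewrite XkB// normcM dn; apply: ler_piMr; first exact: ltW.
  apply: le_trans (Yk_le tau0 tauS H2 H1) _.
  have : y (cRe (s + d%:C%C)) (cRe s) <= 50^-1.
    by apply: yk_small => //; [case: H2|case: H1].
  lra.
have u1 : normc (X (s + d%:C%C) - X s) <= 1 by lra.
have := hC _ u1; rewrite eL mulr0 subr0.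
have : C * normc (X (s + d%:C%C) - X s) ^+ 2 <= C * d ^+ 2.
  by rewrite ler_wpM2l// lerXn2r// ?nnegrE ?normc_ge0// ltW.
have : C * d ^+ 2 < 16^-1 * e * d.
  rewrite expr2 mulrA ltr_pM2r//.
  have : d * (e * (1 + C)) = 64^-1 by rewrite /d divfK// gt_eqF.
  nra.
lra.
Qed.

Let step_alg (d e Y0 Y1 W rho : R) : 1 <= e -> 0 < Y0 -> 0 < Y1 -> 0 <= d ->
  rho = Y0 / (256 * e) -> Y0 <= (1 + d) * Y1 -> Y1 <= (1 + d) * Y0 ->
  2^-1 * Y1 <= W -> W <= Y1 -> d * W <= rho ->
  d <= 64^-1 / e /\ (16^-1 * e * d <= (128 * 128)^-1 -> d * W <= rho / 2).
Proof.
move=> e1 Y0p Y1p d0 erho r1 r2 l1 l2 h1.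
have ep : 0 < 256 * e by lra.
have re : rho * (256 * e) = Y0 by rewrite erho (divfK (lt0r_neq0 ep)).
have rp : 0 < rho by rewrite erho divr_gt0.
have dd : d * e <= 64^-1.
  have a2 : d * Y1 <= 2 * rho.
    have : d * (2^-1 * Y1) <= d * W by apply: ler_wpM2l.
    lra.
  have a3 : d * Y0 <= (1 + d) * (2 * rho).
    have : d * Y0 <= d * ((1 + d) * Y1) by apply: ler_wpM2l.
    have : (1 + d) * (d * Y1) <= (1 + d) * (2 * rho) by apply: ler_wpM2l => //; lra.
    lra.
  have a4 : d * (256 * e) <= (1 + d) * 2.
    rewrite -(ler_pM2r rp).
    have -> : d * (256 * e) * rho = d * Y0 by rewrite -re; ring.
    lra.
  have : d <= d * e by rewrite ler_peMr.
  lra.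
have d1 : d <= 1.
  have : d <= d * e by rewrite ler_peMr.
  lra.
split; first by rewrite ler_pdivlMr//; lra.
move=> low; have low2 : d * e <= 16 * (128 * 128)^-1 by lra.
have b1 : Y1 <= 2 * Y0 by apply: le_trans r2 _; apply: ler_wpM2r; lra.
have b2 : d * W <= d * (2 * Y0) by apply: ler_wpM2l => //; lra.
apply: le_trans b2 _.
have -> : d * (2 * Y0) = d * e * (512 * rho) by rewrite -re; ring.
have : d * e * (512 * rho) <= 16 * (128 * 128)^-1 * (512 * rho).
  by apply: ler_wpM2r; [lra|exact: low2].
by have -> : 16 * (128 * 128)^-1 * (512 * rho) = rho / 2 by field.
Qed.

(** A dichotomy at the scale [rho] set by the point [X s]: a point of the tract at
    distance at most [rho] with almost the same value is at distance at most
    [rho / 2].  Both scales are proportional to the derivative of [X] at [s], so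
    the tolerance for the values is absolute. *)
Lemma asym_step s s' rho : half_strip s -> half_strip s' -> 1 <= normc (fent (X s)) ->
  rho = y (cRe s) (cRe s) / (256 * expR (cRe s)) ->
  normc (X s' - X s) <= rho ->
  normc (fent (X s') - fent (X s)) <= (128 * 128)^-1 ->
  normc (X s' - X s) <= rho / 2.
Proof.
move=> hs hs' f1 erho h1 h2; have e1 := large_expR hs f1.
have H1 := half_strip_wide hs; have H2 := half_strip_wide hs'.
have s2 : -2 <= cRe s by case: H1.
have s2' : -2 <= cRe s' by case: H2.
have Y0p := yk_gt0 tau0 tauS s2 s2.
have Y1p := yk_gt0 tau0 tauS s2 s2'.
have d0 := normc_ge0 (s' - s).
have hd : `|cRe s' - cRe s| <= normc (s' - s) by rewrite -cReB; exact: Re_le_normc.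
have hd1 : 1 + `|cRe s' - cRe s| <= 1 + normc (s' - s) by rewrite lerD2l.
have r1 := le_trans (yk_ratio tau0 tauS s2 s2 s2') (ler_wpM2r (ltW Y1p) hd1).
have r2 := yk_ratio tau0 tauS s2 s2' s2; rewrite distrC in r2.
have {}r2 := le_trans r2 (ler_wpM2r (ltW Y0p) hd1).
have l1 := Yk_ge tau0 tauS H2 H1; have l2 := Yk_le tau0 tauS H2 H1.
rewrite (ykC _ (cRe s')) in l1 l2.
rewrite (XkB tau0 tauS H2 H1) normcM in h1 *.
have [dd fin] := step_alg e1 Y0p Y1p d0 erho r1 r2 l1 l2 h1.
have [k1 k2] := cexp_close e1 dd.
have k3 : normc (s' - s) <= 32^-1 by apply: le_trans k1 _; lra.
have [_ low] := fent_expand tau0 tauS hs hs' k3 k2 f1.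
exact/fin/(le_trans low).
Qed.

Lemma normc_dist_lip (a b c : R[i]) :
  `|normc (a - c) - normc (b - c)| <= normc (a - b).
Proof.
have h1 := normcBD (a - c) (b - c); have h2 := normcBD (b - c) (a - c).
have e1 : a - c - (b - c) = a - b by ring.
have e2 : b - c - (a - c) = - (a - b) by ring.
rewrite e1 in h1; rewrite e2 normcN in h2.
by rewrite ler_norml; apply/andP; split; lra.
Qed.

Let mid_alg (a b c : R[i]) : b - c = - (a - b) + (a - c).
Proof. by ring. Qed.

(** Far out on an asymptotic path the values are almost constant.  By
    [asym_step] the distance from a point of the path never takes values
    above [rho / 2] and up to [rho], so by continuity it stays below [rho]: the path is
    bounded. *)
Lemma asymptotic_le a : asymptotic_values (fent : R[i]^o -> R[i]^o) a -> normc a <= 2.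
Proof.
move=> [g [gc ginf ga]]; rewrite leNgt; apply/negP => a2.
pose eta : R := (128 * 128)^-1 / 2.
have eta0 : (0 : R[i]) < eta%:C%C by rewrite ltcR divr_gt0// invr_gt0 mulr_gt0.
have /cvgrPdist_lt/(_ _ eta0)[M1 [_ hM1]] := ga.
pose T := `|M1| + 1.
have T0 : 0 <= T by rewrite addr_ge0.
have near_a t : T <= t -> normc (a - fent (g t)) < eta.
  move=> Tt; have := hM1 t; rewrite /= normr_normc ltcR; apply.
  by apply: lt_le_trans Tt; rewrite /T; have := ler_norm M1; lra.
have etaD : eta + eta <= (128 * 128)^-1 by rewrite /eta -splitr.
have eta1 : eta <= 1.
  by rewrite /eta; lra.
have large t : T <= t -> 1 <= normc (fent (g t)).
  move=> Tt; have := near_a t Tt; have := normcBD a (fent (g t)); lra.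
have [sT hsT eT] := large_in_tract (large T (lexx _)).
have fT := large T (lexx _); rewrite -eT in fT.
pose rho := y (cRe sT) (cRe sT) / (256 * expR (cRe sT)).
have rho0 : 0 < rho.
  have s2 : -2 <= cRe sT by case: (half_strip_wide hsT).
  apply: divr_gt0; first exact: (yk_gt0 tau0 tauS s2 s2).
  by apply: mulr_gt0; [lra|exact: expR_gt0].
pose G t := normc (g t - g T).
have step t : T <= t -> G t <= rho -> G t <= rho / 2.
  move=> Tt; have [s hs et] := large_in_tract (large t Tt); rewrite /G -et -eT => h.
  apply: (asym_step hsT hs fT erefl h); rewrite et eT (mid_alg a).
  apply: le_trans (le_normcD _ _) _; rewrite (normcN (a - fent (g t))).
  exact: le_trans (lerD (ltW (near_a t Tt)) (ltW (near_a T (lexx _)))) etaD.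
have Gc t : {within `[T, t], continuous G}.
  apply/subspace_continuousP => u; rewrite /= in_itv/= => /andP[Tu ut].
  have /subspace_continuousP/(_ u) := gc; rewrite /= in_itv/= andbT => /(_ (le_trans T0 Tu)).
  move=> /cvgrPdist_lt cg; apply/cvgrPdist_lt => e e0.
  have e0' : (0 : R[i]) < e%:C%C by rewrite ltcR.
  have := cg _ e0'; rewrite !near_withinE; apply: filter_app; near=> v => hv.
  rewrite /= in_itv/= => /andP[Tv vt].
  have := hv; rewrite /= in_itv/= andbT (le_trans T0 Tv) => /(_ isT).
  by rewrite normr_normc ltcR; apply: le_lt_trans; exact: normc_dist_lip.
have GT : G T = 0 by rewrite /G subrr normc0.
have Gle t : T <= t -> G t <= rho.
  move=> Tt; rewrite leNgt; apply/negP => Gt.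
  have [|c] := @IVT R G T t rho Tt (Gc t).
    have Gt0 : 0 <= G t by exact: normc_ge0.
    by rewrite GT (min_l Gt0) (max_r Gt0) (ltW rho0) (ltW Gt).
  rewrite in_itv/= => /andP[Tc ct] Gr.
  have := step c Tc; rewrite Gr lexx => /(_ isT); lra.
have /cvgryPge/(_ (rho + normc (g T) + 1))[M2 [_ hM2]] := ginf.
pose t := T + `|M2| + 1.
have Tt : T <= t by rewrite /t; have := normr_ge0 M2; lra.
have : M2 < t by rewrite /t; have := ler_norm M2; lra.
move=> /hM2 /=; rewrite cabsE; have := Gle t Tt; rewrite /G.
have := normcBD (g t) (g T); lra.
Unshelve. all: by end_near. Qed.

Lemma fent_entire : entire (fent : R[i]^o -> R[i]^o).
Proof.
move=> z; have [L [C [C0 hC]]] := fent_deriv tau0 tauS z.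
have h : is_derive (z : R[i]^o) (1 : R[i]^o) (fent : R[i]^o -> R[i]^o) L.
  apply: (@is_derive_quad _ _ _ _ C%:C%C 1); rewrite ?ltr01 ?lecR// => u.
  rewrite !normr_normc -(rmorph1 (real_complex R)) ltcR => /ltW u1.
  rewrite -rmorphXn -rmorphM lecR -[u in X in _ <= X](addrK z) -{2}[u](addrK z).
  by apply: hC; rewrite addrK.
by case: h.
Qed.

Lemma fent_unbounded : exists z, 1 <= normc (fent z).
Proof.
have K1 := K0_gt R.
pose x := 2 * K0.
have hs : half_strip x%:C%C by split; rewrite /= ?normr0 ?pi_ge0// /x; lra.
exists (X x%:C%C); have := fent_inside tau0 tauS hs.
have : 2 <= normc (phi x%:C%C / K0%:C%C).
  rewrite normc_div normc_K0 ler_pdivlMr; last lra.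
  rewrite normc_cexp /=; set c := (X in expR X).
  have : x <= c by rewrite /c /= cos0 mulr1; have := expR_ge1Dx x; lra.
  have := expR_ge1Dx c; rewrite /x; lra.
have := normcBD (phi x%:C%C / K0%:C%C) (fent (X x%:C%C)); rewrite normcB.
lra.
Qed.

Lemma fent_transcendental : transcendental_entire (fent : R[i]^o -> R[i]^o).
Proof.
split; first exact: fent_entire.
move=> [q hq]; have neg (x : R) : 0 <= x -> normc (fent (- x%:C%C)) <= 2^-1.
  move=> x0; apply: (fent_outside tau0 tauS) => -[s hs e].
  by have := Re_Xk_ge tau0 tauS (half_strip_wide hs); rewrite e cReN /=; lra.
have s1 : (size q <= 1)%N.
  by apply: (@poly_bounded_ray R q 2^-1) => x x0; rewrite -hq; exact: neg.
have [z fz] := fent_unbounded.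
have := neg 0 (lexx _); move: fz; rewrite !hq (size1_polyC s1) !hornerC; lra.
Qed.

Theorem fent_eremenko_lyubich : eremenko_lyubich (fent : R[i]^o -> R[i]^o).
Proof.
split; first exact: fent_transcendental.
exists 2; split; first exact: realn.
move=> M M2 a ha; apply: le_trans (ltW M2); rewrite /= normr_normc -(rmorphMn _ 2) lecR.
case: ha => [/critical_le h|/asymptotic_le//].
by apply: le_trans h _; lra.
Qed.
End ClassB.

(** * Finite covers and null sets for Hausdorff measures *)

Section FiniteCovers.
Variable R : realType.
Implicit Types (D S T d : R) (A B U : set R[i]).

Definition diam_le U d := forall x y, U x -> U y -> normc (x - y) <= d.

(** [D] bounds the single diameters of a finite cover and [S] their sum.  The inductive form makes pulling back and
    taking unions simple inductions. *)
Inductive fincov D : R -> set R[i] -> Prop :=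
| fincov0 : fincov D 0 set0
| fincovU S A d U : fincov D S A -> 0 <= d <= D -> diam_le U d ->
    fincov D (S + d) (A `|` U)
| fincovW S A T B : fincov D S A -> S <= T -> B `<=` A -> fincov D T B.

Lemma fincov_one D d U : 0 <= d <= D -> diam_le U d -> fincov D d U.
Proof.
by move=> dD Ud; apply: (fincovW (fincovU (fincov0 D) dD Ud)); rewrite ?add0r// => x; right.
Qed.

Lemma fincov_cup D S T A B : fincov D S A -> fincov D T B -> fincov D (S + T) (A `|` B).
Proof.
move=> cA; elim=> {T B} [|T B d U _ IH dD Ud|T B T' B' _ IH TT BB].
- by rewrite addr0; apply: (fincovW cA) => // x [].
- by rewrite addrA setUA; exact: fincovU.
- by apply: (fincovW IH); [rewrite lerD2l|exact: setUS].
Qed.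

Lemma fincov_bigcup D (S : nat -> R) (A : nat -> set R[i]) n :
  (forall i, (i < n)%N -> fincov D (S i) (A i)) ->
  fincov D (\sum_(i < n) S i) (\bigcup_(i in `I_n) A i).
Proof.
elim: n => [_|n IH h].
  by rewrite big_ord0 bigcup0; [exact: fincov0|move=> i; rewrite /= ltn0].
rewrite big_ord_recr /= bigcup_mkord big_ord_recr /= -bigcup_mkord.
by apply: fincov_cup; [apply: IH => i ni; apply: h; exact: ltnW|exact: h].
Qed.

(** Here [Phi] is a preimage operation, and [C] the factor by which the preimage of
    a single set multiplies the total diameter. *)
Lemma fincov_pull D C S A (Phi : set R[i] -> set R[i]) : 0 <= C ->
  Phi set0 = set0 -> (forall B B', Phi (B `|` B') = Phi B `|` Phi B') ->
  (forall d U, 0 <= d <= D -> diam_le U d -> fincov D (C * d) (Phi U)) ->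
  fincov D S A -> fincov D (C * S) (Phi A).
Proof.
move=> C0 P0 PU h; elim=> {S A} [|S A d U _ IH dD Ud|S A T B _ IH ST BA].
- by rewrite mulr0 P0; exact: fincov0.
- by rewrite mulrDr PU; apply: fincov_cup => //; exact: h.
- apply: (fincovW IH); first exact: ler_wpM2l.
  by rewrite -((setUidPr B A).2 BA) PU; left.
Qed.

Local Notation dflt := (set0 : set R[i], 0 : R).

Lemma fincov_seq D S A : 0 <= D -> fincov D S A -> exists l : seq (set R[i] * R),
  [/\ forall i, 0 <= (nth dflt l i).2 <= D /\ diam_le (nth dflt l i).1 (nth dflt l i).2,
      \sum_(q <- l) q.2 <= S & forall z, A z -> exists i, (nth dflt l i).1 z].
Proof.
move=> D0; elim=> {S A} [|S A d U _ [l [h1 h2 h3]] dD Ud|S A T B _ [l [h1 h2 h3]] ST BA].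
- exists [::]; split=> [i||z []]; last by rewrite big_nil.
  by rewrite nth_nil/= lexx D0; split.
- exists ((U, d) :: l); split.
  + by case=> [|i]; [split|exact: h1].
  + by rewrite big_cons/= addrC lerD2r.
  + by move=> z [/h3[i iz]|Uz]; [exists i.+1|exists 0%N].
- by exists l; split=> //; [exact: le_trans ST|move=> z /BA /h3].
Qed.

End FiniteCovers.

Section HausdorffNull.
Variable R : realType.
Variables (eta : R) (h : R -> R).
Hypothesis gauge_h : gauge_function eta h.
Local Notation dflt := (set0 : set R[i], 0 : R).

Lemma diam_fine (U : set R[i]) d : 0 <= d -> diam_le U d ->
  (diam U <= d%:E)%E /\ 0 <= fine (diam U) <= d.
Proof.
move=> d0 Ud.
have h1 : (diam U <= d%:E)%E.
  apply: ge_ereal_sup => _ [->|[x Ux [y Uy <-]]]; first by rewrite lee_fin.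
  by rewrite lee_fin cabsE; exact: Ud.
have h2 : (0 <= diam U)%E by apply: ereal_sup_ubound; left.
split=> //; case: (diam U) h1 h2 => [r| |] //=; rewrite !lee_fin => -> ->.
by [].
Qed.

Section Stream.
Variable l : nat -> seq (set R[i] * R).
Hypothesis l_gt0 : forall m, (0 < size (l m))%N.

Definition flat n := flatten [seq l m | m <- iota 0 n].

Lemma flatD m n : exists r, flat (m + n) = flat m ++ r.
Proof. by rewrite /flat iotaD map_cat flatten_cat; eexists. Qed.

Lemma flat_size n : (n <= size (flat n))%N.
Proof.
elim: n => // n IH; rewrite /flat -addn1 iotaD map_cat flatten_cat size_cat /= add0n cats0.
exact: leq_add.
Qed.

Lemma flat_nth n i : (i < size (flat n))%N -> nth dflt (flat n) i = nth dflt (flat i.+1) i.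
Proof.
move=> hi; case: (leqP n i.+1) => ni.
  by have [r] := flatD n (i.+1 - n); rewrite subnKC// => ->; rewrite nth_cat hi.
have [r] := flatD i.+1 (n - i.+1); rewrite subnKC; last exact: ltnW.
by move=> ->; rewrite nth_cat flat_size.
Qed.

(** Enumerates the concatenation of infinitely many nonempty lists; the prefix
    [flat i.+1] already contains the entry of index [i], see [flat_nth]. *)
Definition stream i := nth dflt (flat i.+1) i.

Lemma stream_cover m i : exists j, (nth dflt (l m) i).1 `<=` (stream j).1.
Proof.
case: (leqP (size (l m)) i) => hi; first by exists 0%N; rewrite nth_default.
pose j := (size (flat m) + i)%N.
have e : flat m.+1 = flat m ++ l m.
  by rewrite /flat -addn1 iotaD map_cat flatten_cat /= add0n cats0.
have hj : (j < size (flat m.+1))%N by rewrite e size_cat ltn_add2l.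
exists j; rewrite /stream -(flat_nth hj) e nth_cat /j ltnNge leq_addr /=.
by rewrite addKn.
Qed.

Lemma stream_all (P : set R[i] * R -> Prop) :
  (forall m i, P (nth dflt (l m) i)) -> P dflt -> forall j, P (stream j).
Proof.
move=> hP P0 j; rewrite /stream /flat.
move: (iota 0 j.+1) => s; elim: s j => [|m s IH] j; first by rewrite nth_nil.
by rewrite /= nth_cat; case: ifP => _; [exact: hP|exact: IH].
Qed.

Lemma stream_sum (g : set R[i] * R -> R) n : (forall j, 0 <= g (nth dflt (flat n) j)) ->
  \sum_(0 <= j < n) g (stream j) <= \sum_(0 <= m < n) \sum_(q <- l m) g q.
Proof.
move=> g0; have -> : \sum_(0 <= m < n) \sum_(q <- l m) g q = \sum_(q <- flat n) g q.
  by rewrite /flat big_flatten big_map /index_iota subn0.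
rewrite (big_nth dflt) (big_cat_nat (leq0n n) (flat_size n)) /=.
rewrite (_ : \sum_(0 <= j < n) g (stream j) = \sum_(0 <= j < n) g (nth dflt (flat n) j)).
  by rewrite lerDl sumr_ge0.
apply: eq_big_nat => j /andP[_ jn]; rewrite /stream (@flat_nth n j)//.
exact: leq_trans jn (flat_size n).
Qed.

End Stream.

Let h0 : h 0 = 0. Proof. by case: gauge_h. Qed.
Let h_ge0 t : 0 <= t -> t < eta -> 0 <= h t.
Proof. by case: gauge_h => _ _ _ H _ t0 te; apply: H; rewrite in_itv/= t0. Qed.

(** The countably many finite covers are concatenated into one sequence, and
    piece [m] contributes at most [theta m * S m]. *)
Lemma premeasure_le (A : set R[i]) (F : nat -> set R[i]) (D S theta : nat -> R) delta e :
  0 < e -> A `<=` \bigcup_m F m -> (forall m, fincov (D m) (S m) (F m)) ->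
  (forall m, 0 <= D m < Num.min delta eta) -> (forall m, 0 <= theta m) ->
  (forall m t, 0 <= t <= D m -> h t <= theta m * t) ->
  (forall m, theta m * S m <= e / 2 ^+ m.+1) ->
  (hausdorff_premeasure h delta A <= e%:E)%E.
Proof.
move=> e0 AF cF Dd th0 hth thS.
have D0 m : 0 <= D m by case/andP: (Dd m).
have De m : D m < eta by case/andP: (Dd m) => _; rewrite lt_min => /andP[].
have Ddl m : D m < delta by case/andP: (Dd m) => _; rewrite lt_min => /andP[].
have /choice[l0 hl0] := fun m => fincov_seq (D0 m) (cF m).
have d0l m : 0 <= (0 : R) <= D m /\ diam_le (set0 : set R[i]) 0.
  by split=> [|x y []]; rewrite lexx D0.
(* padding by the empty set makes every list nonempty *)
pose l m := dflt :: l0 m.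
have lp m : (0 < size (l m))%N by [].
have hl m i : 0 <= (nth dflt (l m) i).2 <= D m /\
    diam_le (nth dflt (l m) i).1 (nth dflt (l m) i).2.
  by case: i => [|i]; [exact: d0l|have [H _ _] := hl0 m; exact: H].
pose U j := (stream l j).1.
pose g (q : set R[i] * R) := h (fine (diam q.1)).
have sm j : exists m, D m = D m /\ 0 <= (stream l j).2 <= D m /\
    diam_le (stream l j).1 (stream l j).2.
  apply: (@stream_all l (fun q => exists m, D m = D m /\ 0 <= q.2 <= D m /\ diam_le q.1 q.2)).
    by move=> m i; exists m; split=> //; exact: hl.
  by exists 0%N; split=> //; exact: d0l.
have gn n j : 0 <= g (nth dflt (flat l n) j).
  have [m [d0 dU]] : exists m, 0 <= (nth dflt (flat l n) j).2 <= D m /\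
     diam_le (nth dflt (flat l n) j).1 (nth dflt (flat l n) j).2.
    have [jn|jn] := ltnP j (size (flat l n)).
      by rewrite flat_nth//; have [m [_ hm]] := sm j; exists m.
    by rewrite nth_default//; exists 0%N; exact: d0l.
  case/andP: d0 => d0 dD; have [_ /andP[f0 f1]] := diam_fine d0 dU.
  by apply: h_ge0 => //; apply: le_lt_trans f1 _; apply: le_lt_trans dD (De m).
apply: (@le_trans _ _ (\sum_(0 <= j <oo) (h (fine (diam (U j))))%:E)%E).
  apply: ereal_inf_lbound; exists U => //; split.
    move=> j; have [m [_ [/andP[d0 dD] dU]]] := sm j.
    have [h1 _] := diam_fine d0 dU.
    by apply: le_lt_trans h1 _; rewrite lte_fin; apply: le_lt_trans dD (Ddl m).
  move=> z /AF[m _ Fz]; have [_ _ /(_ _ Fz)[i iz]] := hl0 m.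
  have [j hj] := @stream_cover l lp m i.+1.
  by exists j => //; exact: hj.
have Uge j : (0 <= (h (fine (diam (U j))))%:E)%E.
  rewrite lee_fin; have := gn j.+1 j; by [].
apply: lime_le; first by apply: is_cvg_nneseries => j _ _; exact: Uge.
near=> n; rewrite sumEFin lee_fin.
apply: le_trans (stream_sum lp (gn n)) _.
apply: (@le_trans _ _ (\sum_(0 <= m < n) e / 2 ^+ m.+1)).
  apply: ler_sum_nat => m _; apply: le_trans (thS m).
  apply: (@le_trans _ _ (theta m * \sum_(q <- l m) q.2)).
    rewrite mulr_sumr (big_nth dflt) [leRHS](big_nth dflt); apply: ler_sum => i _.
    have [/andP[d0 dD] dU] := hl m i; have [_ /andP[f0 f1]] := diam_fine d0 dU.
    apply: (@le_trans _ _ (theta m * fine (diam (nth dflt (l m) i).1))).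
      by apply: hth; rewrite f0 (le_trans f1).
    exact: ler_wpM2l.
  by apply: ler_wpM2l => //; rewrite big_cons add0r; case: (hl0 m).
have -> : \sum_(0 <= m < n) e / 2 ^+ m.+1 = e * (1 - 2^-1 ^+ n).
  elim: (n) => [|k IH]; first by rewrite big_geq// expr0 subrr mulr0.
  rewrite big_nat_recr//= IH !exprS invfM -exprVn; lra.
rewrite ler_piMr ?(ltW e0)// lerBlDr lerDl exprn_ge0//; lra.
Unshelve. all: by end_near. Qed.

Lemma hausdorff_null (A : set R[i]) :
  (forall delta e, 0 < delta -> 0 < e -> (hausdorff_premeasure h delta A <= e%:E)%E) ->
  hausdorff_measure h A = 0%E.
Proof.
move=> H; have eta0 : 0 < eta by case: gauge_h.
apply: cvg_lim => //; apply: cvg_near_cst; near=> delta.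
have d0 : 0 < delta by [].
have de : delta <= eta by near: delta; exact: nbhs_right_le.
apply/eqP; rewrite eq_le; apply/andP; split.
  by apply/lee_addgt0Pr => e e0; rewrite add0e; exact: H.
apply: le_ereal_inf_tmp => _ [U [Ud _] <-].
apply: nneseries_ge0 => j _ _; rewrite lee_fin.
have := Ud j; have : (0 <= diam (U j))%E by apply: ereal_sup_ubound; left.
case: (diam (U j)) => [r| |] //=; rewrite lee_fin lte_fin => r0 rd.
by apply: h_ge0 => //; exact: lt_le_trans de.
Unshelve. all: by end_near. Qed.

End HausdorffNull.

(** * Pulling covers back *)

Section PullBack.
Variable R : realType.
Variable tau : nat -> R.
Hypothesis tau0 : 200 <= tau 0%N.
Hypothesis tauS : forall k, 2 * tau k <= tau k.+1.
Notation X := (Xk tau).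
Notation Y := (Yk tau).
Notation y := (yk tau).
Notation xi := (xi tau).
Notation phi := (@phi R).
Notation fent := (fent tau).
Notation half_strip := (@half_strip R).
Notation tract := (tract tau).
Notation K0 := (K0 R).

Lemma grid (x B : R) : 0 <= x -> x <= B ->
  exists2 k, (k < (Num.truncn B).+1)%N & k%:R <= x <= k%:R + 1.
Proof.
move=> x0 xB; exists (Num.truncn x); first by rewrite ltnS; exact: le_truncn.
have /andP[-> h] := truncn_itv x0; by rewrite -natr1 in h; exact: ltW.
Qed.

Definition edge (j : nat) : R := -1 + j%:R / 64.
(** Boxes of side 1/64: two points are at distance at most 1/32, the range of
    [fent_expand]. *)
Definition box (j i : nat) : set R[i] := [set s | [/\ half_strip s,
  edge j <= cRe s <= edge j + 64^-1 &
  -4 + i%:R / 64 <= cIm s <= -4 + i%:R / 64 + 64^-1]].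

Lemma edge_ge j : -1 <= edge j.
Proof. by rewrite lerDl divr_ge0. Qed.

Lemma edge_ge2 j : -2 <= edge j.
Proof. by apply: le_trans (edge_ge j); lra. Qed.

Lemma edgeS j : edge j.+1 = edge j + 64^-1.
Proof. by rewrite /edge -natr1 mulrDl mul1r addrA. Qed.

Lemma box_norm j i s s' : box j i s -> box j i s' -> normc (s' - s) <= 32^-1.
Proof.
move=> [_ /andP[a1 a2] /andP[b1 b2]] [_ /andP[a3 a4] /andP[b3 b4]].
apply: le_trans (normc_le_ReIm _) _; rewrite cReB cImB.
have h1 : `|cRe s' - cRe s| <= 64^-1 by rewrite ler_norml; apply/andP; split; lra.
have h2 : `|cIm s' - cIm s| <= 64^-1 by rewrite ler_norml; apply/andP; split; lra.
lra.
Qed.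

Lemma box_Xk j i s s' : box j i s -> box j i s' ->
  normc (X s' - X s) <= normc (s' - s) * y (edge j) (edge j).
Proof.
move=> [h1 /andP[a1 _] _] [h2 /andP[a2 _] _].
have H1 := half_strip_wide h1; have H2 := half_strip_wide h2.
rewrite (XkB tau0 tauS H2 H1) normcM ler_wpM2l ?normc_ge0//.
apply: le_trans (Yk_le tau0 tauS H2 H1) _.
by apply: yk_decr => //; exact: edge_ge2.
Qed.

(** The derivative of the slow map at the left edge of column [j], cut off where
    the column has left the region [|X s| < V]. *)
Definition weight (V : R) j := if xi (edge j) <= V + 1 then y (edge j) (edge j) else 0.

Lemma weight_ge0 V j : 0 <= weight V j.
Proof. by rewrite /weight; case: ifP => // _; apply: yk_ge0 => //; exact: edge_ge2. Qed.

Lemma weight_box V j i s : box j i s -> normc (X s) < V -> weight V j = y (edge j) (edge j).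
Proof.
move=> [hs /andP[a1 _] _] sV; rewrite /weight ifT//.
have H := half_strip_wide hs.
apply: le_trans (xi_mono tau0 tauS (edge_ge2 j) a1) _.
have := Re_Xk_close tau0 tauS H; rewrite ler_norml => /andP[h _].
have := le_lt_trans (ler_norm _) (le_lt_trans (Re_le_normc (X s)) sV).
lra.
Qed.

Let ratio_alg (a b : R) : a <= (1 + 64^-1) * b -> 0 <= b -> a <= 128 * (64^-1 * b).
Proof. by move=> *; lra. Qed.

(** A column at [edge j] gains [xi] by at least [weight V j / 128] over the
    previous one, so the sum telescopes.  The bound does not depend on [tau]. *)
Lemma sum_weight V J : 0 <= V -> \sum_(j < J) weight V j <= 128 * (V + 1).
Proof.
move=> V0; pose e j := edge j - 64^-1.
have e2 j : -2 <= e j by rewrite /e; have := edge_ge j; lra.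
have ed j : e j <= edge j by rewrite /e; lra.
have x2 : 0 <= xi (e 0%N).
  have := Re_Xk_ge tau0 tauS (wide_real (e2 0%N)); rewrite /xi; lra.
pose m j := Num.min (xi (e j)) (V + 1).
have step j : weight V j <= 128 * (m j.+1 - m j).
  have eS : e j.+1 = edge j by rewrite /e edgeS addrK.
  have mono := xi_mono tau0 tauS (e2 j) (ed j).
  rewrite /m eS /weight; case: (leP (xi (edge j)) (V + 1)) => h.
    rewrite (min_l (le_trans mono h)) xiB//; last exact: edge_ge2.
    have -> : edge j - e j = 64^-1 by rewrite /e; ring.
    have r := yk_ratio tau0 tauS (edge_ge2 j) (edge_ge2 j) (e2 j).
    have en : `|e j - edge j| = 64^-1.
      by rewrite /e addrAC subrr add0r normrN ger0_norm.
    rewrite en in r; apply: ratio_alg r (yk_ge0 tau0 tauS (edge_ge2 j) (e2 j)).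
  rewrite mulr_ge0// subr_ge0; by rewrite ge_min lexx orbT.
apply: (@le_trans _ _ (128 * (m J - m 0%N))).
  elim: (J) => [|n IH]; first by rewrite big_ord0 subrr mulr0.
  rewrite big_ord_recr /=; apply: le_trans (lerD IH (step n)) _.
  by rewrite -mulrDr addrC subrKA.
have m0 : 0 <= m 0%N by rewrite le_min x2/=; lra.
have mJ : m J <= V + 1 by rewrite ge_min lexx orbT.
lra.
Qed.

(** There are 512 rows of height 1/64 between -4 and 4, and [grid] adds one for
    the right end. *)
Lemma box_exists V : 0 <= V -> exists J, forall s, half_strip s -> normc (X s) < V ->
  exists j i, [/\ (j < J)%N, (i < 513)%N & box j i s].
Proof.
move=> V0; pose n := (Num.truncn (2 * V)).+1.
have V2 : 0 <= 2 * V by lra.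
have /andP[_ nV] := truncn_itv V2; rewrite -/n in nV.
have tn := tau_gt0 tau0 tauS n.
exists (Num.truncn (64 * (tau n + 1))).+1 => s hs sV.
have [s1 s2] := hs; have H := half_strip_wide hs.
have rn : cRe s < tau n.
  rewrite ltNge; apply/negP => h; have := xi_ge tau0 tauS h.
  have := Re_Xk_close tau0 tauS H; rewrite ler_norml => /andP[k _].
  have := le_lt_trans (ler_norm _) (le_lt_trans (Re_le_normc (X s)) sV).
  lra.
have [|| j jJ /andP[j1 j2]] := @grid (64 * (cRe s + 1)) (64 * (tau n + 1)); [lra|lra|].
have p4 := pi_lt4 R; move: (s2); rewrite ler_norml => /andP[i1 i2].
have [|| i iI /andP[i3 i4]] := @grid (64 * (cIm s + 4)) 512%:R; [lra|lra|].
rewrite natrK in iI.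
exists j, i; split=> //; split=> //; apply/andP; rewrite /edge; split; lra.
Qed.

Let re_alg (F F' P P' G E1 E2 d : R) : d <= 200^-1 -> 2 <= F' -> G <= d ->
  E1 <= 400^-1 -> E2 <= 400^-1 -> P <= E1 + F -> F' <= E2 + P' -> F <= G + F' ->
  P <= 129 / 128 * P'.
Proof. by move=> *; lra. Qed.

Let e128 : 129 / 128 <= expR (128^-1 : R).
Proof. by have := expR_ge1Dx (128^-1 : R); lra. Qed.

(** The modulus of the main term is [exp (Re (cexp s)) / K0]; almost equal values
    of the function have moduli of ratio close to 1. *)
Lemma re_close s s' d : half_strip s -> half_strip s' -> d <= 200^-1 ->
  2 <= normc (fent (X s')) -> normc (fent (X s) - fent (X s')) <= d ->
  cRe (cexp s) - cRe (cexp s') <= 128^-1.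
Proof.
move=> hs hs' d2 f2 ff; have K1 := K0_gt R.
have a1 := fent_inside tau0 tauS hs; have a2 := fent_inside tau0 tauS hs'.
have b1 := normcBD (phi s / K0%:C%C) (fent (X s)); rewrite normcB in b1.
have b2 := normcBD (fent (X s')) (phi s' / K0%:C%C).
have b3 := normcBD (fent (X s)) (fent (X s')).
have c1 : normc (phi s / K0%:C%C) <= 129 / 128 * normc (phi s' / K0%:C%C).
  exact: (re_alg d2 f2 ff a1 a2 b1 b2 b3).
move: c1; rewrite !normc_div normc_K0 mulrA ler_pM2r ?invr_gt0; last by exact: K0_gt0.
rewrite !normc_cexp => c1; rewrite lerBlDr -ler_expR expRD; apply: le_trans c1 _.
by apply: ler_wpM2r; [exact: expR_ge0|exact: e128].
Qed.

Let cell_norm (u v : R[i]) (E k : R) :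
  cRe u - cRe v <= 128^-1 -> cRe v - cRe u <= 128^-1 ->
  k <= 64 * (cIm u + E) -> 64 * (cIm u + E) <= k + 1 ->
  k <= 64 * (cIm v + E) -> 64 * (cIm v + E) <= k + 1 ->
  normc (u - v) <= 32^-1.
Proof.
move=> r1 r2 k1 k2 k3 k4.
apply: le_trans (normc_le_ReIm _) _; rewrite cReB cImB.
have q1 : `|cRe u - cRe v| <= 128^-1 by rewrite ler_norml; apply/andP; split; lra.
have q2 : `|cIm u - cIm v| <= 64^-1 by rewrite ler_norml; apply/andP; split; lra.
lra.
Qed.

Let piece_alg (M e a g d : R) : 1 <= M -> M <= e -> 0 <= a -> 0 <= g ->
  16^-1 * e * g <= d -> g * a <= 16 * a * d / M.
Proof.
move=> M1 Me a0 g0 low; rewrite ler_pdivlMr; last lra.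
have h : M * g <= e * g by apply: ler_wpM2r.
have : a * (M * g) <= a * (16 * d) by apply: ler_wpM2l => //; lra.
lra.
Qed.

(** By [re_close] the real part of [cexp s] is almost constant on the preimage,
    and its imaginary part ranges over an interval of length about
    [exp (Re s)].  Cutting that interval into cells of height 1/64 gives pieces
    to which [fent_expand] applies: each is contracted by [16 exp (- Re s)], so
    the number of pieces cancels the contraction. *)
Lemma box_pull V j i d D U : 0 <= d <= D -> d <= 200^-1 -> U `<=` tract -> diam_le U d ->
  fincov D (257 * 16 * weight V j * d)
    [set X s | s in [set s | [/\ box j i s, normc (X s) < V & U (fent (X s))]]].
Proof.
move=> /andP[d0 dD] d2 UT Ud; set P := [set s | _].
have [[s0 [bs0 sV _]]|nP] := pselect (exists s, P s); last first.
  apply: (fincovW (fincov0 D)).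
    by apply: mulr_ge0; [apply: mulr_ge0; [lra|exact: weight_ge0]|exact: d0].
  by move=> t [s Ps _]; case: nP; exists s.
rewrite (weight_box bs0 sV).
set a := y _ _; set M := Num.max 1 (expR (edge j)).
have M1 : 1 <= M by rewrite le_max lexx.
have Me : expR (edge j) <= M by rewrite le_max lexx orbT.
have a0 : 0 <= a by apply: yk_ge0 => //; exact: edge_ge2.
have a1 : a <= 50^-1 by apply: yk_small => //; exact: edge_ge2.
(* the imaginary part of [cexp s] is at most [2 * M] in modulus, which makes
   [256 * M] cells *)
set n := (Num.truncn (256 * M)).+1.
have nM : n%:R <= 257 * M.
  rewrite /n -natr1; have : (Num.truncn (256 * M))%:R <= 256 * M by rewrite truncn_le; lra.
  lra.
pose c := 16 * a * d / M.
have c0 : 0 <= c by rewrite divr_ge0 ?mulr_ge0//; lra.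
have cd : c <= d.
  rewrite ler_pdivrMr; last lra.
  have : a * d <= 50^-1 * d by apply: ler_wpM2r.
  have : d * 1 <= d * M by apply: ler_wpM2l.
  lra.
pose Q k := [set X s | s in [set s | P s /\
   k%:R <= 64 * (cIm (cexp s) + 2 * M) <= k%:R + 1]].
have cQ k : (k < n)%N -> fincov D c (Q k).
  move=> _; apply: fincov_one; first by rewrite c0 (le_trans cd).
  move=> _ _ [s' [[bs' _ Us'] /andP[k1 k2]] <-] [s [[bs _ Us] /andP[k3 k4]] <-].
  have hs : half_strip s by case: bs.
  have hs' : half_strip s' by case: bs'.
  have fs := tract_norm tau0 tauS (UT _ Us); have fs' := tract_norm tau0 tauS (UT _ Us').
  have ff := Ud _ _ Us' Us; have ff' := Ud _ _ Us Us'.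
  have r1 := re_close hs' hs d2 (ltW fs) ff.
  have r2 := re_close hs hs' d2 (ltW fs') ff'.
  have vv : normc (cexp s' - cexp s) <= 32^-1.
    exact: (cell_norm r1 r2 k1 k2 k3 k4).
  have f1 : 1 <= normc (fent (X s)) by apply: le_trans (ltW fs); rewrite ler1n.
  have [_ low] := fent_expand tau0 tauS hs hs' (box_norm bs bs') vv f1.
  (* the expansion makes up for the number of cells, which is of order [M] *)
  have Ms : M <= expR (cRe s).
    rewrite ge_max (large_expR tau0 tauS hs f1) /= ler_expR.
    by case: bs => _ /andP[].
  apply: le_trans (box_Xk bs bs') _; rewrite -/a.
  exact: (piece_alg M1 Ms a0 (normc_ge0 _) (le_trans low ff)).
apply: (fincovW (fincov_bigcup cQ)).
  rewrite sumr_const card_ord -[leLHS]mulr_natl.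
  apply: (@le_trans _ _ (257 * M * c)); first exact: ler_wpM2r c0 _ _ nM.
  have -> : 257 * M * c = 257 * 16 * a * d by rewrite /c; field; lra.
  by [].
move=> _ [s Ps <-]; have [bs _ _] := Ps.
have h1 : `|cIm (cexp s)| <= 2 * M.
  apply: le_trans (Im_le_normc _) _; rewrite normc_cexp.
  have : expR (cRe s) <= expR (edge j + 2^-1).
    rewrite ler_expR; case: bs => _ /andP[_ h] _; apply: le_trans h _; lra.
  rewrite expRD; have := expR_half_lt2 R.
  have : expR (edge j) * expR 2^-1 <= expR (edge j) * 2.
    by apply: ler_wpM2l; [exact: expR_ge0|exact: expR_half_lt2].
  lra.
move: h1; rewrite ler_norml => /andP[h1 h2].
have [||k kn hk] := @grid (64 * (cIm (cexp s) + 2 * M)) (256 * M); [lra|lra|].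
by exists k => //; exists s.
Qed.

Definition Phi V (A : set R[i]) : set R[i] :=
  [set z | [/\ tract z, normc z < V, tract (fent z) & A (fent z)]].

Definition Cpull (V : R) : R := 513%:R * (257 * 16) * (128 * (V + 1)).

Lemma Cpull_ge0 V : 0 <= V -> 0 <= Cpull V.
Proof.
move=> V0; apply: mulr_ge0; last lra.
by apply: mulr_ge0; [exact: ler0n|lra].
Qed.

Lemma sum_boxes V J (c d : R) : 0 <= V -> 0 <= c -> 0 <= d ->
  \sum_(j < J) \sum_(i < 513) (c * weight V j * d) <= 513%:R * c * (128 * (V + 1)) * d.
Proof.
move=> V0 c0 d0; under eq_bigr do rewrite sumr_const card_ord.
rewrite sumrMnl -mulr_suml -mulr_sumr -[leLHS]mulr_natl mulrA (mulrA 513%:R).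
by apply: ler_wpM2r d0 _ _ (ler_wpM2l (mulr_ge0 (ler0n _ _) c0) (sum_weight J V0)).
Qed.

Lemma Phi_pull V D S A : 0 <= V -> D <= 200^-1 -> fincov D S A ->
  fincov D (Cpull V * S) (Phi V A).
Proof.
move=> V0 D2; apply: fincov_pull; first exact: Cpull_ge0.
- by apply/seteqP; split=> z // [].
- move=> B B'; apply/seteqP; split=> z.
    by move=> [h1 h2 h3 [h|h]]; [left|right].
  by move=> [[h1 h2 h3 h]|[h1 h2 h3 h]]; split=> //; [left|right].
move=> d U /andP[d0 dD] Ud; have [J hJ] := box_exists V0.
pose U' := U `&` tract.
have dU' : diam_le U' d by move=> x x' [Ux _] [Ux' _]; exact: Ud.
have dd : 0 <= d <= D by rewrite d0.
have c1 j : (j < J)%N -> fincov D (\sum_(i < 513) (257 * 16 * weight V j * d))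
    (\bigcup_(i in `I_513)
    [set X s | s in [set s | [/\ box j i s, normc (X s) < V & U' (fent (X s))]]]).
  move=> _; apply: (@fincov_bigcup R D (fun=> 257 * 16 * weight V j * d)) => i _.
  by apply: box_pull => //; [exact: le_trans D2|move=> x []].
apply: (fincovW (fincov_bigcup c1)).
  by apply: (sum_boxes J V0 _ d0); lra.
move=> z [[s hs <-] sV fT Uf]; have [j [i [jJ iI bs]]] := hJ s hs sV.
by exists j => //; exists i => //; exists s.
Qed.

(** No cutting is needed here: each box contributes its image. *)
Lemma base_cover V m D : 0 <= V -> 0 <= D ->
  (forall j i s, box j i s -> m <= normc (X s) -> y (edge j) (edge j) <= D) ->
  fincov D (Cpull V) [set z | tract z /\ m <= normc z < V].
Proof.
move=> V0 D0 hD; have [J hJ] := box_exists V0.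
pose B j i := [set X s | s in [set s | box j i s /\ m <= normc (X s) < V]].
have c0 j i : fincov D (weight V j) (B j i).
  have [[s0 [bs0 /andP[m0 V1]]]|nP] := pselect (exists s, box j i s /\ m <= normc (X s) < V);
    last first.
    apply: (fincovW (fincov0 D)); first exact: weight_ge0.
    by move=> t [s Ps _]; case: nP; exists s.
  rewrite (weight_box bs0 V1).
  have y0 : 0 <= y (edge j) (edge j) by apply: yk_ge0 => //; exact: edge_ge2.
  apply: fincov_one; first by rewrite y0; exact: hD bs0 m0.
  move=> _ _ [s' [bs' _] <-] [s [bs _] <-]; apply: le_trans (box_Xk bs bs') _.
  by apply: ler_piMl => //; apply: le_trans (box_norm bs bs') _; lra.
have c1 j : (j < J)%N -> fincov D (\sum_(i < 513) weight V j) (\bigcup_(i in `I_513) B j i).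
  by move=> _; apply: (@fincov_bigcup R D (fun=> weight V j)) => i _; exact: c0.
apply: (fincovW (fincov_bigcup c1)).
  have e j : weight V j = 1 * weight V j * 1 by rewrite mul1r mulr1.
  under eq_bigr do under eq_bigr do rewrite e.
  apply: le_trans (sum_boxes J V0 ler01 ler01) _; rewrite mulr1.
  apply: ler_wpM2r; first lra.
  by apply: ler_wpM2l; [exact: ler0n|lra].
move=> z [[s hs <-] /andP[mz zV]]; have [j [i [jJ iI bs]]] := hJ s hs zV.
by exists j => //; exists i => //; exists s => //; split=> //; rewrite mz.
Qed.

Definition level V n (A : set R[i]) : set R[i] :=
  [set z | (forall k, (k < n)%N -> tract (iter k fent z) /\ normc (iter k fent z) < V) /\
           A (iter n fent z)].

Lemma level_cover V n D S A : 0 <= V -> D <= 200^-1 -> A `<=` tract -> fincov D S A ->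
  fincov D (Cpull V ^+ n * S) (level V n A).
Proof.
move=> V0 D2 AT cA; elim: n => [|n IH].
  by rewrite expr0 mul1r; apply: (fincovW cA) => // z [].
rewrite exprS -mulrA; apply: (fincovW (Phi_pull V0 D2 IH)) => // z [h Az].
have [t0 z0] := h 0%N isT; rewrite /= in t0 z0.
have h' k : (k < n)%N -> tract (iter k fent (fent z)) /\ normc (iter k fent (fent z)) < V.
  by move=> kn; have := h k.+1 kn; rewrite iterSr.
rewrite iterSr in Az.
split=> //; case: n {IH h} h' Az => [|n] h' Az; first exact: AT.
by case: (h' 0%N isT).
Qed.

End PullBack.

(** * The unbounded orbits *)

Section Unbounded.
Variable R : realType.
Variable tau : nat -> R.
Hypothesis tau0 : 200 <= tau 0%N.
Hypothesis tauS : forall k, 2 * tau k <= tau k.+1.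
Notation fent := (fent tau).
Notation tract := (tract tau).
Variable p : nat -> R.
Variable N : nat -> nat.
Hypothesis Np : forall m n, (N m <= n)%N -> m%:R <= p n.
Hypothesis Nmono : {homo N : m n / (m <= n)%N}.

Definition shell (m : nat) : set R[i] := [set z | tract z /\ m%:R <= normc z < m.+1%:R].

(** Off the tract the next value lies in the disc of radius 1/2, and the orbit is
    trapped by [fent_le_half]. *)
Lemma Unb_tract z : Unb (fent : R[i]^o -> R[i]^o) p z -> forall n, tract (iter n fent z).
Proof.
move=> Uz n; apply: contrapT => nT.
have small k : normc (iter (n.+1 + k) fent z) <= 2^-1.
  elim: k => [|k IH]; first by rewrite addn0; exact: fent_outside nT.
  have IH2 : normc (iter (n.+1 + k) fent z) <= 2 by apply: le_trans IH _; lra.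
  by rewrite addnS iterS; exact: (fent_le_half tau0 tauS IH2).
have [k] := Uz (n.+1 + N 1)%N; rewrite cabsE => nk.
have := Np (leq_trans (leq_addl _ _) nk).
have := small (k - n.+1)%N; rewrite subnKC; last by apply: leq_trans nk; exact: leq_addr.
lra.
Qed.

(** Call [n] good if [n < N (m+1)] for the integer part [m >= m0] of [|f^n z|].
    Good indices exist because [|f^n z| > p n] and [n >= N (m+1)] are
    incompatible.  Before the least good index all moduli are below [m+1]: an
    earlier iterate of larger modulus would be good, as [N] is monotone. *)
Lemma Unb_level m0 z : Unb (fent : R[i]^o -> R[i]^o) p z -> exists m n,
  [/\ (m0 <= m)%N, (n < N m.+1)%N & level tau m.+1%:R n (shell m) z].
Proof.
move=> Uz; have Tz := Unb_tract Uz.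
have tr (x : R) : 0 <= x -> (Num.truncn x)%:R <= x < (Num.truncn x).+1%:R.
  exact: truncn_itv.
pose P n := `[< exists m, [/\ (m0 <= m)%N, (n < N m.+1)%N &
   m%:R <= normc (iter n fent z) < m.+1%:R] >].
have [n [/asboolP[m [mm nN zm]] nmin]] : exists n, P n /\ forall k, P k -> (n <= k)%N.
  have ex : exists n, P n.
    have [n Nn pn] := Uz (N m0); exists n; apply/asboolP.
    rewrite cabsE in pn; have /andP[t1 t2] := tr _ (normc_ge0 (iter n fent z)).
    exists (Num.truncn (normc (iter n fent z))); split; last by rewrite t1.
    - rewrite -ltnS -(ltr_nat R); apply: le_lt_trans t2.
      by apply: le_trans (ltW pn); exact: Np.
    - rewrite ltnNge; apply/negP => /Np h; have := lt_trans pn t2; lra.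
  by exists (ex_minn ex); case: ex_minnP.
exists m, n; split=> //; split; last by split; [exact: Tz|].
move=> k kn; split; first exact: Tz.
rewrite ltNge; apply/negP => mk; have := kn; rewrite ltnNge => /negP; apply; apply: nmin.
have /andP[t1 t2] := tr _ (normc_ge0 (iter k fent z)).
apply/asboolP; set m' := Num.truncn _ in t1 t2; exists m'.
have mm' : (m.+1 <= m')%N by rewrite -ltnS -(ltr_nat R); exact: le_lt_trans t2.
split; last by rewrite t1.
- by apply: leq_trans mm (ltnW mm').
- by apply: leq_trans (ltn_trans kn nN) _; apply: Nmono; exact: leqW.
Qed.

Lemma shell_cover m D : (4 <= m)%N -> 0 < D ->
  (m - 4).+2%:R * 2 ^+ (m - 4) * 8 / D <= tau (m - 4) ->
  fincov D (Cpull m.+1%:R) (shell m).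
Proof.
move=> m4 D0 hD; apply: base_cover => //; first exact: ltW.
move=> j i s bs ms; have [hs /andP[e1 e2] _] := bs.
have ms' : (m - 4)%:R + 4 <= normc (Xk tau s) by rewrite -natrD subnK.
have se : cRe s - 1 <= edge R j by lra.
have := yk_far tau0 tauS (half_strip_wide hs) ms' (edge_ge2 R j) se.
move/le_trans; apply.
by rewrite ler_pdivrMr ?tau_gt0// -ler_pdivrMl// mulrC.
Qed.

End Unbounded.

(** The factor [2 ^ k] gives the doubling, the partial sums the domination. *)
Lemma fast_sequence (R : realType) (g : nat -> R) : exists tau : nat -> R,
  [/\ 200 <= tau 0%N, forall k, 2 * tau k <= tau k.+1 & forall k, g k <= tau k].
Proof.
exists (fun k => 2 ^+ k * (200 + \sum_(i < k.+1) `|g i|)); split.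
- by rewrite expr0 mul1r lerDl sumr_ge0.
- move=> k; rewrite mulrA -exprS ler_wpM2l ?exprn_ge0//.
  by rewrite [X in _ <= _ + X]big_ord_recr /= addrA lerDl.
move=> k; apply: le_trans (ler_norm _) _.
have s0 : 0 <= \sum_(i < k) `|g i| by exact: sumr_ge0.
have g0 := normr_ge0 (g k).
apply: (@le_trans _ _ (1 * (200 + \sum_(i < k.+1) `|g i|))).
  by rewrite mul1r big_ord_recr/=; lra.
apply: ler_wpM2r; first by rewrite addr_ge0// sumr_ge0.
by rewrite exprn_ege1// ler1n.
Qed.

Lemma gauge_small (R : realType) (eta : R) (h : R -> R) (b theta : R) :
  gauge_function eta h -> h t / t @[t --> 0^'+] --> (0 : R) -> 0 < b -> 0 < theta ->
  exists D, [/\ 0 < D, D < b, D < eta & forall t, 0 <= t <= D -> h t <= theta * t].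
Proof.
move=> [eta0 _ _ _ h0] hs b0 th0.
have /cvgrPdist_le/(_ _ th0) := hs.
move=> [r /= r0 hr].
exists (Num.min (r / 2) (Num.min (b / 2) (eta / 2))).
have e1 : r / 2 < r by lra.
have e2 : b / 2 < b by lra.
have e3 : eta / 2 < eta by lra.
split; [by rewrite !lt_min; apply/and3P; split; lra|by rewrite !gt_min e2 orbT|
  by rewrite !gt_min e3 !orbT|].
move=> t /andP[]; rewrite le_eqVlt => /orP[/eqP<-|t0]; first by rewrite h0 mulr0.
rewrite !le_min => /and3P[tr _ _].
have := hr t; rewrite /ball /= sub0r normrN gtr0_norm// => /(_ _ t0).
rewrite sub0r normrN => H; have : `|h t / t| <= theta by apply: H; lra.
by move/(le_trans (ler_norm _)); rewrite ler_pdivrMr.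
Qed.

Theorem theorem2 (R : realType) (p : nat -> R) (hp : p n @[n --> \oo] --> +oo)
    (eta : R) (h : R -> R) (gauge_h : gauge_function eta h)
    (h_small : h t / t @[t --> 0^'+] --> (0 : R)) :
  exists2 f : R[i]^o -> R[i]^o,
    eremenko_lyubich f & hausdorff_measure h (Unb f p) = 0%E.
Proof.
have /choice[N0 hN0] : forall m : nat, exists N, forall n, (N <= n)%N -> m%:R <= p n.
  by move=> m; have /cvgryPge/(_ m%:R)[N _ hN] := hp; exists N.
pose N m := (\sum_(i < m.+1) N0 i)%N.
have Np m n : (N m <= n)%N -> m%:R <= p n.
  move=> h1; apply: hN0; apply: leq_trans h1; rewrite /N big_ord_recr /=; exact: leq_addl.
have Nmono : {homo N : m n / (m <= n)%N}.
  move=> m n mn; rewrite /N -(subnKC mn) -addSn big_split_ord /=; exact: leq_addr.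
(* the factor of one pull back in the region [|z| < m + 1]; it does not depend
   on [tau] *)
pose C (m : nat) : R := Cpull m.+1%:R.
have C0 m : 0 <= C m by apply: Cpull_ge0.
pose S m := \sum_(n < N m.+1) C m ^+ n * C m.
have S0 m : 0 <= S m by apply: sumr_ge0 => n _; rewrite mulr_ge0// exprn_ge0.
(* piece [m] will contribute at most [2 ^ - (m + 1)] *)
pose theta m := (2 ^+ m.+1)^-1 / (S m + 1).
have th0 m : 0 < theta m by rewrite divr_gt0 ?invr_gt0 ?exprn_gt0// ltr_wpDl.
have bp m : 0 < Num.min (m.+1%:R^-1) (200^-1) :> R by rewrite lt_min !invr_gt0 !ltr0n.
have /choice[D hD] := fun m => gauge_small gauge_h h_small (bp m) (th0 m).
have [tau [tau0 tauS tauD]] := fast_sequence (fun k => k.+2%:R * 2 ^+ k * 8 / D (k + 4)%N).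
exists (fent tau); first exact: fent_eremenko_lyubich.
apply: (hausdorff_null gauge_h) => delta e delta0 e0.
(* pieces from [m0] on have diameters below [delta] and total contribution
   below [e] *)
pose m0 := (4 + (Num.truncn e^-1 + Num.truncn delta^-1))%N.
have m0e : (2 ^+ m0)^-1 <= e.
  rewrite -[leRHS]invrK lef_pV2 ?posrE ?exprn_gt0 ?invr_gt0//.
  have ei : 0 <= e^-1 by rewrite invr_ge0 ltW.
  have /andP[_ /ltW h1] := truncn_itv ei; apply: le_trans h1 _.
  rewrite -natrX ler_nat; apply: leq_trans (ltnW (ltn_expl m0 (ltnSn 1))).
  by rewrite /m0; lia.
have m0d m : (m0 <= m)%N -> m.+1%:R^-1 <= delta.
  move=> mm; have di : 0 <= delta^-1 by rewrite invr_ge0 ltW.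
  have /andP[_ /ltW h1] := truncn_itv di.
  rewrite -[leRHS]invrK lef_pV2 ?posrE ?invr_gt0//; apply: le_trans h1 _.
  by rewrite ler_nat; apply: leq_trans (leqW mm); rewrite /m0; lia.
pose F i := \bigcup_(n in `I_(N (m0 + i).+1)) level tau (m0 + i).+1%:R n (shell tau (m0 + i)).
apply: (@premeasure_le R eta h gauge_h _ F (fun i => D (m0 + i)%N) (fun i => S (m0 + i)%N)
  (fun i => theta (m0 + i)%N) delta e e0).
- move=> z Uz; have [m [n [mm nN Lz]]] := Unb_level tau0 tauS Np Nmono m0 Uz.
  by exists (m - m0)%N => //; exists n; rewrite /= subnKC.
- move=> i; set m := (m0 + i)%N; have [D0 Db _ _] := hD m.
  apply: (@fincov_bigcup R (D m) (fun n => C m ^+ n * C m)) => n _.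
  apply: level_cover => //.
  + by move: Db; rewrite lt_min => /andP[_ /ltW].
  + by move=> z [].
  have m4 : (4 <= m)%N by rewrite /m /m0 -addnA leq_addr.
  apply: shell_cover => //; have := tauD (m - 4)%N; by rewrite subnK.
- move=> i; have [D0 Db De _] := hD (m0 + i)%N; rewrite (ltW D0) lt_min De andbT.
  by apply: lt_le_trans Db _; rewrite ge_min m0d// leq_addr.
- by move=> i; exact: ltW.
- by move=> i; have [_ _ _] := hD (m0 + i)%N.
move=> i; set m := (m0 + i)%N.
apply: (@le_trans _ _ (2 ^+ m.+1)^-1).
  rewrite /theta -mulrA ler_piMr ?invr_ge0 ?exprn_ge0// mulrC ler_pdivrMr ?ltr_wpDl//.
  by rewrite mul1r lerDl.
by rewrite /m -addnS exprD invfM; apply: ler_wpM2r; rewrite ?invr_ge0 ?exprn_ge0.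
Qed.
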